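(* For every positive integer $d$ there is a constant $C_d>0$, depending only on $d$, such that the following holds. Let $K$ be a totally real number field of degree $d=[K:\mathbb{Q}]$ with ring of integers $\mathcal{O}_K$, discriminant $\Delta$, and Pythagoras number $\mathcal{P}(\mathcal{O}_K)=P$. Fix a set $\mathcal{S}$ of representatives for the classes of elements $\alpha\in\mathcal{O}_K^+$ with $\mathrm{N}_{K/\mathbb{Q}}(\alpha)\le\Delta$, up to multiplication by squares of units in $\mathcal{O}_K$. Then the diagonal quadratic form $$Q=\sum_{\alpha\in\mathcal{S}}\alpha x_\alpha^2+y_1^2+\dots+y_P^2$$ is universal over $\mathcal{O}_K$ and its rank satisfies $\#\mathcal{S}+P< C_d\,\Delta(\log\Delta)^{d-1}$.
   Context: An element $\gamma\in K$ is totally positive if $\sigma(\gamma)>0$ for every embedding $\sigma:K\hookrightarrow\mathbb{R}$; $\mathcal{O}_K^+$ is the set of totally positive elements of $\mathcal{O}_K$. $\mathrm{N}_{K/\mathbb{Q}}$ is the field norm. The Pythagoras number $\mathcal{P}(\mathcal{O}_K)$ is the smallest positive integer $n$ (or $\infty$) such that every element of $\mathcal{O}_K$ that is a sum of finitely many squares of elements of $\mathcal{O}_K$ is a sum of $n$ squares of elements of $\mathcal{O}_K$. A totally positive definite quadratic form $Q$ over $\mathcal{O}_K$ in $r$ variables (rank $r$) is universal if for every $\gamma\in\mathcal{O}_K^+$ there is $v\in\mathcal{O}_K^r$ with $Q(v)=\gamma$; totally positive definite means that $Q(v)$ is totally positive for all nonzero $v\in K^r$. When $d=1$ the factor $(\log\Delta)^{d-1}$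 is read as $1$. *)

(* Defs.v *)
From HB Require Import structures.
From mathcomp Require Import all_boot all_order all_algebra all_field.
From mathcomp Require Import mathcomp_extra boolp classical_sets.
From mathcomp Require Import reals exp.
From mathcomp Require Import complex.

Set Implicit Arguments.
Unset Strict Implicit.
Unset Printing Implicit Defensive.

Import Order.TTheory GRing.Theory Num.Theory.

Local Open Scope classical_set_scope.
Local Open Scope ring_scope.

Definition totally_real (R : realType) (K : fieldExtType rat) : Prop :=
  forall (sigma : {rmorphism K -> R[i]}) (x : K), sigma x \is Num.real.

Definition totally_positive (R : realType) (K : fieldExtType rat) (x : K) :
    Prop :=
  forall sigma : {rmorphism K -> R}, 0 < sigma x.

Definition ring_of_integers (K : fieldExtType rat) : set K :=
  [set x | integralOver (intr : int -> K) x].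

(* MathComp's [0^-1] is [0], hence the explicit [u != 0]. *)
Definition is_integer_unit (K : fieldExtType rat) (u : K) : Prop :=
  [/\ u != 0, ring_of_integers u & ring_of_integers u^-1].

(* The matrix, in some rational basis, of multiplication by [x]. *)
Definition mul_matrix (K : fieldExtType rat) (x : K) : 'M[rat]_(\dim {:K}) :=
  passmx.mxof (vbasis {:K}) (vbasis {:K}) (amulr x).

Definition field_norm (K : fieldExtType rat) (x : K) : rat :=
  \det (mul_matrix x).

Definition field_trace (K : fieldExtType rat) (x : K) : rat :=
  \tr (mul_matrix x).

Definition is_integral_basis (K : fieldExtType rat)
    (b : (\dim {:K}).-tuple K) : Prop :=
  (forall i, ring_of_integers (tnth b i)) /\
  forall x, ring_of_integers x ->
    exists! c : {ffun 'I_(\dim {:K}) -> int}, x = \sum_i tnth b i *~ c i.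

(* The value does not depend on the choice of the integral basis; the default
   [0] is never used, as every number field has an integral basis. *)
Definition discriminant (K : fieldExtType rat) : rat :=
  xget 0 [set D | exists2 b : (\dim {:K}).-tuple K, is_integral_basis b
    & D = \det (\matrix_(i, j) field_trace (tnth b i * tnth b j))].

Definition is_sum_of_squares (K : fieldExtType rat) (n : nat) (x : K) : Prop :=
  exists2 v : 'I_n -> K, (forall i, ring_of_integers (v i))
    & x = \sum_(i < n) v i ^+ 2.

Definition pythagoras_bound (K : fieldExtType rat) (n : nat) : Prop :=
  forall (m : nat) (x : K), is_sum_of_squares m x -> is_sum_of_squares n x.

(* [P] is a natural number, so this includes finiteness. *)
Definition is_pythagoras_number (K : fieldExtType rat) (P : nat) : Prop :=
  [/\ (0 < P)%N, pythagoras_bound K P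
    & forall n, (0 < n)%N -> pythagoras_bound K n -> (P <= n)%N].

(* Quadratic forms in [r] variables are given by a coefficient matrix [A],
   not necessarily symmetric, so that off-diagonal coefficients may be odd:
   the form is [\sum_(i, j) A i j * v_i * v_j]. *)
Definition qform (K : fieldExtType rat) (r : nat) (A : 'M[K]_r)
    (v : 'rV[K]_r) : K :=
  (v *m A *m v^T) 0 0.

Definition totally_positive_definite (R : realType) (K : fieldExtType rat)
    (r : nat) (A : 'M[K]_r) : Prop :=
  forall v : 'rV[K]_r, v != 0 -> totally_positive R (qform A v).

Definition is_universal (R : realType) (K : fieldExtType rat)
    (r : nat) (A : 'M[K]_r) : Prop :=
  [/\ forall i j, ring_of_integers (A i j),
      totally_positive_definite R A
    & forall g : K, ring_of_integers g -> totally_positive R g ->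
        exists2 v : 'rV[K]_r, (forall i, ring_of_integers (v 0 i))
          & qform A v = g].

Definition small_norm_elements (R : realType) (K : fieldExtType rat) : set K :=
  [set a | [/\ ring_of_integers a, totally_positive R a
             & field_norm a <= discriminant K]].

Definition square_unit_equiv (K : fieldExtType rat) (a b : K) : Prop :=
  exists2 u : K, is_integer_unit u & b = a * u ^+ 2.

Definition is_representative_set (R : realType) (K : fieldExtType rat)
    (S : set K) : Prop :=
  S `<=` @small_norm_elements R K /\
  forall a, small_norm_elements R a ->
    exists! s, S s /\ square_unit_equiv a s.

(* [\sum_(a <- s) a x_a^2 + y_1^2 + ... + y_P^2] *)
Definition diagonal_form (K : fieldExtType rat) (s : seq K) (P : nat) :
    'M[K]_(size s + P) :=
  diag_mx (row_mx (\row_(i < size s) s`_i) (const_mx 1)).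

(* Main.v *)
Require Import Defs.
From HB Require Import structures.
From mathcomp Require Import all_boot all_order all_algebra all_field.
From mathcomp Require Import mathcomp_extra boolp classical_sets.
From mathcomp Require Import reals exp topology normedtype sequences.
From mathcomp Require Import complex.
From mathcomp Require Import zify ring lra.

Set Implicit Arguments.
Unset Strict Implicit.
Unset Printing Implicit Defensive.

Import Order.TTheory GRing.Theory Num.Theory.
Import numFieldNormedType.Exports.

Local Open Scope ring_scope.

(** Universality is a descent that subtracts squares until the norm is small;
    the rank is bounded by treating the Pythagoras number and the number of
    representatives separately.

    Universality.  Let [g] be a totally positive integer.  If its norm exceeds
    the discriminant, the box of all [x] with [`|tau x| < sqrt (tau g)] for
    every embedding [tau] is large enough for Minkowski's theorem on linear
    forms ([minkowski_linear_forms]) to provide a nonzero integer [x] with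
    [g - x ^ 2] still totally positive ([subtract_square]).  The trace of a
    totally positive integer is a positive integer, so after finitely many
    steps [g] is a sum of squares plus a totally positive [a] of norm at most
    the discriminant ([totally_positive_decomposition]).  Then [a] is a
    representative times the square of a unit, and the sum of squares is a sum
    of [P] squares.

    The Pythagoras number is bounded in terms of the degree.  Over an integral
    basis a sum of squares of integers is the value of a sum of squares of
    integral linear forms in [d] variables, so it suffices to bound the number
    of squares for such forms ([bounded_sumsq]).  If the form takes a small
    nonzero value, few of the squares involve the first variable of a suitable
    basis, and the others are forms in fewer variables.  Otherwise the form is
    reduced ([form_reduction]): in a good basis it is bounded below by a
    multiple of the sum of squares of the variables, and there is room to peel
    off one variable with seven squares, four of which come from Lagrange's
    theorem, and to recurse ([large_forms_sumsqS]).

    The number of representatives is at most [2 ^ d] times the number of ways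
    to write a positive integer at most [D] as an ordered product of [d]
    factors ([card_representatives]), where [D] is the discriminant; the latter
    number is at most [D * (1 + ln D) ^ (d - 1)] ([size_factorizations]).  The
    reason is that principal ideals of norm [n] inject into factorizations of
    [n] into [d] factors ([norm_factorization_code]): after inverting the
    elements of norm prime to a prime number [p], the ring of integers is a
    principal ideal ring with at most [d] primes ([local_factorization]).  That
    is proved without ideals: [gcd_at_prime] shows directly that two elements
    have a greatest common divisor which is a combination of them.  Totally
    positive elements that generate the same ideal differ by totally positive
    units, and a growth argument in logarithmic coordinates shows that there are
    at most [2 ^ d] of these modulo squares ([units_mod_squares]).

    Finally the bound is compared with [D * (ln D) ^ (d - 1)], which needs
    [D > 1] when [d > 1] ([discriminant_gt1]). *)

(** * Sums of four squares *)

Definition four_squares (n : int) : Prop :=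
  exists a b c d : int, n = a ^+ 2 + b ^+ 2 + c ^+ 2 + d ^+ 2.

Lemma four_squaresM m n :
  four_squares m -> four_squares n -> four_squares (m * n).
Proof.
move=> [a1 [b1 [c1 [d1 ->]]]] [a2 [b2 [c2 [d2 ->]]]].
exists (a1 * a2 + b1 * b2 + c1 * c2 + d1 * d2).
exists (a1 * b2 - b1 * a2 + c1 * d2 - d1 * c2).
exists (a1 * c2 - c1 * a2 + d1 * b2 - b1 * d2).
exists (a1 * d2 - d1 * a2 + b1 * c2 - c1 * b2).
ring.
Qed.

(** For odd [p], more than half of the elements of ['F_p] are squares, so the
    squares and the values of [- 1 - y ^ 2] cannot be disjoint. *)
Lemma sum_two_squares_Fp (p : nat) :
  prime p -> exists x y : 'F_p, x ^+ 2 + y ^+ 2 + 1 = 0.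
Proof.
move=> pr_p; have [->|p2] := eqVneq p 2.
  by exists 1, 0; apply/eqP.
have odd_p : odd p by case: (even_prime pr_p) p2 => // ->.
pose A : {set 'F_p} := [set x ^+ 2 | x in 'F_p].
pose r (z : 'F_p) := odflt 0 [pick x | x ^+ 2 == z].
have rP (x : 'F_p) : r (x ^+ 2) = x \/ r (x ^+ 2) = - x.
  rewrite /r; case: pickP => [y|/(_ x)]; last by rewrite eqxx.
  by rewrite eqf_sqr => /orP[]/eqP /= ->; [left | right].
pose f (x : 'F_p) := (x ^+ 2, x == r (x ^+ 2)).
have inj_f : injective f.
  move=> x y /eqP; rewrite xpair_eqE => /andP[/eqP exy /eqP]; rewrite exy.
  have [ey h|ny h] := eqVneq y (r (y ^+ 2)).
    by rewrite [RHS]ey; apply/eqP; rewrite h.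
  have nx : x != r (y ^+ 2) by rewrite h.
  move: (rP x) (rP y); rewrite exy.
  case=> ex; first by rewrite ex eqxx in nx.
  case=> ey; first by rewrite ey eqxx in ny.
  by apply: oppr_inj; rewrite -ex -ey.
have leA : (p <= 2 * #|A|)%N.
  apply: (@leq_trans #|'F_p|); first by rewrite card_Fp.
  have -> : (2 * #|A| = #|finset.setX A [set: bool]|)%N.
    by rewrite cardsX cardsT card_bool mulnC.
  rewrite -(card_imset _ inj_f).
  apply: subset_leq_card; apply/fintype.subsetP => _ /imsetP[x _ ->].
  by rewrite !inE andbT; apply/imsetP; exists x.
pose B : {set 'F_p} := [set - 1 - x | x in A].
have cB : #|B| = #|A| by rewrite card_imset // => x y /addrI/oppr_inj.
have [/eqP AB0|[z /setIP[/imsetP[x _ ->] /imsetP[_ /imsetP[y _ ->] e]]]] :=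
  set_0Vmem (A :&: B).
  have := leq_card_setU A B => -[]; rewrite -setI_eq0 AB0 => _ /eqP eAB.
  have := max_card (mem (A :|: B)); rewrite eAB cB card_Fp // => le.
  have /eqP e : (p == 2 * #|A|)%N by rewrite eqn_leq leA mul2n -addnn.
  by move: odd_p; rewrite e oddM.
by exists x, y; rewrite e; ring.
Qed.

Lemma sum_two_squares_mod (p : nat) : prime p ->
  exists x y : int, (p %| x ^+ 2 + y ^+ 2 + 1)%Z.
Proof.
move=> pr_p; have [x [y e]] := sum_two_squares_Fp pr_p.
exists (x : nat)%:Z, (y : nat)%:Z.
have ex (z : 'F_p) : z = (z : nat)%:R by rewrite natr_Zp.
move: e; rewrite [in LHS](ex x) [in LHS](ex y) -!natrX -!natrD -[1]/(1%:R)
  -natrD.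
move/eqP; rewrite -(dvdn_pcharf (pchar_Fp pr_p)) => h.
have -> : (x : nat)%:Z ^+ 2 + (y : nat)%:Z ^+ 2 + 1 = (x ^ 2 + y ^ 2 + 1)%N
  by lia.
exact: h.
Qed.

Lemma balanced_mod (m x : int) : 0 < m ->
  exists2 y, (m %| x - y)%Z & 4 * y ^+ 2 <= m ^+ 2.
Proof.
move=> m0; have h1 := divz_eq x m.
have h2 : 0 <= (x %% m)%Z by rewrite modz_ge0 // gt_eqF.
have h3 := ltz_pmod x m0.
have [le|lt] := lerP (2 * (x %% m)%Z) m.
  exists (x %% m)%Z; last by clear -h2 h3 m0 le; nia.
  by apply/dvdzP; exists (x %/ m)%Z; lia.
exists ((x %% m)%Z - m); last by clear -h2 h3 m0 lt; nia.
by apply/dvdzP; exists ((x %/ m)%Z + 1); lia.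
Qed.

(** Descent: if [m * p] is a sum of four squares and [1 < m < p], reducing the
    four roots modulo [m] and multiplying by Euler's identity gives [r * p]
    with a smaller [r]. *)
Lemma four_squares_prime (p : nat) : prime p -> four_squares p%:Z.
Proof.
move=> pr_p; have p1 := prime_gt1 pr_p.
have p0 : 0 < p%:Z by lia.
have [m [m0 mp fm]] : exists m : nat, [/\ (0 < m)%N, (m < p)%N
    & four_squares (m%:Z * p%:Z)].
  have [x [y dv]] := sum_two_squares_mod pr_p.
  have [x' dx lx] := balanced_mod x p0.
  have [y' dy ly] := balanced_mod y p0.
  have : (p %| x' ^+ 2 + y' ^+ 2 + 1)%Z.
    have -> : x' ^+ 2 + y' ^+ 2 + 1 = (x ^+ 2 + y ^+ 2 + 1) -
       ((x - x') * (x + x') + (y - y') * (y + y')) by ring.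
    by rewrite rpredB // rpredD // dvdz_mulr.
  case/dvdzP => k ek.
  have k0 : 0 < k.
    by rewrite -(pmulr_lgt0 _ p0) -ek ltr_wpDl // addr_ge0 // sqr_ge0.
  have kp : k < p.
    have p2 : p%:Z * p%:Z >= 4 by clear -p1; nia.
    by rewrite -(ltr_pM2r p0) -ek; clear -lx ly p2; lia.
  have ak : `|k|%N%:Z = k by rewrite gez0_abs // ltW.
  exists `|k|%N; split; [by rewrite absz_gt0 gt_eqF | by rewrite -ltz_nat ak |].
  by exists x', y', 1, 0; rewrite ak -ek expr1n expr0n addr0.
elim/ltn_ind: m m0 mp fm => m IH m0 mp fm.
have [m1|m1] := eqVneq m 1%N; first by move: fm; rewrite m1 mul1r.
case: fm => a [b [c [d e]]].
have mz : 0 < m%:Z by lia.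
have [a' /dvdzP[qa ea] la] := balanced_mod a mz.
have [b' /dvdzP[qb eb] lb] := balanced_mod b mz.
have [c' /dvdzP[qc ec] lc] := balanced_mod c mz.
have [d' /dvdzP[qd ed] ld] := balanced_mod d mz.
have {}ea : a = a' + qa * m by rewrite -ea addrC subrK.
have {}eb : b = b' + qb * m by rewrite -eb addrC subrK.
have {}ec : c = c' + qc * m by rewrite -ec addrC subrK.
have {}ed : d = d' + qd * m by rewrite -ed addrC subrK.
pose r := p%:Z - m%:Z * (qa ^+ 2 + qb ^+ 2 + qc ^+ 2 + qd ^+ 2)
  - 2 * (qa * a' + qb * b' + qc * c' + qd * d').
have er : a' ^+ 2 + b' ^+ 2 + c' ^+ 2 + d' ^+ 2 = r * m.
  have : r * m = m%:Z * p%:Z - m%:Z * (m%:Z * (qa ^+ 2 + qb ^+ 2 + qc ^+ 2 + qd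
    ^+ 2)
  + 2 * (qa * a' + qb * b' + qc * c' + qd * d')) by rewrite /r; ring.
  by rewrite e ea eb ec ed => ->; ring.
have mndvd : ~ exists k, p%:Z = k * m%:Z.
  case=> k ek; have : (m %| p)%N by rewrite -[(m %| p)%N]/(m%:Z %| p%:Z)%Z;
    apply/dvdzP; exists k.
  case/primeP: pr_p => _ h /h /orP[]/eqP h1; first by rewrite h1 eqxx in m1.
  by rewrite h1 ltnn in mp.
have r0 : 0 < r.
  have rge : 0 <= r.
    rewrite -(pmulr_lge0 _ mz) -er.
    by rewrite !addr_ge0 // sqr_ge0.
  rewrite lt_neqAle rge andbT; apply/eqP => r0; apply: mndvd.
  have z (x y z t : int) : x ^+ 2 + y ^+ 2 + z ^+ 2 + t ^+ 2 = 0 -> x = 0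
    by clear; nia.
  move: er; rewrite -r0 mul0r => er.
  have a0 : a' = 0 by apply: (z a' b' c' d').
  have b0 : b' = 0 by apply: (z b' a' c' d'); rewrite -[RHS]er; ring.
  have c0 : c' = 0 by apply: (z c' a' b' d'); rewrite -[RHS]er; ring.
  have d0 : d' = 0 by apply: (z d' a' b' c'); rewrite -[RHS]er; ring.
  exists (qa ^+ 2 + qb ^+ 2 + qc ^+ 2 + qd ^+ 2).
  by move: r0; rewrite /r a0 b0 c0 d0; clear; lia.
have rm : r < m.
  have rle : r <= m by rewrite -(ler_pM2r mz) -er; clear -la lb lc ld; lia.
  rewrite lt_neqAle rle andbT; apply/eqP => rm; apply: mndvd.
  (* Equality forces each reduced root to be [m / 2] or [- m / 2]. *)
  have E (x : int) : 4 * x ^+ 2 = m%:Z ^+ 2 -> exists k, 2 * x = m%:Z * k.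
    move=> h; have : (2 * x - m%:Z) * (2 * x + m%:Z) = 0 by clear -h; lia.
    move/eqP; rewrite mulf_eq0 => /orP[]/eqP h'; [exists 1 | exists (-1)];
      clear -h'; lia.
  have [ka ka'] : exists k, 2 * a' = m%:Z * k by apply: E; move: er; rewrite rm;
    clear -la lb lc ld; lia.
  have [kb kb'] : exists k, 2 * b' = m%:Z * k by apply: E; move: er; rewrite rm;
    clear -la lb lc ld; lia.
  have [kc kc'] : exists k, 2 * c' = m%:Z * k by apply: E; move: er; rewrite rm;
    clear -la lb lc ld; lia.
  have [kd kd'] : exists k, 2 * d' = m%:Z * k by apply: E; move: er; rewrite rm;
    clear -la lb lc ld; lia.
  exists (1 + (qa ^+ 2 + qb ^+ 2 + qc ^+ 2 + qd ^+ 2)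
     + (qa * ka + qb * kb + qc * kc + qd * kd)).
  have : r = p%:Z - m%:Z * (qa ^+ 2 + qb ^+ 2 + qc ^+ 2 + qd ^+ 2)
     - (qa * (2 * a') + qb * (2 * b') + qc * (2 * c') + qd * (2 * d')).
    by rewrite /r; ring.
  by rewrite ka' kb' kc' kd' rm => h; clear -h; lia.
have er' : `|r|%N%:Z = r by rewrite gez0_abs // ltW.
apply: (IH `|r|%N); rewrite ?er'.
- by clear -er' rm; lia.
- by clear -er' r0; lia.
- by clear -er' rm mp; lia.
exists (qa * a' + qb * b' + qc * c' + qd * d' + r).
exists (qa * b' - qb * a' + qc * d' - qd * c').
exists (qa * c' - qc * a' + qd * b' - qb * d').
exists (qa * d' - qd * a' + qb * c' - qc * b').
have m2 : m%:Z ^+ 2 != 0 by rewrite expf_neq0 // gt_eqF.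
apply: (mulfI m2).
have -> : m%:Z ^+ 2 * (r * p) = (a' ^+ 2 + b' ^+ 2 + c' ^+ 2 + d' ^+ 2) * (m%:Z
  * p%:Z).
  by rewrite er; ring.
have -> (x y z t : int) : m%:Z ^+ 2 * ((x + r) ^+ 2 + y ^+ 2 + z ^+ 2 + t ^+ 2)
  = (m%:Z * x + r * m%:Z) ^+ 2 + (m%:Z * y) ^+ 2 + (m%:Z * z) ^+ 2 + (m%:Z * t)
    ^+ 2.
  by ring.
by rewrite -er e ea eb ec ed; ring.
Qed.

Lemma four_squares_nat (n : nat) : four_squares n%:Z.
Proof.
elim/ltn_ind: n => n IH; have [n1|n1] := leqP n 1.
  exists n%:Z, 0, 0, 0; rewrite expr0n !addr0.
  by case: n n1 {IH} => [|[|]].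
have := pdiv_dvd n; have pr := pdiv_prime n1; case/dvdnP => k ek.
have p1 := prime_gt1 pr.
rewrite ek PoszM; apply: four_squaresM; last exact: four_squares_prime.
by apply: IH; clear -ek p1 n1; nia.
Qed.

(** * Reduction of positive quadratic forms *)

Definition quad (R : comPzRingType) n (A : 'M[R]_n) (v : 'rV[R]_n) : R :=
  (v *m A *m v^T) 0 0.

Definition dot (R : comPzRingType) n (v w : 'rV[R]_n) : R := (v *m w^T) 0 0.

Definition imx m n (A : 'M[int]_(m, n)) : 'M[rat]_(m, n) := map_mx intr A.

Lemma dotE (R : comPzRingType) n (v w : 'rV[R]_n) :
  dot v w = \sum_i v 0 i * w 0 i.
Proof. by rewrite /dot mxE; apply: eq_bigr => i _; rewrite mxE. Qed.

Lemma dotvv_ge0 (R : realDomainType) n (v : 'rV[R]_n) : 0 <= dot v v.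
Proof. by rewrite dotE sumr_ge0 // => i _; rewrite -expr2 sqr_ge0. Qed.

Lemma quad_congr (R : comPzRingType) m n (A : 'M[R]_n) (U : 'M_(m, n)) v :
  quad (U *m A *m U^T) v = quad A (v *m U).
Proof. by rewrite /quad trmx_mul !mulmxA. Qed.

Lemma quadB (R : comPzRingType) n (A B : 'M[R]_n) v :
  quad (A - B) v = quad A v - quad B v.
Proof. by rewrite /quad mulmxBr mulmxBl !mxE. Qed.

Lemma quadZ (R : comPzRingType) n a (A : 'M[R]_n) v :
  quad (a *: A) v = a * quad A v.
Proof. by rewrite /quad -scalemxAr -scalemxAl mxE. Qed.

Lemma dotC (R : comPzRingType) n (v w : 'rV[R]_n) : dot v w = dot w v.
Proof. by rewrite !dotE; apply: eq_bigr => i _; rewrite mulrC. Qed.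

Lemma quad_rank1 (R : comPzRingType) n (a v : 'rV[R]_n) :
  quad (a^T *m a) v = dot a v ^+ 2.
Proof.
rewrite /quad mulmxA -mulmxA mxE big_ord1 -/(dot v a) -/(dot a v).
by rewrite (dotC v) expr2.
Qed.

Lemma quad_imx n (A : 'M[int]_n) v : quad (imx A) (imx v) = (quad A v)%:~R.
Proof. by rewrite /quad /imx map_trmx -!map_mxM mxE. Qed.

Lemma imxK m n (A B : 'M[int]_(m, n)) : imx A = imx B -> A = B.
Proof.
by move/matrixP => e; apply/matrixP => i j; move: (e i j);
  rewrite !mxE => /intr_inj.
Qed.

Lemma sqr_sum_le (R : realFieldType) n (x : 'I_n -> R) :
  (\sum_i x i) ^+ 2 <= n%:R * \sum_i x i ^+ 2.
Proof.
elim: n x => [|n IH] x; first by rewrite !big_ord0 expr0n mul0r.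
rewrite !big_ord_recr /=; set s := \sum_i _; set q := \sum_i _.
have := IH (fun i => x (widen_ord (leqnSn n) i)); rewrite -/s -/q => h.
move: (x ord_max) => y; case: (posnP n) => [n0|n0].
  have q0 : 0 <= q by apply: sumr_ge0 => i _; rewrite sqr_ge0.
  have : s ^+ 2 <= 0 by move: h; rewrite n0 mul0r.
  move=> s0; have -> : s = 0 by apply/eqP; rewrite -sqrf_eq0 eq_le s0 sqr_ge0.
  by rewrite n0; lra.
have n0' : 0 < n%:R :> R by rewrite ltr0n.
rewrite -natr1 -(ler_pM2l n0').
have := sqr_ge0 (s - n%:R * y).
by have := ler_wpM2l (ltW n0') h; move: h; lra.
Qed.

Lemma dot_le (R : realFieldType) n (a v : 'rV[R]_n) K :
  (forall j, a 0 j ^+ 2 <= K) -> dot a v ^+ 2 <= n%:R * K * dot v v.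
Proof.
move=> aK; rewrite !dotE; apply: (le_trans (sqr_sum_le _)).
rewrite -mulrA ler_wpM2l ?ler0n // mulr_sumr ler_sum // => i _.
by rewrite exprMn -expr2 ler_wpM2r ?sqr_ge0.
Qed.

(** The Schur complement of the corner [m]: completing the square in the first
    variable leaves this form in the others. *)
Definition schur n (m : rat) (a : 'rV[rat]_n) (B : 'M[rat]_n) :=
  B - m^-1 *: (a^T *m a).

Lemma quad_block (R : comPzRingType) n (m t : R) (a v : 'rV_n) (B : 'M_n) :
  quad (block_mx m%:M a a^T B) (row_mx t%:M v : 'rV_(1 + n)) =
    m * t ^+ 2 + 2 * t * dot a v + quad B v.
Proof.
rewrite /quad mul_row_block tr_row_mx mul_row_col !mulmxDl tr_scalar_mx.
rewrite !mul_mx_scalar !mul_scalar_mx -scalemxAl -/(quad B v).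
have addE (X Y : 'M[R]_1) : (X + Y) 0 0 = X 0 0 + Y 0 0 by rewrite mxE.
have scaleE c (X : 'M[R]_1) : (c *: X) 0 0 = c * X 0 0 by rewrite mxE.
rewrite !addE !scaleE -/(dot v a) -/(dot a v) (dotC v) [_%:M 0 0]mxE mulr1n.
by rewrite -/(quad B v); ring.
Qed.

Lemma quad_schur n (m t : rat) (a v : 'rV[rat]_n) (B : 'M_n) : m != 0 ->
  quad (block_mx m%:M a a^T B) (row_mx t%:M v : 'rV_(1 + n)) =
    m * (t + dot a v / m) ^+ 2 + quad (schur m a B) v.
Proof.
by move=> m0; rewrite quad_block /schur quadB quadZ quad_rank1; field.
Qed.

Lemma primitive_row n (v : 'rV[int]_n.+1) : v != 0 ->
  exists U : 'M[int]_n.+1, exists k : int,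
    [/\ U \in unitmx, k != 0 & v = k *: row 0 U].
Proof.
move=> v0; have [L uL [R uR [d _ e]]] := int_Smith_normal_form v.
have {}e : v = (L 0 0 * d`_0) *: row 0 R.
  rewrite e; set D := \matrix_(_, _) _.
  have -> : D = d`_0 *: delta_mx 0 0.
    apply/matrixP => i j; rewrite !mxE ord1 /= eq_sym -val_eqE /=.
    by case: eqP => _; rewrite ?mulr1 ?mulr0.
  by rewrite {1}(mx11_scalar L) mul_scalar_mx -!scalemxAl scalerA -rowE.
exists R, (L 0 0 * d`_0); split => //.
by apply: contraNneq v0 => h; rewrite e h scale0r.
Qed.

Lemma imxM m n p (A : 'M[int]_(m, n)) (B : 'M_(n, p)) :
  imx (A *m B) = imx A *m imx B.
Proof. exact: map_mxM. Qed.

Lemma quad_scale (R : comPzRingType) n (A : 'M[R]_n) k v :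
  quad A (k *: v) = k ^+ 2 * quad A v.
Proof.
rewrite /quad linearZ /= -scalemxAr -!scalemxAl scalerA.
by rewrite [LHS]mxE expr2.
Qed.

(** The minimum is attained because the values of a rational form have a
    common denominator. *)
Lemma exists_min n (A : 'M[rat]_n.+1) (mu : rat) : 0 < mu ->
  (forall v : 'rV[int]_n.+1, v != 0 -> mu <= quad A (imx v)) ->
  exists2 U : 'M[int]_n.+1, U \in unitmx &
    forall v : 'rV[int]_n.+1, v != 0 ->
      quad A (imx (row 0 U)) <= quad A (imx v).
Proof.
move=> mu0 hmu.
pose D := \prod_i \prod_j denq (A i j).
have D0 : 0 < D by apply: prodr_gt0 => i _; apply: prodr_gt0 => j _;
  apply: denq_gt0.
have [B eB] : exists B : 'M[int]_n.+1, D%:~R *: A = imx B.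
  exists (\matrix_(i, j) (numq (A i j) * (D %/ denq (A i j))%Z)).
  apply/matrixP => i j; rewrite !mxE rmorphM /= numqE.
  have dv : (denq (A i j) %| D)%Z.
    by rewrite /D (bigD1 i) //= (bigD1 j) //= -mulrA dvdz_mulr.
  by rewrite -{1}(divzK dv) rmorphM /=; ring.
have qB v : (quad B v)%:~R = D%:~R * quad A (imx v).
  by rewrite -quad_imx -eB quadZ.
have Bpos v : v != 0 -> 0 < quad B v.
  move=> v0; rewrite -(ltr0z rat) qB mulr_gt0 ?ltr0z //.
  exact: lt_le_trans (hmu v v0).
pose P k := `[< exists2 v : 'rV[int]_n.+1, v != 0 & quad B v = k%:Z >].
have exP : exists k, P k.
  exists `|quad B (const_mx 1%R)|%N; apply/asboolP; exists (const_mx 1).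
    by apply/eqP => /matrixP/(_ 0 0); rewrite !mxE.
  rewrite gez0_abs // ltW // Bpos //.
  by apply/eqP => /matrixP/(_ 0 0); rewrite !mxE.
case: (ex_minnP exP) => k /asboolP[v v0 ev] kmin.
have [U [c [uU c0 e]]] := primitive_row v0.
exists U => // w w0.
rewrite -(ler_pM2l (_ : 0 < D%:~R)) ?ltr0z // -!qB ler_int.
apply: (@le_trans _ _ (quad B v)).
  rewrite e quad_scale ler_peMl //.
    by apply/ltW/Bpos; apply: contraNneq v0 => h; rewrite e h scaler0.
  by rewrite -gtz0_ge1 exprn_even_gt0 /= ?c0 ?orbT.
have : P `|quad B w|%N.
  by apply/asboolP; exists w => //; rewrite gez0_abs // ltW // Bpos.
by move/kmin; rewrite ev -lez_nat gez0_abs // ltW // Bpos.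
Qed.

Lemma imx_row_block n t (v : 'rV[int]_n) :
  imx (row_mx t%:M v : 'rV_(1 + n)) = row_mx (t%:~R)%:M (imx v).
Proof. by rewrite /imx map_row_mx map_scalar_mx. Qed.

Lemma row_scalar_eq0 (R : nzRingType) n (t : R) (v : 'rV[R]_n) :
  ((row_mx t%:M v : 'rV_(1 + n)) == 0) = (t == 0) && (v == 0).
Proof.
rewrite row_mx_eq0; congr (_ && _).
apply/eqP/eqP => [/matrixP/(_ 0 0)|->].
  by rewrite !mxE mulr1n.
by apply/matrixP => i j; rewrite !mxE mul0rn.
Qed.

Lemma sym_block n (A : 'M[rat]_(1 + n)) : A^T = A ->
  A = block_mx (A 0 0)%:M (ursubmx A) (ursubmx A)^T (drsubmx A).
Proof.
move=> sA; have -> : (ursubmx A)^T = dlsubmx A by rewrite trmx_ursub sA.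
rewrite -[LHS]submxK; congr block_mx.
apply/matrixP => i j; rewrite !mxE !ord1 mulr1n.
by congr (A _ _); apply/val_inj.
Qed.

Lemma schur_sym n m (a : 'rV[rat]_n) B : B^T = B ->
  (schur m a B)^T = schur m a B.
Proof.
by move=> sB; rewrite /schur linearB linearZ /= trmx_mul trmxK sB.
Qed.

(** Hermite's argument: when the corner [m] is the minimal value, the first
    coordinate can be chosen so that its square contributes at most [m / 4], and
    the other variables must provide the remaining [3 / 4 * m]. *)
Lemma schur_min n (m : rat) (a : 'rV[rat]_n) (B : 'M_n) : 0 < m ->
  (forall v : 'rV[int]_(1 + n), v != 0 ->
    m <= quad (block_mx m%:M a a^T B : 'M_(1 + n)) (imx v)) ->
  forall e, 4 * e <= 3 ->
  forall v : 'rV[int]_n, v != 0 -> e * m <= quad (schur m a B) (imx v).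
Proof.
move=> m0 hm e he v v0; have mn0 : m != 0 by rewrite gt_eqF.
have {}he : 4 * (e * m) <= 3 * m by rewrite mulrA ler_wpM2r // ltW.
 pose x := dot a (imx v) / m.
pose t : int := - Num.floor (x + 1 / 2).
have tv : (row_mx t%:M v : 'rV_(1 + n)) != 0.
  by rewrite row_scalar_eq0 (negbTE v0) andbF.
have := hm _ tv; rewrite imx_row_block (quad_schur _ _ _ _ mn0) -/x.
have h1 : (Num.floor (x + 1 / 2))%:~R <= x + 1 / 2 by exact: floor_le.
have h2 : x + 1 / 2 < (Num.floor (x + 1 / 2))%:~R + 1.
  by have := floorD1_gt (x + 1 / 2); rewrite rmorphD.
have et : t%:~R = - (Num.floor (x + 1 / 2))%:~R :> rat by rewrite rmorphN.
have : (t%:~R + x) ^+ 2 <= 1 / 4 by rewrite et; nra.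
move=> h; have : m * (t%:~R + x) ^+ 2 <= m * (1 / 4)
  by rewrite ler_wpM2l // ltW.
by move: he; lra.
Qed.

(** Applying [U] to the last variables and adding multiples of the first one to
    them has independent effects: the Schur complement only sees [U], while the
    first row moves modulo [m]. *)
Lemma block_change n (m : rat) (a : 'rV[rat]_n) (B : 'M_n)
    (U : 'M[int]_n) (k : 'rV[int]_n) :
  U \in unitmx -> m != 0 ->
  exists V : 'M[int]_(1 + n), exists B' : 'M_n,
    let a' := m *: imx k + a *m (imx U)^T in
  [/\ V \in unitmx,
    imx V *m block_mx m%:M a a^T B *m (imx V)^T = block_mx m%:M a' a'^T B' &
    schur m a' B' = imx U *m schur m a B *m (imx U)^T].
Proof.
move=> uU m0; pose V : 'M[int]_(1 + n) := block_mx 1%:M 0 k^T U.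
pose a' := m *: imx k + a *m (imx U)^T.
exists V, (imx U *m schur m a B *m (imx U)^T + m^-1 *: (a'^T *m a')) => a''.
split; first by rewrite unitmxE det_lblock det1 mul1r -unitmxE.
  have -> : imx V = block_mx 1%:M 0 (imx k)^T (imx U).
    by rewrite /imx map_block_mx map_mx1 map_mx0 map_trmx.
  rewrite tr_block_mx !mulmx_block !mul1mx !mul0mx !addr0 trmx1 trmx0 !mulmx0.
  rewrite !mulmx1 !addr0 trmxK.
  congr block_mx.
  - by rewrite mul_scalar_mx.
  - by rewrite mul_mx_scalar /a'' linearD linearZ /= trmx_mul trmxK.
  rewrite mul_mx_scalar /schur -/a'' mulmxBr mulmxBl -scalemxAr -scalemxAl.
  have eX : imx U *m a^T = (a *m (imx U)^T)^T by rewrite trmx_mul trmxK.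
  rewrite mulmxDl -[_ *m (a^T *m a) *m _]mulmxA -[a^T *m a *m _]mulmxA.
  rewrite [imx U *m (_ *m _)]mulmxA mulmxDl -[(imx k)^T *m a *m _]mulmxA.
  rewrite eX /a'; move: (a *m _) (imx k) (imx U *m B *m _) => X K Z.
  rewrite [(_ + _)^T]linearD /= [(m *: _)^T]linearZ /= mulmxDl !mulmxDr
    -!scalemxAl -!scalemxAr.
  move: (K^T *m K) (K^T *m X) (X^T *m K) (X^T *m X) => P1 P2 P3 P4.
  by apply/matrixP => i j; rewrite !mxE; field.
by rewrite /schur -/a'' addrK.
Qed.

Lemma quad_row (R : comPzRingType) m n (A : 'M[R]_n) (M : 'M_(m, n)) i :
  quad A (row i M) = (M *m A *m M^T) i i.
Proof.
rewrite /quad -row_mul tr_row !mxE; apply: eq_bigr => j _.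
by rewrite !mxE.
Qed.

Definition bounded_below n (A : 'M[rat]_n) (mu : rat) :=
  forall v : 'rV[int]_n, v != 0 -> mu <= quad A (imx v).

Lemma bounded_below_congr n (A : 'M[rat]_n) (U : 'M[int]_n) mu :
  U \in unitmx -> bounded_below A mu ->
  bounded_below (imx U *m A *m (imx U)^T) mu.
Proof.
move=> uU hA v v0; rewrite quad_congr -imxM; apply: hA.
by apply: contraNneq v0 => h; rewrite -(mulmxK uU v) h mul0mx.
Qed.

(** All that is needed of reduction theory: one constant serves for all the
    forms of a given dimension. *)
Definition reduces_to_sum_squares n := exists2 c : rat, 0 < c &
  forall (A : 'M[rat]_n) mu, A^T = A -> 0 < mu -> bounded_below A mu ->
  exists2 U : 'M[int]_n, U \in unitmx &
    forall v, c * mu * dot (imx v) (imx v) <=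
      quad (imx U *m A *m (imx U)^T) (imx v).

Definition reduces_to_block n := exists2 c : rat, 0 < c &
  forall (A : 'M[rat]_(1 + n)) mu, A^T = A -> 0 < mu -> bounded_below A mu ->
  exists U : 'M[int]_(1 + n), exists m (a : 'rV[rat]_n) B,
  [/\ U \in unitmx,
      imx U *m A *m (imx U)^T = block_mx m%:M a a^T B,
      mu <= m,
      forall j, 0 <= a 0 j < m &
      forall v, c * m * dot (imx v) (imx v) <= quad (schur m a B) (imx v)].

(** A minimal vector is put first; the Schur complement, whose minimum is at
    least a fixed multiple of the new corner [m], is then reduced by induction,
    and the first row is brought into [[0, m)]. *)
Lemma reduces_to_block_of n :
  reduces_to_sum_squares n -> reduces_to_block n.
Proof.
move=> [c c0 hc]; have [e e0 he] : exists2 e : rat, 0 < e & 4 * e <= 3.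
  by exists 2^-1; lra.
exists (c * e); first by rewrite mulr_gt0.
move=> A mu sA mu0 hA; have [U0 uU0 minU0] := exists_min mu0 hA.
pose A0 : 'M[rat]_(1 + n) := imx U0 *m A *m (imx U0)^T.
have sA0 : A0^T = A0 by rewrite /A0 !trmx_mul trmxK sA mulmxA.
have eA0 := sym_block sA0.
set m := A0 0 0 in eA0; set a := ursubmx A0 in eA0; set B := drsubmx A0 in eA0.
have em : m = quad A (imx (row 0 U0)).
  by rewrite /m /A0 -quad_row /imx map_row.
have mum : mu <= m.
  rewrite em; apply: hA; apply/eqP => /matrixP h.
  have : \det U0 = 0 by rewrite (expand_det_row _ 0) big1 // => j _;
    have := h 0 j; rewrite !mxE => ->; rewrite mul0r.
  by move: uU0; rewrite unitmxE => + U00; rewrite U00 unitr0.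
have m0 : 0 < m by apply: lt_le_trans mum.
have bA0 : bounded_below A0 m.
  by apply: bounded_below_congr => // v v0; rewrite em minU0.
have sB : B^T = B by rewrite /B trmx_drsub sA0.
have sS := schur_sym m a sB.
have bS : bounded_below (schur m a B) (e * m).
  by apply: schur_min he => // v v0; rewrite -eA0; apply: bA0.
have mn0 : m != 0 by rewrite gt_eqF.
have em0 : 0 < e * m by rewrite mulr_gt0.
have [U uU hU] := hc _ _ sS em0 bS.
pose k : 'rV[int]_n := \row_j - Num.floor ((a *m (imx U)^T) 0 j / m).
have [V [B' [uV eV eS]]] := block_change a B k uU mn0.
exists (V *m U0), m, (m *: imx k + a *m (imx U)^T), B'; split => //.
- by rewrite unitmx_mul uV.
- by rewrite -eV imxM trmx_mul -eA0 /A0 !mulmxA.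
- move=> j.
  have kE : imx k 0 j = - (Num.floor ((a *m (imx U)^T) 0 j / m))%:~R.
    by rewrite !mxE rmorphN.
  rewrite mxE; have -> : (m *: imx k) 0 j = m * imx k 0 j by rewrite mxE.
  rewrite kE; move: ((a *m _) 0 j) => x.
  have h1 : (Num.floor (x / m))%:~R <= x / m by exact: floor_le.
  have h2 : x / m < (Num.floor (x / m))%:~R + 1.
    by have := floorD1_gt (x / m); rewrite rmorphD.
  have ex : x = m * (x / m) by field; rewrite gt_eqF.
  rewrite {2 4}ex; move: (x / m) h1 h2 => y h1 h2.
  rewrite -mulrDr mulr_ge0 ?(ltW m0) //=; last by lra.
  by rewrite -[X in _ < X]mulr1 ltr_pM2l //; lra.
by move=> v; have := hU v; rewrite eS !mulrA.
Qed.

Lemma reduces_to_sum_squares0 : reduces_to_sum_squares 0.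
Proof.
exists 1 => // A mu _ _ _; exists 1%:M; first exact: unitmx1.
by move=> v; rewrite [imx v]thinmx0 dotE big_ord0 mulr0 /quad mul0mx mul0mx mxE.
Qed.

Lemma small_constant (R : realFieldType) (n c : R) : 0 <= n -> 0 < c ->
  exists c', [/\ 0 < c', 2 * c' <= 1 & c' * (2 * n + 1) <= c].
Proof.
move=> n0 c0; have n1 : 0 < 2 * n + 1 by lra.
exists (Num.min (1 / 2) (c / (2 * n + 1))); split.
- by rewrite lt_min !divr_gt0.
- by rewrite -ler_pdivlMl // mulrC ge_min lexx.
by rewrite -ler_pdivlMr // ge_min lexx orbT.
Qed.

(** With [y] the shift of the first variable [x] in the completed square, [y] is
    controlled by the other variables, so [x ^ 2] is at most a combination of
    [(x + y) ^ 2] and the sum of their squares. *)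
Lemma reduces_to_sum_squaresS n :
  reduces_to_block n -> reduces_to_sum_squares n.+1.
Proof.
move=> [c c0 hc].
have [c' [c'0 c'1 c'2]] := small_constant (ler0n rat n) c0.
exists c' => // A mu sA mu0 hA.
have [U [m [a [B [uU eU mum am hS]]]]] := hc A mu sA mu0 hA.
exists U => // v; rewrite eU.
have m0 : 0 < m by apply: lt_le_trans mum.
pose t := v 0 0; pose w : 'rV[int]_n := rsubmx (v : 'rV_(1 + n)).
have -> : v = (row_mx t%:M w : 'rV_(1 + n)).
  have <- : lsubmx (v : 'rV_(1 + n)) = t%:M.
    apply/matrixP => i j; rewrite !mxE !ord1 mulr1n /t.
    by congr (v _ _); apply/val_inj.
  exact: (esym (hsubmxK (v : 'rV_(1 + n)))).
rewrite imx_row_block quad_schur ?gt_eqF //.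
have -> : dot (row_mx (t%:~R)%:M (imx w) : 'rV[rat]_(1 + n)) (row_mx (t%:~R)%:M
  (imx w)) =
    t%:~R ^+ 2 + dot (imx w) (imx w).
  rewrite {1}/dot tr_row_mx mul_row_col tr_scalar_mx -scalar_mxM mxE.
  by rewrite [_%:M 0 0]mxE mulr1n expr2.
have := hS w; set S := quad _ _; set q := dot _ _ => hSw.
have q0 : 0 <= q by apply: dotvv_ge0.
set y := dot a (imx w) / m; set x := t%:~R.
have hy : y ^+ 2 <= n%:R * q.
  have := @dot_le _ _ (m^-1 *: a) (imx w) 1.
  rewrite -/q mulr1; have -> : dot (m^-1 *: a) (imx w) = y.
    by rewrite /dot -scalemxAl mxE mulrC.
  apply => j; rewrite mxE mulrC; have /andP[h1 h2] := am j.
  have h3 : 0 <= a 0 j / m by rewrite divr_ge0 // ltW.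
  have h4 : a 0 j / m <= 1 by rewrite ler_pdivrMr // mul1r ltW.
  by rewrite expr_le1.
have h1 : c' * (x ^+ 2 + q) <= (x + y) ^+ 2 + c * q.
  have h2 : x ^+ 2 <= 2 * (x + y) ^+ 2 + 2 * y ^+ 2.
    by have := sqr_ge0 (x + 2 * y); lra.
  have h3 : c' * x ^+ 2 <= c' * (2 * (x + y) ^+ 2 + 2 * (n%:R * q)).
    by rewrite ler_wpM2l ?(ltW c'0) //; lra.
  have h4 : 2 * c' * (x + y) ^+ 2 <= 1 * (x + y) ^+ 2.
    by rewrite ler_wpM2r // sqr_ge0.
  have h5 : c' * (2 * n%:R + 1) * q <= c * q by rewrite ler_wpM2r.
  lra.
have q1 : 0 <= x ^+ 2 + q by rewrite addr_ge0 // sqr_ge0.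
apply: (@le_trans _ _ (m * (c' * (x ^+ 2 + q)))).
  rewrite mulrCA mulrA ler_wpM2r // ler_wpM2l // ltW //.
have : m * (c' * (x ^+ 2 + q)) <= m * ((x + y) ^+ 2 + c * q).
  by rewrite ler_wpM2l // ltW.
by move: hSw; lra.
Qed.

Lemma form_reduction n : reduces_to_block n.
Proof.
apply: reduces_to_block_of.
elim: n => [|n IH]; first exact: reduces_to_sum_squares0.
exact/reduces_to_sum_squaresS/reduces_to_block_of.
Qed.

(** * Sums of boundedly many squares of integral linear forms *)

(** The Gram matrix of the form [\sum_(v <- s) (dot v x) ^ 2]. *)
Definition sumsq n (s : seq 'rV[int]_n) : 'M[int]_n :=
  \sum_(v <- s) v^T *m v.

Lemma sumsq_sym n (s : seq 'rV[int]_n) : (sumsq s)^T = sumsq s.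
Proof.
by rewrite /sumsq linear_sum; apply: eq_bigr => v _; rewrite /= trmx_mul trmxK.
Qed.

Lemma quad_sumsq n (s : seq 'rV[int]_n) v :
  quad (sumsq s) v = \sum_(u <- s) dot u v ^+ 2.
Proof.
rewrite /quad /sumsq mulmx_sumr mulmx_suml summxE; apply: eq_bigr => u _.
exact: quad_rank1.
Qed.

Lemma sumsq_cat n (s1 s2 : seq 'rV[int]_n) :
  sumsq (s1 ++ s2) = sumsq s1 + sumsq s2.
Proof. by rewrite /sumsq big_cat. Qed.

Lemma sumsq_map m n (M : 'M[int]_(m, n)) (s : seq 'rV[int]_m) :
  sumsq [seq v *m M | v <- s] = M^T *m sumsq s *m M.
Proof.
rewrite /sumsq big_map mulmx_sumr mulmx_suml; apply: eq_bigr => v _.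
by rewrite trmx_mul !mulmxA.
Qed.

Lemma sumsq_lift n (s : seq 'rV[int]_n) :
  sumsq [seq (row_mx 0 v : 'rV_(1 + n)) | v <- s] = block_mx 0 0 0 (sumsq s).
Proof.
elim: s => [|v s IH]; first by rewrite /sumsq !big_nil block_mx0.
rewrite /sumsq /= !big_cons in IH *; rewrite IH tr_row_mx mul_col_row.
by rewrite !trmx0 !mul0mx mulmx0 add_block_mx !addr0.
Qed.

Lemma row_block_sq n (x : int) (v : 'rV[int]_n) :
  (row_mx x%:M v : 'rV_(1 + n))^T *m (row_mx x%:M v : 'rV_(1 + n)) =
  block_mx (x ^+ 2)%:M (x *: v) (x *: v)^T (v^T *m v).
Proof.
rewrite tr_row_mx mul_col_row tr_scalar_mx -scalar_mxM mul_scalar_mx.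
by rewrite mul_mx_scalar linearZ /= expr2.
Qed.

Lemma isqrt (N : nat) : exists s : nat, (s ^ 2 <= N < s.+1 ^ 2)%N.
Proof.
elim: N => [|N [s /andP[h1 h2]]]; first by exists 0%N.
have [h|h] := ltnP N.+1 (s.+1 ^ 2)%N; first by exists s; rewrite h; lia.
exists s.+1; rewrite h /=; nia.
Qed.

(** The error made by replacing [(x / sqrt m) ^ 2] by the squares of rounded
    forms is a small fraction of [c * m * Q]: here [x], [r], [k], [l] stand for
    the values of linear forms with coefficients at most [m], [s], [s / q] and
    [q]. *)
Lemma peel_error (R : realFieldType) (n c q eta m s x r k l Q : R) :
  0 <= n -> 0 < c -> 0 < q -> 0 < eta -> eta <= 1 -> 0 < s -> 0 < m -> 0 <= Q ->
  8 * n <= c * q ^+ 2 -> 24 * eta * n <= c -> m <= (1 + eta) * s ^+ 2 ->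
  s ^+ 2 <= m -> 8 * (n * q ^+ 2 + (1 + eta^-1) * n) <= c * m ->
  x ^+ 2 <= n * m ^+ 2 * Q -> r ^+ 2 <= n * s ^+ 2 * Q ->
  (q * k) ^+ 2 <= n * s ^+ 2 * Q -> l ^+ 2 <= n * q ^+ 2 * Q ->
  ((x - r) / s) ^+ 2 + k ^+ 2 + l ^+ 2 <= x ^+ 2 / m + 3 / 8 * c * m * Q.
Proof.
move=> n0 c0 q0 eta0 eta1 s0 m0 Q0 hq heta ms sm hm hx hr hk hl.
have mQ : 0 <= m * Q by rewrite mulr_ge0 // ltW.
have h1 : (x - r) ^+ 2 <= (1 + eta) * x ^+ 2 + (1 + eta^-1) * r ^+ 2.
  have := sqr_ge0 (eta * x + r).
  rewrite -(pmulr_rge0 _ (_ : 0 < eta^-1)) ?invr_gt0 // => h.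
  have -> : (1 + eta) * x ^+ 2 + (1 + eta^-1) * r ^+ 2
     = (x - r) ^+ 2 + eta^-1 * (eta * x + r) ^+ 2 by field; rewrite gt_eqF.
  by rewrite lerDl.
have s2 : 0 < s ^+ 2 by rewrite exprn_gt0.
have h2 : (1 + eta) * x ^+ 2 / s ^+ 2 <= x ^+ 2 / m + c * m * Q / 8.
  have i1 : (s ^+ 2)^-1 <= (1 + eta) / m.
    by rewrite ler_pdivlMr // mulrC ler_pdivrMr // .
  have x2 := sqr_ge0 x.
  have i2 : (1 + eta) * x ^+ 2 / s ^+ 2 <= (1 + eta) * x ^+ 2 * ((1 + eta) / m).
    by rewrite ler_wpM2l // mulr_ge0 //; lra.
  apply: (le_trans i2).
  have i3 : (1 + eta) * x ^+ 2 * ((1 + eta) / m) <= x ^+ 2 / m + 3 * eta * (x ^+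
    2 / m).
    have -> : (1 + eta) * x ^+ 2 * ((1 + eta) / m) = (1 + eta) ^+ 2 * (x ^+ 2 /
      m).
      by field; rewrite gt_eqF.
    have : 0 <= x ^+ 2 / m by rewrite divr_ge0 // ltW.
    move: (x ^+ 2 / m) => z z0.
    have : (1 + eta) ^+ 2 <= 1 + 3 * eta by nra.
    by move/(ler_wpM2r z0); lra.
  apply: (le_trans i3); rewrite lerD2l.
  have i4 : x ^+ 2 / m <= n * m * Q by rewrite ler_pdivrMr //; lra.
  have i5 : 3 * eta * (x ^+ 2 / m) <= 3 * eta * (n * m * Q).
    by rewrite ler_wpM2l //; lra.
  by have := ler_wpM2r mQ heta; lra.
have h3 : (1 + eta^-1) * r ^+ 2 / s ^+ 2 <= (1 + eta^-1) * n * Q.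
  have e1 : 0 <= 1 + eta^-1 by rewrite addr_ge0 ?invr_ge0 ?ltW.
  by rewrite ler_pdivrMr //; have := ler_wpM2l e1 hr; lra.
have h4 : k ^+ 2 <= c * m * Q / 8.
  have q2 : 0 < q ^+ 2 by rewrite exprn_gt0.
  rewrite -(ler_pM2l q2) -exprMn; apply: (le_trans hk).
  have : n * s ^+ 2 * Q <= n * m * Q.
    by rewrite ler_wpM2r // ler_wpM2l.
  by have := ler_wpM2r mQ hq; lra.
have h5 : (1 + eta^-1) * n * Q + n * q ^+ 2 * Q <= c * m * Q / 8.
  by have := ler_wpM2r Q0 hm; lra.
have h6 : ((x - r) / s) ^+ 2 <= ((1 + eta) * x ^+ 2 + (1 + eta^-1) * r ^+ 2) / s
  ^+ 2.
  by rewrite expr_div_n ler_wpM2r ?invr_ge0 // ltW.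
move: h6; rewrite mulrDl; lra.
Qed.

(** The constants are chosen in this order: [q] makes the second vector
    negligible, [eta] bounds the relative gap between [s ^ 2] and [m], and
    beyond the threshold [T] the integer [s] is large enough for that gap and
    the remainder exceeds [T0]. *)
Lemma peel_constants (R : archiRealFieldType) (n c T0 : R) : 0 <= n -> 0 < c ->
  exists (q : nat) (eta : R) (s0 : nat) (T : R),
  [/\ [/\ (0 < q)%N /\ (0 < s0)%N, 8 * n <= c * q%:R ^+ 2, 0 < eta, eta <= 1 &
          24 * eta * n <= c],
      0 < T & forall m, T <= m ->
      [/\ (s0 ^ 2 + q ^ 2 + 1)%:R <= m,
          8 * (n * q%:R ^+ 2 + (1 + eta^-1) * n) <= c * m,
          forall Q, 1 <= Q -> T0 <= 5 / 8 * c * m * Q &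
          forall s, (s0 <= s)%N -> 2 * s%:R + q%:R ^+ 2 + 2 <= eta * s%:R ^+
            2]].
Proof.
move=> n0 c0.
have [q [q0 hq]] : exists q : nat, (0 < q)%N /\ 8 * n <= c * q%:R ^+ 2.
  pose q := (Num.truncn (8 * n / c)).+1; exists q; split => //.
  have h : 8 * n / c < q%:R by apply: truncnS_gt.
  rewrite [c * _]mulrC -ler_pdivrMr //; apply: (le_trans (ltW h)).
  by rewrite -natrX ler_nat expnS leq_pmulr.
pose eta : R := Num.min 1 (c / (24 * (n + 1))).
have h24 : 0 < 24 * (n + 1) by lra.
have eta0 : 0 < eta by rewrite lt_min ltr01 divr_gt0.
have eta1 : eta <= 1 by rewrite ge_min lexx.
have heta : 24 * eta * n <= c.
  have : eta <= c / (24 * (n + 1)) by rewrite ge_min lexx orbT.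
  by rewrite ler_pdivlMr // => h'; lra.
pose s0 := (Num.truncn ((q%:R ^+ 2 + 4) / eta)).+1.
pose T1 : R := 8 * (n * q%:R ^+ 2 + (1 + eta^-1) * n) / c.
have T10 : 0 <= T1.
  rewrite divr_ge0 ?(ltW c0) // mulr_ge0 // addr_ge0 // mulr_ge0 ?sqr_ge0 //.
  by rewrite addr_ge0 // invr_ge0 ltW.
have T00 : 0 <= 2 * `|T0| / c by rewrite divr_ge0 ?(ltW c0) // mulr_ge0.
have N0 : 0 < (s0 ^ 2 + q ^ 2 + 1)%:R :> R by rewrite ltr0n addn1.
exists q, eta, s0, ((s0 ^ 2 + q ^ 2 + 1)%:R + T1 + 2 * `|T0| / c).
split; [by split | by lra |].
move=> m hm; split; first by lra.
- have : T1 <= m by lra.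
  by rewrite ler_pdivrMr // [m * c]mulrC.
- have : 2 * `|T0| / c <= m by lra.
  rewrite ler_pdivrMr // => h Q Q1.
  have h1 : T0 <= 5 / 8 * c * m by have := ler_norm T0; have := normr_ge0 T0;
    lra.
  have h2 : 0 <= c * m by have := normr_ge0 T0; lra.
  by have := ler_wpM2l h2 Q1; lra.
move=> s s0s.
have h : (q%:R ^+ 2 + 4) / eta < s%:R.
  by apply: (lt_le_trans (truncnS_gt _)); rewrite ler_nat.
have s1 : 1 <= s%:R :> R by rewrite ler1n; apply: leq_trans s0s.
rewrite ltr_pdivrMr // in h.
have q2 := sqr_ge0 (q%:R : R); nra.
Qed.

Lemma dotvv_ge1 n (v : 'rV[int]_n) : v != 0 -> 1 <= dot (imx v) (imx v).
Proof.
move=> v0; have [i vi] : exists i, v 0 i != 0.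
  apply/existsP; rewrite -negb_forall; apply: contra v0 => /forallP h.
  by apply/eqP/matrixP => i j; rewrite ord1 mxE; apply/eqP.
rewrite dotE (bigD1 i) //= mxE -expr2 -[1]addr0 lerD //.
  rewrite -rmorphXn /= -[1]/(1%:~R) ler_int -gtz0_ge1.
  by rewrite exprn_even_gt0 /= ?vi ?orbT.
by apply: sumr_ge0 => j _; rewrite -expr2 sqr_ge0.
Qed.

Lemma dotZl (R : comPzRingType) n c (v w : 'rV[R]_n) :
  dot (c *: v) w = c * dot v w.
Proof. by rewrite /dot -scalemxAl mxE. Qed.

Lemma dotBl (R : comPzRingType) n (u v w : 'rV[R]_n) :
  dot (u - v) w = dot u w - dot v w.
Proof. by rewrite /dot mulmxBl !mxE. Qed.

Definition large_forms_sumsq n := exists T : rat, exists N : nat,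
  forall A : 'M[int]_n, A^T = A -> bounded_below (imx A) T ->
  exists2 s, (size s <= N)%N & A = sumsq s.

(** One variable is peeled off a reduced form.  With [s] close to [sqrt m],
    the squares of [s x_0 + t x], [q x_0 + kappa x], [x_0 + lambda x] and four
    squares of multiples of [x_0] account exactly for the first row [m, a];
    what they take away from the other variables differs little from
    [(a x) ^ 2 / m], so that the remainder is still large. *)
Lemma large_forms_sumsqS n :
  large_forms_sumsq n -> large_forms_sumsq n.+1.
Proof.
move=> [T0 [N0 H0]]; have [c c0 hc] := form_reduction n.
have nr0 : 0 <= n%:R :> rat by rewrite ler0n.
have [q [eta [s0 [T [[[q0 s00] hq eta0 eta1 heta] T0' hT]]]]] :=
  peel_constants T0 nr0 c0.
exists T, (7 + N0)%N => A sA hA.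
have sA' : (imx A)^T = imx A by rewrite /imx map_trmx sA.
have [U [m [a [B [uU eU Tm am hS]]]]] := hc (imx A) T sA' T0' hA.
pose A1 : 'M[int]_(1 + n) := U *m A *m U^T.
have eA1 : imx A1 = block_mx m%:M a a^T B by rewrite -eU !imxM /imx map_trmx.
pose mi := A1 0 0; pose ai := ursubmx A1; pose Bi := drsubmx A1.
have em : m = mi%:~R.
  have : imx A1 0 0 = block_mx (m%:M : 'M_1) a a^T B 0 0 by rewrite eA1.
  rewrite mxE => ->.
  have -> : 0 = lshift n (0 : 'I_1) :> 'I_(1 + n) by apply/val_inj.
  by rewrite block_mxEul mxE mulr1n.
have ea : a = imx ai by rewrite /imx /ai map_ursubmx -/(imx A1) eA1 block_mxKur.
have eB : B = imx Bi by rewrite /imx /Bi map_drsubmx -/(imx A1) eA1 block_mxKdr.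
have sA1 : A1^T = A1 by rewrite /A1 !trmx_mul trmxK sA mulmxA.
have bA1 : A1 = block_mx mi%:M ai ai^T Bi.
  by apply: imxK; rewrite eA1 /imx map_block_mx map_scalar_mx /= -em -map_trmx
    -/(imx ai) -ea -/(imx Bi) -eB.
have aim j : 0 <= ai 0 j < mi.
  have := am j; rewrite ea em mxE ltr_int -[0]/(0%:~R) ler_int //.
have sBi : Bi^T = Bi by rewrite trmx_drsub sA1.
clearbody mi ai Bi.
have [hTm hm1 hm2 hs0] := hT m Tm.
have mi0 : (s0 ^ 2 + q ^ 2 + 1)%:Z <= mi.
  by rewrite -(ler_int rat) -em -[X in X <= _]/((s0 ^ 2 + q ^ 2 + 1)%:R).
have [s hs] := isqrt (`|mi| - q ^ 2 - 1)%N.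
have hM : mi = `|mi|%N by rewrite gez0_abs //; apply: le_trans mi0.
have eM : m = `|mi|%:R by rewrite em {1}hM.
move: `|mi|%N eM hM hs => M eM hM /andP[hs1 hs2].
have mi0' : (s0 ^ 2 + q ^ 2 + 1 <= M)%N by move: mi0; rewrite hM.
have s0s : (s0 <= s)%N by rewrite -ltnS -(ltn_exp2r _ _ (isT : 0 < 2)%N);
  clear -mi0' hs2; lia.
have sgt0 : (0 < s)%N by apply: leq_trans s0s.
have hMs : (s ^ 2 + q ^ 2 + 1 <= M)%N by clear -hs1 mi0'; lia.
have [x1 [x2 [x3 [x4 ex]]]] := four_squares_nat (M - (s ^ 2 + q ^ 2 + 1)).
pose rho : 'rV[int]_n := \row_j modz (ai 0 j) s.
pose t : 'rV[int]_n := \row_j divz (ai 0 j) s.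
pose kap : 'rV[int]_n := \row_j divz (rho 0 j) q.
pose lam : 'rV[int]_n := \row_j modz (rho 0 j) q.
have sz : s%:Z != 0 by clear -sgt0; lia.
have qz : q%:Z != 0 by clear -q0; lia.
have erho : ai = s%:Z *: t + rho.
  by apply/rowP => j; rewrite !mxE {1}(divz_eq (ai 0 j) s) mulrC.
have elam : rho = q%:Z *: kap + lam.
  by apply/rowP => j; rewrite !mxE {1}(divz_eq (modz (ai 0 j) s) q) mulrC.
pose A2 := Bi - sumsq [:: t; kap; lam].
have sA2 : A2^T = A2.
  by rewrite /A2 [LHS]raddfB /= sBi sumsq_sym.
have bA2 : bounded_below (imx A2) T0.
  move=> v v0; pose w := imx v; pose Q := dot w w.
  have Q1 : 1 <= Q by apply: dotvv_ge1.
  have eQ : quad (imx A2) w = quad B w -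
      (dot (imx t) w ^+ 2 + dot (imx kap) w ^+ 2 + dot (imx lam) w ^+ 2).
    rewrite quad_imx eB quad_imx /A2 quadB rmorphB /= quad_sumsq.
    rewrite !big_cons big_nil addr0 addrA !rmorphD !rmorphXn /=.
    have D (u : 'rV[int]_n) : dot (imx u) w = (dot u v)%:~R.
      by rewrite !dotE rmorph_sum; apply: eq_bigr => i _; rewrite !mxE rmorphM.
    by rewrite !D.
  have m0 : 0 < m by rewrite (lt_le_trans T0').
  have et : dot (imx t) w = (dot a w - dot (imx rho) w) / s%:R.
    have -> : a = s%:R *: imx t + imx rho.
      by rewrite ea erho /imx map_mxD map_mxZ.
    by rewrite -dotBl addrK dotZl [RHS]mulrC mulKf // pnatr_eq0 -lt0n.
  have s0' : 0 < s%:R :> rat by rewrite ltr0n.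
  have q0' : 0 < q%:R :> rat by rewrite ltr0n.
  have sq_le (x y : rat) : 0 <= x -> x <= y -> x ^+ 2 <= y ^+ 2.
    by move=> x0 xy; rewrite ler_sqr // nnegrE // (le_trans x0).
  have rho_bd j : 0 <= rho 0 j < s%:Z by rewrite mxE modz_ge0 // ltz_pmod
    ?ltz_nat.
  have lam_bd j : 0 <= lam 0 j < q%:Z by rewrite mxE modz_ge0 // ltz_pmod
    ?ltz_nat.
  have Hx : dot a w ^+ 2 <= n%:R * m ^+ 2 * Q.
    by apply: dot_le => j; have /andP[h1 h2] := am j; apply: sq_le => //;
      apply: ltW.
  have Hr : dot (imx rho) w ^+ 2 <= n%:R * s%:R ^+ 2 * Q.
    apply: dot_le => j; have /andP[h1 h2] := rho_bd j; rewrite mxE.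
    by apply: sq_le; rewrite ?ler0z // -[s%:R]/(s%:Z%:~R) ler_int ltW.
  have Hk : (q%:R * dot (imx kap) w) ^+ 2 <= n%:R * s%:R ^+ 2 * Q.
    rewrite -dotZl; apply: dot_le => j; have /andP[h1 h2] := rho_bd j.
    have /andP[h3 h4] := lam_bd j.
    have ek : rho 0 j = q%:Z * kap 0 j + lam 0 j by rewrite {1}elam !mxE.
    have k0 : 0 <= kap 0 j by rewrite mxE divz_ge0 // ltz_nat.
    have -> : (q%:R *: imx kap) 0 j = (q%:Z * kap 0 j)%:~R.
      by rewrite mxE [imx kap 0 j]mxE rmorphM.
    apply: sq_le; first by rewrite ler0z mulr_ge0.
    by rewrite -[s%:R]/(s%:Z%:~R) ler_int; clear -ek h2 h3; lia.
  have Hl : dot (imx lam) w ^+ 2 <= n%:R * q%:R ^+ 2 * Q.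
    apply: dot_le => j; have /andP[h1 h2] := lam_bd j; rewrite mxE.
    by apply: sq_le; rewrite ?ler0z // -[q%:R]/(q%:Z%:~R) ler_int ltW.
  have ms1 : m <= (1 + eta) * s%:R ^+ 2.
    have := hs0 s s0s; have : (M%:R : rat) <= (s.+1 ^ 2 + q ^ 2 + 1)%:R.
      by rewrite ler_nat; clear -hs2 mi0'; lia.
    by rewrite eM !natrD !natrX -natr1; clear; lra.
  have ms2 : s%:R ^+ 2 <= m by rewrite eM -natrX ler_nat; clear -hs1; lia.
  have := peel_error nr0 c0 q0' eta0 eta1 s0' m0 (le_trans ler01 Q1)
    hq heta ms1 ms2 hm1 Hx Hr Hk Hl.
  rewrite -et eQ; have := hS v; rewrite /schur quadB quadZ quad_rank1 -/w -/Q.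
  have := hm2 Q Q1.
  by rewrite [_^-1 * _]mulrC; clear; lra.
have [s2 hs2' es2] := H0 A2 sA2 bA2.
(* The last four vectors complete the corner to [m] by Lagrange's theorem. *)
pose ws : seq 'rV[int]_(1 + n) :=
  [:: row_mx s%:Z%:M t; row_mx q%:Z%:M kap; row_mx 1%:M lam;
      row_mx x1%:M 0; row_mx x2%:M 0; row_mx x3%:M 0; row_mx x4%:M 0].
pose L := ws ++ [seq row_mx 0 v | v <- s2].
have eL : sumsq L = A1.
  rewrite sumsq_cat sumsq_lift -es2 bA1 /sumsq !big_cons big_nil.
  rewrite !row_block_sq addr0 !add_block_mx !trmx0 !mul0mx !scaler0 !trmx0
    !addr0 scale1r.
  congr block_mx.
  - have -> : mi = s%:Z ^+ 2 + q%:Z ^+ 2 + 1 +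
        (x1 ^+ 2 + x2 ^+ 2 + x3 ^+ 2 + x4 ^+ 2) by rewrite -ex hM; clear -hMs;
          lia.
    by rewrite expr1n !raddfD /= !addrA.
  - by rewrite addrA -addrA erho {1}elam.
  - by rewrite erho {1}elam !linearD.
  by rewrite /A2 /sumsq !big_cons big_nil addr0 !addrA addrAC subrr add0r.
exists [seq v *m (invmx U)^T | v <- L].
  by rewrite size_map size_cat size_map leq_add2l.
rewrite sumsq_map eL trmxK /A1 -!mulmxA -trmx_mul mulVmx // trmx1 mulmx1.
by rewrite mulKmx.
Qed.

Lemma large_forms_are_sumsq n : large_forms_sumsq n.
Proof.
elim: n => [|n]; last exact: large_forms_sumsqS.
exists 0, 0%N => A _ _; exists [::] => //.
by rewrite /sumsq big_nil [A]thinmx0.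
Qed.

(** If a sum of squares takes a small nonzero value, then in a suitable basis
    few of the squares involve the first variable, and the others are forms in
    one variable less.  Otherwise [large_forms_are_sumsq] applies. *)
Lemma bounded_sumsq n : exists N : nat, forall s : seq 'rV[int]_n,
  exists2 s', (size s' <= N)%N & sumsq s' = sumsq s.
Proof.
elim: n => [|n [N IH]].
  by exists 0%N => s; exists [::]; rewrite // [LHS]thinmx0 [RHS]thinmx0.
have [T [N1 H]] := large_forms_are_sumsq n.+1.
exists (N1 + (Num.truncn T + N))%N => s; set A := sumsq s.
have sA : A^T = A by exact: sumsq_sym.
have [bA|] := pselect (bounded_below (imx A) T).
  have [s' h e] := H A sA bA; exists s' => //.
  by apply: leq_trans h _; rewrite leq_addr.
move=> /existsNP[v /not_implyP[v0 /negP]]; rewrite -ltNge => hv.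
have [U [k [uU k0 ev]]] := primitive_row v0.
pose s1 := [seq v *m U^T | v <- s].
have es : s = [seq v *m (invmx U)^T | v <- s1].
  rewrite -map_comp map_id_in // => w _ /=.
  by rewrite -mulmxA -trmx_mul mulVmx // trmx1 mulmx1.
have Uinv : invmx U \in unitmx by rewrite unitmx_inv.
pose f := [pred w : 'rV[int]_(1 + n) | w 0 0 != 0].
pose s2 := seq.filter f s1; pose s3 := seq.filter (predC f) s1.
have e123 : sumsq s1 = sumsq s2 + sumsq s3.
  by rewrite /sumsq !big_filter (bigID f).
have sz2 : (size s2 <= Num.truncn T)%N.
  have corner : (sumsq s1) 0 0 = \sum_(w <- s1) (w 0 0) ^+ 2.
    rewrite /sumsq summxE; apply: eq_bigr => w _.
    by rewrite mxE big_ord1 mxE expr2.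
  have eq : (sumsq s1) 0 0 = quad A (row 0 U) by rewrite /s1 sumsq_map trmxK
    -quad_row.
  have qT : ((sumsq s1) 0 0)%:~R < T.
    apply: le_lt_trans hv; rewrite quad_imx ler_int ev quad_scale eq.
    rewrite ler_peMl //; first by rewrite -eq corner sumr_ge0 // => w _;
      rewrite sqr_ge0.
    by rewrite -gtz0_ge1 exprn_even_gt0 /= ?k0 ?orbT.
  have le2 : (size s2)%:Z <= (sumsq s1) 0 0.
    rewrite corner (bigID f) /= -big_filter -/s2.
    apply: (@le_trans _ _ (\sum_(w <- s2) 1)).
      by rewrite big_const_seq count_predT iter_addr_0 natz.
    apply: (@le_trans _ _ (\sum_(w <- s2) w 0 0 ^+ 2)).
      rewrite !big_filter; apply: ler_sum => w fw.
      by rewrite -gtz0_ge1 exprn_even_gt0 /= ?fw ?orbT.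
    by rewrite lerDl sumr_ge0 // => w _; rewrite sqr_ge0.
  have T0 : 0 <= T.
    by apply/ltW/(le_lt_trans _ qT); rewrite ler0z; apply: le_trans le2.
  rewrite truncn_ge_nat //; apply/ltW/(le_lt_trans _ qT).
  by rewrite -[_%:R]/((size s2)%:Z%:~R) ler_int.
have e3 : s3 = [seq row_mx 0 w | w <- [seq rsubmx (w : 'rV_(1 + n)) | w <- s3]].
  rewrite -map_comp map_id_in // => w; rewrite mem_filter =>
    /andP[/negPn/eqP w0 _] /=.
  rewrite -[RHS]hsubmxK; congr row_mx; apply/matrixP => i j.
  by rewrite !mxE !ord1 -[LHS]w0; congr (w _ _); apply/val_inj.
have [s4 h4 e4] := IH [seq rsubmx (w : 'rV_(1 + n)) | w <- s3].
exists [seq v *m (invmx U)^T | v <- s2 ++ [seq row_mx 0 w | w <- s4]].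
  rewrite size_map size_cat size_map; apply: leq_trans (leq_addl _ _).
  exact: leq_add.
rewrite sumsq_map sumsq_cat sumsq_lift e4 -sumsq_lift -e3 -e123 -sumsq_map.
by rewrite -es.
Qed.

(** * Minkowski's theorem on linear forms *)

Lemma pigeonhole (A B : finType) (f : A -> B) :
  (#|B| < #|A|)%N -> exists x y, x != y /\ f x = f y.
Proof.
move=> lt; have /injectivePn[x [y xy e]] : ~~ injectiveb f.
  apply/negP => /injectiveP inj_f.
  by have := leq_card f inj_f; rewrite leqNgt lt.
by exists x, y.
Qed.

Lemma card_dffun_ord n (k : 'I_n -> nat) :
  #|{dffun forall i, 'I_(k i)}| = (\prod_i k i)%N.
Proof.
rewrite card_dep_ffun foldrE big_map -big_enum /=.
by apply: eq_bigr => i _; rewrite card_ord.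
Qed.

(** By the Smith normal form, reducing the coordinates of [L^-1 y] modulo the
    elementary divisors takes at most [`|\det M|] values on integral vectors,
    and two vectors with the same reduction differ by an element of the lattice
    [M Z^n]. *)
Lemma lattice_pigeonhole n (M : 'M[int]_n) (k : 'I_n -> nat) :
  \det M != 0 -> (`|\det M| < \prod_i k i)%N ->
  exists2 x : 'cV[int]_n, x != 0 & forall i, `|(M *m x) i 0| < (k i)%:Z.
Proof.
move=> M0 hk; have [L uL [S uS [d _ e]]] := int_Smith_normal_form M.
pose dd (i : 'I_n) : int := nth 0 d i.
have {}e : M = L *m diag_mx (\row_i dd i) *m S.
  rewrite e; congr (_ *m _ *m _); apply/matrixP => i j; rewrite !mxE.
  by rewrite -val_eqE.
have detM : `|\det M|%N = (\prod_(i < n) `|dd i|)%N.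
  rewrite e !det_mulmx det_diag !abszM.
  have unit1 (A : 'M[int]_n) : A \in unitmx -> `|\det A|%N = 1%N.
    by rewrite unitmxE => /orP[]/eqP ->.
  rewrite !unit1 // mul1n muln1 (big_morph absz abszM (erefl _)).
  by apply: eq_bigr => i _; rewrite mxE.
have dd0 i : dd i != 0.
  apply: contraNneq M0 => h.
  by rewrite -absz_eq0 detM (bigD1 i) //= h.
pose vec (y : {dffun forall i, 'I_(k i)}) : 'cV[int]_n :=
  \col_i (y i : nat)%:Z.
have mod_lt (z : int) i : (`|modz z (dd i)| < `|dd i|)%N.
  rewrite -ltz_nat gez0_abs ?modz_ge0 //.
  exact: ltz_mod.
pose f y : {dffun forall i : 'I_n, 'I_(`|dd i|)} :=
  [ffun i => Ordinal (mod_lt ((invmx L *m vec y) i 0) i)].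
have [|y [y' [yy' /ffunP efy]]] := @pigeonhole _ _ f.
  by rewrite !card_dffun_ord -detM.
pose z := vec y - vec y'.
have dz i : (invmx L *m z) i 0 \in dvdz (dd i).
  have := efy i; rewrite !ffunE => /(congr1 (fun o => (val o)%:Z)) /=.
  rewrite !gez0_abs ?modz_ge0 // => h.
  have -> : (invmx L *m z) i 0 = (invmx L *m vec y) i 0 - (invmx L *m vec y') i
    0.
    by rewrite mulmxBr [LHS]mxE [X in _ + X]mxE.
  by rewrite -eqz_mod_dvd; apply/eqP.
pose w : 'cV[int]_n := \col_i divz ((invmx L *m z) i 0) (dd i).
have ez : z = M *m (invmx S *m w).
  have ew : diag_mx (\row_i dd i) *m w = invmx L *m z.
    apply/colP => i; rewrite mul_diag_mx mxE [X in X * _]mxE [w i 0]mxE.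
    by rewrite mulrC divzK.
  by rewrite e -!mulmxA mulKVmx // ew mulKVmx.
exists (invmx S *m w).
  apply: contraNneq yy' => h; apply/eqP/ffunP => i; apply/val_inj/eqP.
  have : z i 0 = 0 by rewrite ez h mulmx0 mxE.
  by rewrite !mxE => /eqP; rewrite subr_eq0.
move=> i; rewrite -ez !mxE; move: (ltn_ord (y i)) (ltn_ord (y' i)).
move: (nat_of_ord (y i)) (nat_of_ord (y' i)) => a b; move: (k i) => c; clear.
lia.
Qed.

Section Limits.
Local Open Scope classical_set_scope.
Variable R : realType.

Lemma cvg_sum_seq (I : Type) (r : seq I) (u : I -> nat -> R) (l : I -> R) :
  (forall i, u i q @[q --> \oo] --> l i) ->
  \sum_(i <- r) u i q @[q --> \oo] --> \sum_(i <- r) l i.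
Proof.
move=> h; elim: r => [|i r IH].
  by rewrite big_nil; under eq_fun do rewrite big_nil; exact: cvg_cst.
by rewrite big_cons; under eq_fun do rewrite big_cons; exact: cvgD.
Qed.

Lemma cvg_prod_seq (I : Type) (r : seq I) (u : I -> nat -> R) (l : I -> R) :
  (forall i, u i q @[q --> \oo] --> l i) ->
  \prod_(i <- r) u i q @[q --> \oo] --> \prod_(i <- r) l i.
Proof.
move=> h; elim: r => [|i r IH].
  by rewrite big_nil; under eq_fun do rewrite big_nil; exact: cvg_cst.
by rewrite big_cons; under eq_fun do rewrite big_cons; exact: cvgM.
Qed.

Lemma cvg_det n (A : nat -> 'M[R]_n) (B : 'M[R]_n) :
  (forall i j, A q i j @[q --> \oo] --> B i j) ->
  \det (A q) @[q --> \oo] --> \det B.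
Proof.
move=> h; apply: cvg_sum_seq => s; apply: cvgM; first exact: cvg_cst.
by apply: cvg_prod_seq => i; apply: h.
Qed.

Lemma cvg_floor (x : R) :
  (Num.floor (q%:R * x))%:~R / q%:R @[q --> \oo] --> x.
Proof.
apply/cvgrPdist_le => e e0; near=> q.
have q0 : 0 < q%:R :> R by rewrite ltr0n; near: q; exists 1%N.
have qe : e^-1 <= q%:R :> R.
  near: q; exists (Num.truncn e^-1).+1 => // q /= hq.
  by apply: (le_trans (ltW (truncnS_gt _))); rewrite ler_nat.
have h1 : (Num.floor (q%:R * x))%:~R <= q%:R * x by exact: floor_le.
have h2 : q%:R * x < (Num.floor (q%:R * x))%:~R + 1.
  by have := floorD1_gt (q%:R * x); rewrite rmorphD.
have -> : x - (Num.floor (q%:R * x))%:~R / q%:R = (q%:R * x - (Num.floor (q%:R *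
  x))%:~R) / q%:R.
  by field; rewrite gt_eqF.
rewrite normrM [`|_^-1|]gtr0_norm ?invr_gt0 // ger0_norm ?subr_ge0 //.
rewrite ler_pdivrMr //; apply: (@le_trans _ _ 1); first by lra.
by rewrite -ler_pdivrMl // mulr1.
Unshelve. all: by end_near. Qed.

End Limits.

Section LinearForms.
Local Open Scope classical_set_scope.
Variable R : realType.

Lemma near_large (x : R) : \forall q \near \oo, x <= q%:R.
Proof.
exists (Num.truncn x).+1 => // q /= hq.
by apply: (le_trans (ltW (truncnS_gt _))); rewrite ler_nat.
Qed.

Lemma cvg_cst_over (x : R) : x / q%:R @[q --> \oo] --> 0.
Proof.
apply/cvgrPdist_le => e e0; near=> q.
have q0 : 0 < q%:R :> R by rewrite ltr0n; near: q; exists 1%N.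
have qe : `|x| / e <= q%:R by near: q; apply: near_large.
rewrite sub0r normrN normrM [`|_^-1|]gtr0_norm ?invr_gt0 //.
by rewrite ler_pdivrMr // mulrC -ler_pdivrMr.
Unshelve. all: by end_near. Qed.

(** With [M = floor (q W)] the integral form yields [x <> 0] with
    [M x] in a box slightly smaller, by a constant [K], than [q c].  The
    entries of [x] are bounded independently of [q], and so is the difference
    [q W x - M x], which is at most [K]. *)
Theorem minkowski_linear_forms n (W : 'M[R]_n) (c : 'I_n -> R) :
  \det W != 0 -> (forall i, 0 < c i) -> `|\det W| < \prod_i c i ->
  exists2 x : 'cV[int]_n, x != 0 &
    forall i, `|(W *m map_mx intr x) i 0| < c i.
Proof.
move=> W0 c0 hW.
pose C1 := \sum_j \sum_i `|invmx W j i| * c i.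
pose C2 := \sum_j \sum_i `|invmx W j i|.
have C10 : 0 <= C1.
  by apply: sumr_ge0 => j _; apply: sumr_ge0 => i _; rewrite mulr_ge0 // ltW.
(* [K] will bound the sum of the absolute values of the entries of [x]. *)
pose K := (Num.truncn (2 * C1)).+1.
have hK : 2 * C1 < K%:R by apply: truncnS_gt.
pose M (q : nat) : 'M[int]_n := \matrix_(i, j) Num.floor (q%:R * W i j).
pose k (q : nat) i : nat := (`|Num.floor (q%:R * c i)| - K)%N.
pose A (q : nat) : 'M[R]_n := \matrix_(i, j) ((M q i j)%:~R / q%:R).
pose kap i q : R := (Num.floor (q%:R * c i))%:~R / q%:R - K%:R / q%:R.
have cvgA : \det (A q) @[q --> \oo] --> \det W.
  apply: cvg_det => i j; under eq_fun do rewrite !mxE.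
  exact: cvg_floor.
have cvgk : \prod_i kap i q @[q --> \oo] --> \prod_i c i.
  apply: cvg_prod_seq => i; rewrite -[X in _ --> X]subr0.
  by apply: cvgB; [exact: cvg_floor | exact: cvg_cst_over].
pose e := (\prod_i c i - `|\det W|) / 2.
have e0 : 0 < e by rewrite divr_gt0 // subr_gt0.
have W0' : 0 < `|\det W| / 2 by rewrite divr_gt0 // normr_gt0.
have [q [q0 hq2 hq3 [hq1 hq4 hq5]]] : exists q : nat, [/\ (0 < q)%N,
    `|\det W - \det (A q)| < Num.min e (`|\det W| / 2),
    `|\prod_i c i - \prod_i kap i q| < e &
    [/\ 2 * C2 <= q%:R, 1 <= (q%:R : R) & \sum_i ((K%:R + 1) / c i) <= q%:R]].
  near \oo => q; exists q; split.
  - by near: q; exists 1%N.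
  - near: q; move/cvgrPdist_lt : cvgA; apply; rewrite lt_min e0 //.
  - by near: q; move/cvgrPdist_lt : cvgk; apply.
  by split; near: q; apply: near_large.
have q0R : 0 < q%:R :> R by rewrite ltr0n.
have qn0 : 0 < q%:R ^+ n :> R by rewrite exprn_gt0.
have dM : (\det (M q))%:~R = q%:R ^+ n * \det (A q).
  have -> : A q = q%:R^-1 *: map_mx intr (M q).
    by apply/matrixP => i j; rewrite !mxE mulrC.
  by rewrite detZ det_map_mx mulrA -exprMn divff ?gt_eqF // expr1n mul1r.
have [hq2e hq2W] : `|\det W - \det (A q)| < e /\
    `|\det W - \det (A q)| < `|\det W| / 2.
  by move: hq2; rewrite lt_min => /andP.
have M0 : \det (M q) != 0.
  apply/eqP => h; have dA0 : \det (A q) = 0.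
    by apply: (mulfI (lt0r_neq0 qn0)); rewrite -dM h mulr0.
  by move: hq2W W0'; rewrite dA0 subr0; clear; lra.
have floorK i : (K%:Z <= Num.floor (q%:R * c i)).
  rewrite floor_ge_int -[_%:~R]/(K%:R).
  have : (K%:R + 1) / c i <= q%:R.
    apply: le_trans hq5; rewrite (bigD1 i) //= lerDl sumr_ge0 // => j _.
    by rewrite divr_ge0 ?(ltW (c0 j)) // addr_ge0.
  by rewrite ler_pdivrMr // ; apply: le_trans; rewrite lerDl.
have kE i : (k q i)%:R = (Num.floor (q%:R * c i))%:~R - K%:R :> R.
  rewrite /k natrB; last by rewrite -lez_nat gez0_abs // (le_trans _ (floorK
    i)).
  by rewrite natr_absz ger0_norm // (le_trans _ (floorK i)).
have card : (`|\det (M q)| < \prod_i k q i)%N.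
  rewrite -(ltr_nat R) natr_absz intr_norm dM normrM gtr0_norm // natr_prod.
  have -> : \prod_(i < n) (k q i)%:R = q%:R ^+ n * \prod_i kap i q.
    rewrite -[in X in _ ^+ X](card_ord n) -prodr_const -big_split /=.
    apply: eq_bigr => i _; rewrite kE /kap -mulrBl mulrCA.
    by rewrite divff ?gt_eqF // mulr1.
  rewrite ltr_pM2l //.
  have h1 : `|\det (A q)| <= `|\det W| + `|\det W - \det (A q)|.
    by rewrite -[X in `|X| <= _](subKr (\det W)); exact: ler_normB.
  have h2 := ler_norm (\prod_i c i - \prod_i kap i q).
  by move: h1 h2 hq2e hq3; rewrite /e; clear; lra.
have [x x0 hx] := lattice_pigeonhole M0 card; exists x => //.
pose y := W *m map_mx intr x : 'cV[R]_n.
pose X : R := \sum_j `|(x j 0)%:~R|.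
have X0 : 0 <= X by apply: sumr_ge0.
have err i : `|q%:R * y i 0 - ((M q *m x) i 0)%:~R| <= X.
  rewrite !mxE mulr_sumr rmorph_sum /= -sumrB;
    apply: (le_trans (ler_norm_sum _ _ _)).
  apply: ler_sum => j _; rewrite rmorphM /= !mxE mulrA -mulrBl normrM.
  rewrite ler_piMl //.
  have h1 : (Num.floor (q%:R * W i j))%:~R <= q%:R * W i j by exact: floor_le.
  have h2 : q%:R * W i j < (Num.floor (q%:R * W i j))%:~R + 1.
    by have := floorD1_gt (q%:R * W i j); rewrite rmorphD.
  by rewrite ger0_norm ?subr_ge0 //; lra.
have hy i : q%:R * `|y i 0| < q%:R * c i - K%:R + X.
  rewrite -[q%:R in X in X < _](gtr0_norm q0R) -normrM.
  have h1 : `|((M q *m x) i 0)%:~R| < (k q i)%:R :> R.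
    by rewrite -intr_norm -[_%:R]/((k q i)%:Z%:~R) ltr_int.
  have h2 : (Num.floor (q%:R * c i))%:~R <= q%:R * c i by exact: floor_le.
  have h3 := err i; rewrite kE in h1.
  have h4 := ler_normD (q%:R * y i 0 - ((M q *m x) i 0)%:~R) (((M q *m x) i
    0)%:~R).
  rewrite subrK in h4; move: h1 h2 h3 h4; clear; lra.
have hX : X <= 2 * C1.
  have h1 : X <= \sum_j \sum_i `|invmx W j i| * `|y i 0|.
    apply: ler_sum => j _.
    have -> : (x j 0)%:~R = (invmx W *m y) j 0.
      by rewrite /y mulKmx ?unitmxE ?unitfE // mxE.
    rewrite mxE; apply: (le_trans (ler_norm_sum _ _ _)).
    by apply: ler_sum => i _; rewrite normrM.
  have h2 : q%:R * X <= q%:R * C1 + C2 * X.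
    have -> Z : q%:R * C1 + C2 * Z
        = \sum_j \sum_i `|invmx W j i| * (q%:R * c i + Z).
      rewrite /C1 /C2 mulr_suml mulr_sumr -big_split /=.
      apply: eq_bigr => j _; rewrite mulr_suml mulr_sumr -big_split /=.
      by apply: eq_bigr => i _; rewrite mulrCA -mulrDr.
    apply: (le_trans (ler_wpM2l (ltW q0R) h1)); rewrite mulr_sumr.
    apply: ler_sum => j _; rewrite mulr_sumr; apply: ler_sum => i _.
    rewrite mulrCA ler_wpM2l //; have := hy i; have : 0 <= K%:R :> R by [].
    by clear; lra.
  have h3 : C2 * X <= q%:R / 2 * X by rewrite ler_wpM2r //; move: hq1; clear;
    lra.
  rewrite -(ler_pM2l q0R); move: h2 h3; clear; lra.
move=> i; rewrite -(ltr_pM2l q0R); have := hy i; rewrite -/y.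
by move: hX hK; clear; lra.
Unshelve. all: by end_near. Qed.
End LinearForms.

(** * Embeddings of a totally real field *)

Section Embeddings.
Variable K : fieldExtType rat.

Lemma primitive_element : exists t : K, <<1; t>>%VS = fullv.
Proof.
have sep : separable 1 {:K}%AS.
  apply/separableP => x _; apply: pcharf0_separable => p.
  by rewrite pchar_lalg pchar_num.
exists (separable_generator 1 {:K}%AS).
by rewrite -(eq_adjoin_separable_generator sep) // sub1v.
Qed.

Variables (t : K) (ht : <<1; t>>%VS = fullv :> {vspace K}).

Lemma poly_in_generator (x : K) : exists q : {poly rat},
  x = (map_poly (in_alg K) q).[t].
Proof.
by apply/Fadjoin1_polyP; rewrite ht memvf.
Qed.

Variable F : numFieldType.

Lemma rmorph_generator (s : {rmorphism K -> F}) (q : {poly rat}) :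
  s (map_poly (in_alg K) q).[t] = (map_poly ratr q).[s t].
Proof.
rewrite -horner_map /= -map_poly_comp; congr (_.[_]).
by apply: eq_map_poly => a; rewrite -(fmorph_eq_rat (s \o in_alg K)).
Qed.

Lemma embeddings_eq (s s' : {rmorphism K -> F}) : s t = s' t -> s =1 s'.
Proof. by move=> e x; have [q ->] := poly_in_generator x;
  rewrite !rmorph_generator e. Qed.

(** The minimal polynomial of the generator [t] vanishes at [z], so the value at
    [z] of a rational polynomial only depends on its value at [t]. *)
Lemma embedding_of_root (m : {poly rat}) (z : F) :
  minPoly 1 t = map_poly (in_alg K) m -> root (map_poly ratr m) z ->
  exists s : {rmorphism K -> F}, s t = z.
Proof.
move=> em rz.
have wd (q q' : {poly rat}) :
    (map_poly (in_alg K) q).[t] = (map_poly (in_alg K) q').[t] ->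
    (map_poly ratr q).[z] = (map_poly ratr q').[z].
  move=> e; apply/eqP; rewrite -subr_eq0 -hornerN -hornerD -!rmorphB /=.
  have : minPoly 1 t %| map_poly (in_alg K) (q - q').
    apply: minPoly_dvdp; first by apply/polyOver1P; exists (q - q').
    by rewrite rmorphB /root hornerD hornerN e subrr.
  rewrite em dvdp_map => /dvdpP[r ->].
  by rewrite rmorphM hornerM (rootP rz) mulr0.
pose q x := projT1 (cid (poly_in_generator x)).
have qE x : x = (map_poly (in_alg K) (q x)).[t] by rewrite /q; case: cid.
pose f x := (map_poly ratr (q x)).[z].
have fE p x : x = (map_poly (in_alg K) p).[t] -> f x = (map_poly ratr p).[z].
  by move=> ex; apply: wd; rewrite -qE.
have fB : zmod_morphism f.
  move=> x y; rewrite (fE (q x - q y)); last first.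
    by rewrite rmorphB hornerD hornerN -!qE.
  by rewrite rmorphB hornerD hornerN.
have fM : monoid_morphism f.
  split; first by rewrite (fE 1) rmorph1 hornerC.
  move=> x y; rewrite (fE (q x * q y)); last by rewrite rmorphM hornerM -!qE.
  by rewrite rmorphM hornerM.
pose fa := GRing.isZmodMorphism.Build _ _ f fB.
pose fm := GRing.isMonoidMorphism.Build _ _ f fM.
pose s : {rmorphism K -> F} := HB.pack f fa fm.
exists s; rewrite -[LHS]/(f t) (fE 'X) ?map_polyX ?hornerX //.
Qed.

End Embeddings.

(** A primitive element with distinct images certifies that the [d] embeddings
    are distinct, and is what Vandermonde's formula will be applied to. *)
Definition are_all_embeddings (R : realType) (K : fieldExtType rat)
    (tau : 'I_(\dim {:K}) -> {rmorphism K -> R}) : Prop :=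
  (exists2 t : K, <<1; t>>%VS = fullv & injective (fun k => tau k t)) /\
  forall s : {rmorphism K -> R}, exists k, s =1 tau k.

(** A primitive element has [d] distinct complex conjugates, all real, and the
    embeddings correspond to them. *)
Theorem totally_real_embeddings (R : realType) (K : fieldExtType rat) :
  totally_real R K ->
  exists tau : 'I_(\dim {:K}) -> {rmorphism K -> R}, are_all_embeddings tau.
Proof.
move=> htr; have [t ht] := primitive_element K.
have [m em] : exists m, minPoly 1 t = map_poly (in_alg K) m.
  by apply/polyOver1P; apply: minPolyOver.
have mmon : m \is monic.
  by have := monic_minPoly 1 t; rewrite em map_monic.
have szm : size m = (\dim {:K}).+1.
  have := size_minPoly 1 t; rewrite em size_map_poly => ->.
  by rewrite -ht dim_Fadjoin dimv1 muln1.
have sepm : separable_poly m.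
  have : separable_element 1 t.
    by apply: pcharf0_separable => p; rewrite pchar_lalg pchar_num.
  by rewrite /separable_element em separable_map.
have [rs ers] := closed_field_poly_normal (map_poly ratr m : {poly R[i]}).
have lc : lead_coef (map_poly ratr m : {poly R[i]}) = 1.
  by apply/eqP; rewrite -monicE map_monic.
rewrite lc scale1r in ers.
have urs : uniq rs by rewrite -separable_prod_XsubC -ers separable_map.
have szrs : size rs = \dim {:K}.
  by apply/eqP; rewrite -eqSS -(size_prod_XsubC rs id) -ers size_map_poly szm.
have realrs z : z \in rs -> root (map_poly ratr m) (complex.Re z) /\ (complex.Re
  z)%:C%C = z.
  move=> zrs; have rz : root (map_poly ratr m : {poly R[i]}) z.
    by rewrite ers root_prod_XsubC.
  have [s st] := embedding_of_root ht em rz.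
  have ez : (complex.Re z)%:C%C = z by rewrite RRe_real // -st; apply: htr.
  split => //; rewrite -(fmorph_root (real_complex R)) /= ez -map_poly_comp.
  rewrite (eq_map_poly (g := ratr)) // => a.
  exact: (fmorph_eq_rat (real_complex R \o ratr)).
pose z k := nth 0 rs (nat_of_ord (k : 'I_(\dim {:K}))).
have zrs k : z k \in rs by rewrite mem_nth // szrs.
have ex k : exists s : {rmorphism K -> R}, s t = complex.Re (z k).
  by apply: (embedding_of_root ht em); case: (realrs (z k) (zrs k)).
exists (fun k => projT1 (cid (ex k))); split.
  exists t => // k k' /=; case: cid => s -> /=; case: cid => s' -> /= e.
  have : z k = z k' by rewrite -(realrs _ (zrs k)).2 -(realrs _ (zrs k')).2 e.
  by move/eqP; rewrite nth_uniq ?szrs // => /eqP/val_inj.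
move=> s; have rs_t : (s t)%:C%C \in rs.
  have : root (map_poly ratr m) (s t).
    by rewrite /root -(rmorph_generator t s) -em minPolyxx rmorph0.
  rewrite -(fmorph_root (real_complex R)) /= -map_poly_comp.
  rewrite (eq_map_poly (g := ratr)) ?ers ?root_prod_XsubC // => a.
  exact: (fmorph_eq_rat (real_complex R \o ratr)).
have lt : (index (s t)%:C%C rs < \dim {:K})%N by rewrite -szrs index_mem.
exists (Ordinal lt); apply: (embeddings_eq ht); case: cid => s' /= ->.
by rewrite /z /= nth_index.
Qed.

Section EmbeddingMatrix.
Variables (R : realType) (K : fieldExtType rat).
Local Notation d := (\dim {:K}).
Variable tau : 'I_d -> {rmorphism K -> R}.
Hypothesis htau : are_all_embeddings tau.

Lemma rmorphZ_rat (s : {rmorphism K -> R}) a x : s (a *: x) = ratr a * s x.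
Proof.
by rewrite -[a *: x]mulr_algl rmorphM /= -(fmorph_eq_rat (s \o in_alg K)).
Qed.

Definition emb_mx (b : d.-tuple K) : 'M[R]_d := \matrix_(i, k) tau k (tnth b i).

(** A linear relation between the rows of embeddings of a basis would hold for
    all of [K], in particular for the powers of a primitive element,
    contradicting Vandermonde's formula. *)
Lemma emb_mx_det (b : d.-tuple K) : basis_of fullv b -> \det (emb_mx b) != 0.
Proof.
move=> bb; case: htau => [[t ht tinj] _].
rewrite -det_tr; apply/det0P => -[v v0 hv].
have relb i : \sum_k v 0 k * tau k (tnth b i) = 0.
  have := congr1 (fun M : 'rV[R]_d => M 0 i) hv; rewrite !mxE => e.
  by rewrite -[RHS]e; apply: eq_bigr => k _; rewrite !mxE.
have rel x : \sum_k v 0 k * tau k x = 0.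
  rewrite (coord_basis bb (memvf x)).
  under eq_bigr => k _ do rewrite rmorph_sum mulr_sumr.
  rewrite exchange_big big1 //= => i _.
  transitivity (ratr (coord b i x) * \sum_k v 0 k * tau k (tnth b i)).
    rewrite mulr_sumr; apply: eq_bigr => k _.
    by rewrite rmorphZ_rat mulrCA (tnth_nth 0).
  by rewrite relb mulr0.
pose a : 'rV[R]_d := \row_k tau k t.
have Vn0 : \det (Vandermonde d a) != 0.
  rewrite det_Vandermonde prodf_seq_neq0; apply/allP => i _ /=.
  rewrite prodf_seq_neq0; apply/allP => j _; apply/implyP => ij.
  rewrite !mxE subr_eq0 (inj_eq tinj) eq_sym -val_eqE.
  by apply: contraTneq ij => ->; rewrite ltnn.
have /det0P : exists2 w : 'rV[R]_d, w != 0 & w *m (Vandermonde d a)^T = 0.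
  exists v => //; apply/rowP => i; rewrite !mxE -[RHS](rel (t ^+ i)).
  by apply: eq_bigr => k _; rewrite !mxE rmorphXn.
by rewrite det_tr (negbTE Vn0).
Qed.

(** The embeddings diagonalize multiplication by [x], with eigenvalues the
    conjugates of [x]; norm and trace follow. *)
Lemma mul_matrixE (b : d.-tuple K) (bb : basis_of fullv b) (x : K) :
  map_mx ratr (passmx.mxof b b (amulr x)) *m emb_mx b =
  emb_mx b *m diag_mx (\row_k tau k x).
Proof.
apply/matrixP => i k; rewrite mul_mx_diag !mxE -rmorphM /=.
have -> : tnth b i * x = \sum_j coord b j (tnth b i * x) *: tnth b j.
  rewrite [LHS](coord_basis bb) ?memvf //.
  by apply: eq_bigr => j _; rewrite -tnth_nth.
rewrite rmorph_sum; apply: eq_bigr => j _; rewrite !mxE rmorphZ_rat.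
by rewrite /= passmx.vecof_delta lfunE /= -tnth_nth.
Qed.

Lemma field_normE (x : K) : ratr (field_norm x) = \prod_k tau k x.
Proof.
have bb := vbasisP {:K}; have /(congr1 determinant) := mul_matrixE bb x.
rewrite !det_mulmx det_diag det_map_mx mulrC => /(mulfI (emb_mx_det bb)) ->.
by apply: eq_bigr => k _; rewrite mxE.
Qed.

Lemma field_traceE (x : K) : ratr (field_trace x) = \sum_k tau k x.
Proof.
have bb := vbasisP {:K}; have := mul_matrixE bb x.
have uE : emb_mx (vbasis {:K}) \in unitmx by rewrite unitmxE unitfE emb_mx_det.
move/(congr1 (mulmx^~ (invmx (emb_mx (vbasis {:K}))))); rewrite mulmxK // => e.
rewrite /field_trace -trace_map_mx e -mulmxA mxtrace_mulC -mulmxA mulVmx //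
  mulmx1.
by rewrite mxtrace_diag; apply: eq_bigr => k _; rewrite mxE.
Qed.

End EmbeddingMatrix.

(** * Algebraic integers *)

Section Integers.
Variable K : fieldExtType rat.

(** The prefix [OK] stands for the ring of integers [O_K]. *)
Lemma OK_int (z : int) : @ring_of_integers K z%:~R.
Proof. exact: integral_id. Qed.

Lemma OK0 : @ring_of_integers K 0. Proof. exact: (OK_int 0). Qed.
Lemma OK1 : @ring_of_integers K 1. Proof. exact: (OK_int 1). Qed.

Lemma OKN (x : K) : ring_of_integers x -> ring_of_integers (- x).
Proof. exact: integral_opp. Qed.

Lemma OKD (x y : K) :
  ring_of_integers x -> ring_of_integers y -> ring_of_integers (x + y).
Proof. exact: integral_add. Qed.

Lemma OKB (x y : K) :
  ring_of_integers x -> ring_of_integers y -> ring_of_integers (x - y).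
Proof. exact: integral_sub. Qed.

Lemma OKM (x y : K) :
  ring_of_integers x -> ring_of_integers y -> ring_of_integers (x * y).
Proof. exact: integral_mul. Qed.

Lemma OKX (x : K) n : ring_of_integers x -> ring_of_integers (x ^+ n).
Proof.
by move=> hx; elim: n => [|n IH]; [exact: OK1 | rewrite exprS; apply: OKM].
Qed.

Lemma OK_mulrz (x : K) (z : int) : ring_of_integers x ->
  ring_of_integers (x *~ z).
Proof. by move=> hx; rewrite -mulrzr; apply: OKM => //; apply: OK_int. Qed.

Lemma OK_sum I (r : seq I) (P : pred I) (F : I -> K) :
  (forall i, P i -> ring_of_integers (F i)) ->
  ring_of_integers (\sum_(i <- r | P i) F i).
Proof. by move=> h; elim/big_ind: _ => //; [exact: OK0 | exact: OKD]. Qed.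

Lemma OK_prod I (r : seq I) (P : pred I) (F : I -> K) :
  (forall i, P i -> ring_of_integers (F i)) ->
  ring_of_integers (\prod_(i <- r | P i) F i).
Proof. by move=> h; elim/big_ind: _ => //; [exact: OK1 | exact: OKM]. Qed.

(** The leading coefficient of an equation clears denominators: multiplying
    by [a ^ (n - 1)] makes the equation monic in [a * z]. *)
Lemma lead_coef_mul_OK (p : {poly K}) (z : K) :
  (forall i, ring_of_integers p`_i) -> root p z ->
  ring_of_integers (lead_coef p * z).
Proof.
move=> hp pz; have [->|p0] := eqVneq p 0; first by rewrite lead_coef0 mul0r;
  apply: OK0.
have szp : (1 < size p)%N.
  rewrite ltnNge; apply/negP => /size1_polyC ep; move: pz p0.
  by rewrite ep rootC polyC_eq0 => /eqP ->; rewrite eqxx.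
pose n := (size p).-1; have en : size p = n.+1 by rewrite /n prednK // ltnW.
have n0 : (0 < n)%N by rewrite -ltnS -en.
pose a := lead_coef p.
pose r : {poly K} := \poly_(i < n) (p`_i * a ^+ (n.-1 - i)).
pose q : {poly K} := 'X^n + r.
have szq : (size r < size ('X^n : {poly K}))%N.
  by rewrite size_polyXn ltnS size_poly.
have qmon : q \is monic by rewrite monicE lead_coefDl // lead_coefXn.
apply: (integral_root_monic qmon).
  rewrite /root /q hornerD hornerXn horner_poly -/a.
  have -> : (a * z) ^+ n + \sum_(i < n) p`_i * a ^+ (n.-1 - i) * (a * z) ^+ i
     = a ^+ n.-1 * p.[z].
    rewrite horner_coef en big_ord_recr /= mulrDr addrC mulr_sumr.
    have ea : a ^+ n.-1 * (p`_n * z ^+ n) = (a * z) ^+ n.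
      by rewrite mulrA exprMn -[p`_n]/(lead_coef p) -exprSr prednK.
    rewrite ea; congr (_ + _); apply: eq_bigr => i _.
    rewrite exprMn [RHS]mulrCA -mulrA; congr (_ * _).
    by rewrite mulrA -exprD subnK // -ltnS prednK.
  by rewrite (rootP pz) mulr0.
apply/integral_poly => i; rewrite coefD coefXn coef_poly.
apply: OKD; first by case: eqP => _; [exact: OK1 | exact: OK0].
by case: ifP => _; [apply: OKM => //; apply: OKX; apply: hp | exact: OK0].
Qed.

Lemma primitive_int_poly (x : K) :
  exists p : {poly int}, zcontents p = 1 /\ root (map_poly intr p) x.
Proof.
have /polyOver1P[m em] := minPolyOver 1 x.
have [q [a a0 eq]] := rat_poly_scale m.
have q0 : q != 0.
  apply: contraTneq (monic_minPoly 1 x) => q0.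
  by rewrite em eq q0 rmorph0 scaler0 rmorph0 monicE lead_coef0 eq_sym oner_eq0.
exists (zprimitive q); split; first by rewrite zcontents_primitive q0.
have := root_minPoly 1 x.
rewrite em eq map_polyZ /= rootZ ?scaler_eq0 ?oner_eq0 ?orbF ?invr_eq0
  ?intr_eq0 //.
rewrite {1}[q]zpolyEprim !map_polyZ /= rootZ; last first.
  by rewrite scaler_eq0 oner_eq0 orbF intr_eq0 zcontents_eq0.

rewrite -map_poly_comp (_ : map_poly _ _ = map_poly intr (zprimitive q)) //.
by apply: eq_map_poly => z /=; rewrite scaler_int.
Qed.

Lemma intrK_eq0 (z : int) : ((z%:~R : K) == 0) = (z == 0).
Proof. by rewrite -[z%:~R]scaler_int scaler_eq0 oner_eq0 orbF intr_eq0. Qed.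

Lemma intrK_inj : injective (intr : int -> K).
Proof. by move=> x y /eqP; rewrite -subr_eq0 -rmorphB intrK_eq0 subr_eq0 =>
  /eqP. Qed.

Lemma OK_denominator (x : K) : exists n : int,
  n != 0 /\ ring_of_integers (n%:~R * x).
Proof.
have [p [cp px]] := primitive_int_poly x.
have p0 : p != 0 by rewrite -zcontents_eq0 cp.
exists (lead_coef p); rewrite lead_coef_eq0; split => //.
have := @lead_coef_mul_OK (map_poly intr p) x _ px.
rewrite lead_coef_map_inj //; last exact: intrK_inj.
by apply => i; rewrite coef_map; apply: OK_int.
Qed.

End Integers.

Lemma rat_integral (R : realType) (a : rat) :
  integralOver (intr : int -> R) (ratr a) -> exists z : int, a = z%:~R.
Proof.
case=> p pmon; have -> : map_poly (intr : int ->
  R) p = map_poly ratr (map_poly intr p).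
  by rewrite -map_poly_comp; apply: eq_map_poly => z /=; rewrite rmorph_int.
rewrite fmorph_root => pa.
have : root (map_poly (ratr : rat -> algC) (map_poly intr p)) (ratr a)
  by rewrite fmorph_root.
rewrite -map_poly_comp => /root_monic_Aint h.
have : ratr a \in (Num.int : {pred algC}).
  apply: Cint_rat_Aint; first exact: Crat_rat.
  apply: h; first exact: monic_map.
  by apply/polyOverP => i; rewrite coef_map /= rmorph_int; apply: rpred_int.
case/intrP => z /eqP ez; exists z; apply/eqP.
by rewrite -(inj_eq (fmorph_inj (ratr : {rmorphism rat ->
  algC}))) /= rmorph_int.
Qed.

Section IntegersEmb.
Variables (R : realType) (K : fieldExtType rat).

Lemma OK_embedding (s : {rmorphism K -> R}) x :
  ring_of_integers x <-> integralOver (intr : int -> R) (s x).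
Proof.
have e p : map_poly (intr : int -> R) p = map_poly s (map_poly intr p).
  by rewrite -map_poly_comp; apply: eq_map_poly => z /=; rewrite rmorph_int.
split=> -[p pmon pr]; exists p => //; move: pr; rewrite ?e;
  first by rewrite fmorph_root.
by rewrite fmorph_root.
Qed.

Variable tau : 'I_(\dim {:K}) -> {rmorphism K -> R}.
Hypothesis htau : are_all_embeddings tau.

Lemma field_norm_int (x : K) : ring_of_integers x ->
  exists z : int, field_norm x = z%:~R.
Proof.
move=> hx; apply: (@rat_integral R); rewrite (field_normE htau).
elim/big_ind: _ => [||k _]; first exact: integral1.
  exact: integral_mul.
exact/OK_embedding.
Qed.

Lemma field_trace_int (x : K) : ring_of_integers x ->
  exists z : int, field_trace x = z%:~R.
Proof.
move=> hx; apply: (@rat_integral R); rewrite (field_traceE htau).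
elim/big_ind: _ => [||k _]; first exact: integral0.
  exact: integral_add.
exact/OK_embedding.
Qed.

Lemma field_norm_eq0 (x : K) : (field_norm x == 0) = (x == 0).
Proof.
rewrite -(fmorph_eq0 (ratr : {rmorphism rat -> R})) /= (field_normE htau).
apply/prodf_eq0/eqP => [[k _]|->]; first by rewrite fmorph_eq0 => /eqP.
have d0 : (0 < \dim {:K})%N by apply: adim_gt0.
by exists (Ordinal d0); rewrite ?rmorph0.
Qed.

Lemma field_normM (x y : K) : field_norm (x * y) = field_norm x * field_norm y.
Proof.
apply: (fmorph_inj (ratr : {rmorphism rat -> R})).
rewrite /= rmorphM /= !(field_normE htau) -big_split /=.
by apply: eq_bigr => k _; rewrite rmorphM.
Qed.

Lemma field_norm_ge1 (x : K) : ring_of_integers x -> x != 0 ->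
  1 <= `|field_norm x|.
Proof.
move=> hx x0; have [z ez] := field_norm_int hx.
have : field_norm x != 0 by rewrite field_norm_eq0.
rewrite ez intr_eq0 -intr_norm -[1]/(1%:~R) ler_int => z0.
by rewrite -gtz0_ge1 normr_gt0.
Qed.

End IntegersEmb.

(** * Integral bases and the discriminant *)

Section IntegralBasis.
Variables (R : realType) (K : fieldExtType rat).
Local Notation d := (\dim {:K}).
Variable tau : 'I_d -> {rmorphism K -> R}.
Hypothesis htau : are_all_embeddings tau.

Definition trace_disc (b : d.-tuple K) : rat :=
  \det (\matrix_(i, j) field_trace (tnth b i * tnth b j)).

Lemma trace_discE (b : d.-tuple K) :
  ratr (trace_disc b) = \det (emb_mx tau b) ^+ 2.
Proof.
rewrite /trace_disc -det_map_mx expr2 -[X in _ * X]det_tr -det_mulmx.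
congr (\det _); apply/matrixP => i j; rewrite !mxE /= (field_traceE htau).
by apply: eq_bigr => k _; rewrite !mxE rmorphM.
Qed.

Lemma emb_mx_change (b b' : d.-tuple K) (T : 'M[rat]_d) :
  (forall i, tnth b' i = \sum_j T i j *: tnth b j) ->
  emb_mx tau b' = map_mx ratr T *m emb_mx tau b.
Proof.
move=> h; apply/matrixP => i k; rewrite !mxE h rmorph_sum.
by apply: eq_bigr => j _; rewrite !mxE rmorphZ_rat.
Qed.

Lemma basis_of_emb_det (b : d.-tuple K) :
  \det (emb_mx tau b) != 0 -> basis_of fullv b.
Proof.
move=> db; have sz : size b = \dim {:K} by rewrite size_tuple.
rewrite basisEfree sz leqnn subvf !andbT.
apply/freeP => c hc i; apply/eqP.
have : map_mx ratr (\row_j c j) *m emb_mx tau b = 0.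
  apply/rowP => k; rewrite !mxE -[RHS](rmorph0 (tau k)) -hc rmorph_sum.
  by apply: eq_bigr => j _; rewrite !mxE rmorphZ_rat (tnth_nth 0).
have uE : emb_mx tau b \in unitmx by rewrite unitmxE unitfE.
move/(congr1 (mulmx^~ (invmx (emb_mx tau b)))); rewrite mulmxK // mul0mx.
by move/rowP/(_ i); rewrite !mxE => /eqP; rewrite fmorph_eq0.
Qed.

Lemma coord_tnth (b : d.-tuple K) (x : K) : basis_of fullv b ->
  x = \sum_i coord b i x *: tnth b i.
Proof.
move=> bb; rewrite {1}(coord_basis bb (memvf x)).
by apply: eq_bigr => i _; rewrite (tnth_nth 0).
Qed.

Lemma integral_family_exists : exists b : d.-tuple K,
  (forall i, ring_of_integers (tnth b i)) /\ basis_of fullv b.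
Proof.
pose v := vbasis {:K}.
pose n i := projT1 (cid (OK_denominator (tnth v i))).
have nP i : n i != 0 /\ ring_of_integers ((n i)%:~R * tnth v i).
  by rewrite /n; case: cid.
pose b := [tuple (n i)%:~R * tnth v i | i < d].
exists b; split=> [i|]; first by rewrite tnth_mktuple; case: (nP i).
apply: basis_of_emb_det.
rewrite (@emb_mx_change v _ (diag_mx (\row_i (n i)%:~R))); last first.
  move=> i; rewrite tnth_mktuple (bigD1 i) //= big1 ?addr0 => [|j ji].
    by rewrite !mxE eqxx mulr1n scaler_int mulrzl.
  by rewrite !mxE eq_sym (negbTE ji) mulr0n scale0r.
rewrite det_mulmx mulf_neq0 ?emb_mx_det ?(vbasisP {:K}) //.
rewrite det_map_mx det_diag fmorph_eq0; apply/prodf_neq0 => i _.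
by rewrite mxE intr_eq0; case: (nP i).
Qed.

Lemma det_replaced_row (F : fieldType) n (i0 : 'I_n) (c : 'I_n -> F) :
  \det (\matrix_(i, j) (if i == i0 then c j else (i == j)%:R)) = c i0.
Proof.
set T := \matrix_(_, _) _.
have cof j : cofactor T i0 j = (j == i0)%:R.
  have -> : cofactor T i0 j = cofactor 1%:M i0 j.
    rewrite /cofactor; congr (_ * \det _); apply/matrixP => i k.
    by rewrite !mxE eq_sym (negbTE (neq_lift _ _)).
  have adj1 : \adj (1%:M : 'M[F]_n) = 1%:M.
    by rewrite -[LHS]mul1mx mul_mx_adj det1.
  by have := congr1 (fun M : 'M[F]_n => M j i0) adj1; rewrite !mxE.
rewrite (expand_det_row _ i0) (bigD1 i0) //= big1 ?addr0 => [|j ji].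
  by rewrite cof eqxx mulr1 mxE eqxx.
by rewrite cof (negbTE ji) mulr0.
Qed.

Lemma trace_disc_int (b : d.-tuple K) : (forall i,
  ring_of_integers (tnth b i)) ->
  exists z : int, trace_disc b = z%:~R.
Proof.
move=> hb; pose g i j := projT1 (cid (field_trace_int htau (OKM (hb i) (hb
  j)))).
exists (\det (\matrix_(i, j) g i j)); rewrite -det_map_mx /trace_disc.
by congr (\det _); apply/matrixP => i j; rewrite !mxE /g; case: cid.
Qed.

(** A basis of integers with minimal discriminant is an integral basis: if some
    integer had a coordinate [c] outside [int], replacing the corresponding
    basis element would multiply the discriminant by the square of the
    fractional part of [c]. *)
Lemma integral_basis_exists : exists b : d.-tuple K, is_integral_basis b.
Proof.
pose good (b : d.-tuple K) :=
  (forall i, ring_of_integers (tnth b i)) /\ basis_of fullv b.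
pose P n := `[< exists2 b, good b & `|trace_disc b| = n%:R >].
have exP : exists n, P n.
  have [b gb] := integral_family_exists; have [z ez] := trace_disc_int gb.1.
  exists `|z|%N; apply/asboolP; exists b => //.
  by rewrite ez natr_absz intr_norm.
case: (ex_minnP exP) => n /asboolP[b [bO bb] eb] nmin.
have n0 : 0 < `|trace_disc b|.
  rewrite normr_gt0 -(fmorph_eq0 (ratr : {rmorphism rat -> R})) /= trace_discE.
  by rewrite expf_eq0 /= emb_mx_det.
exists b; split => // x xO.
have coord_int i0 : exists z : int, coord b i0 x = z%:~R.
  apply: contrapT => notint.
  pose z := Num.floor (coord b i0 x); pose f := coord b i0 x - z%:~R.
  have f0 : 0 < f.
    rewrite subr_gt0 lt_neqAle floor_le andbT; apply/eqP => e.
    by apply: notint; exists z.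
  have f1 : f < 1.
    by rewrite /f ltrBlDl; have := floorD1_gt (coord b i0 x); rewrite rmorphD.
  pose y := x - tnth b i0 *~ z.
  pose b' := [tuple if i == i0 then y else tnth b i | i < d].
  pose c j := coord b j x - (j == i0)%:R * z%:~R.
  pose T : 'M[rat]_d := \matrix_(i, j) (if i == i0 then c j else (i == j)%:R).
  have eT : emb_mx tau b' = map_mx ratr T *m emb_mx tau b.
    apply: emb_mx_change => i; rewrite tnth_mktuple.
    under eq_bigr => j _ do rewrite mxE.
    case: eqP => [_|/eqP ii0].
      rewrite /y {1}(coord_tnth x bb) /c.
      under [RHS]eq_bigr => j _ do rewrite scalerBl.
      rewrite sumrB; congr (_ - _); rewrite (bigD1 i0) //= big1 ?addr0.
        by rewrite eqxx mul1r scaler_int.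
      by move=> j ji0; rewrite (negbTE ji0) mul0r scale0r.
    rewrite (bigD1 i) //= eqxx scale1r big1 ?addr0 // => j ji.
    by rewrite eq_sym (negbTE ji) scale0r.
  have ed : trace_disc b' = f ^+ 2 * trace_disc b.
    apply: (fmorph_inj (ratr : {rmorphism rat -> R}));
      rewrite /= rmorphM /= !trace_discE.
    rewrite eT det_mulmx det_map_mx det_replaced_row /c eqxx mul1r -/f.
    by rewrite exprMn rmorphXn.
  have b'O i : ring_of_integers (tnth b' i).
    rewrite tnth_mktuple; case: eqP => _ //.
    by apply: OKB => //; apply: OK_mulrz.
  have gb' : good b'.
    split => //; apply: basis_of_emb_det.
    have : ratr (trace_disc b') != 0 :> R.
      rewrite fmorph_eq0 ed mulf_neq0 -?normr_gt0 //.
      by rewrite normr_gt0 expf_neq0 // gt_eqF.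
    by rewrite trace_discE expf_eq0.
  have [w ew] := trace_disc_int b'O.
  have /nmin : P `|w|%N.
    by apply/asboolP; exists b' => //; rewrite ew natr_absz intr_norm.
  rewrite -(ler_nat rat) natr_absz intr_norm -ew -eb ed normrM.
  rewrite -subr_le0 -{1}[`|trace_disc b|]mul1r -mulrBl pmulr_lle0 // subr_le0.
  rewrite ger0_norm ?sqr_ge0 // => h.
  have : f ^+ 2 < 1 by rewrite expr_lt1 // ltW.
  by rewrite ltNge h.
pose c i := projT1 (cid (coord_int i)).
have cP i : coord b i x = (c i)%:~R by rewrite /c; case: cid.
exists [ffun i => c i]; split.
  rewrite [LHS](coord_tnth x bb); apply: eq_bigr => i _.
  by rewrite ffunE cP scaler_int.
move=> c' ex; apply/ffunP => i; rewrite ffunE.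
apply: (@intr_inj rat); rewrite -cP ex.
under eq_bigr => j _ do rewrite -scaler_int (tnth_nth 0).
by rewrite coord_sum_free // (basis_free bb).
Qed.

Lemma integral_basis_is_basis (b : d.-tuple K) :
  is_integral_basis b -> basis_of fullv b.
Proof.
move=> [bO hb]; rewrite basisEdim size_tuple leqnn andbT.
apply/subvP => x _; have [n [n0 nx]] := OK_denominator x.
have [c [ec _]] := hb _ nx.
have -> : x = (n%:~R : rat)^-1 *: (n%:~R * x).
  by rewrite mulrzl -scaler_int scalerA mulVf ?scale1r // intr_eq0.
rewrite memvZ // ec memv_suml // => i _.
by rewrite -scaler_int memvZ // memv_span // mem_tnth.
Qed.

Lemma discriminantP : exists b : d.-tuple K,
  [/\ is_integral_basis b, basis_of fullv b, discriminant K = trace_disc b &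
      exists2 D : nat, (0 < D)%N & discriminant K = D%:R].
Proof.
have [b0 hb0] := integral_basis_exists.
have [b hb e] : [set D | exists2 b : d.-tuple K, is_integral_basis b &
    D = trace_disc b]%classic (discriminant K).
  by apply: (@xgetPex _ 0); exists (trace_disc b0), b0.
have bb := integral_basis_is_basis hb; exists b; split => //.
have [z ez] := trace_disc_int hb.1.
have z0 : 0 < z.
  rewrite -(ltr0z rat) -ez -(ltr_rat R) rmorph0 trace_discE.
  by rewrite exprn_even_gt0 //= emb_mx_det.
exists `|z|%N; first by rewrite absz_gt0 gt_eqF.
by rewrite e ez natr_absz intr_norm gtr0_norm // ltr0z.
Qed.

End IntegralBasis.

(** * Small elements of the ring of integers *)

Section SmallElements.
Variables (R : realType) (K : fieldExtType rat).
Local Notation d := (\dim {:K}).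
Variable tau : 'I_d -> {rmorphism K -> R}.
Hypothesis htau : are_all_embeddings tau.

(** The linear forms are the conjugates of a combination of an integral basis;
    the square of their determinant is the discriminant. *)
Lemma exists_small_integer (c : 'I_d -> R) :
  (forall k, 0 < c k) -> ratr (discriminant K) < (\prod_k c k) ^+ 2 ->
  exists x : K, [/\ ring_of_integers x, x != 0 & forall k, `|tau k x| < c k].
Proof.
move=> c0 hc; have [b [bO bb eD _]] := discriminantP htau.
pose W := (emb_mx tau b)^T.
have W0 : \det W != 0 by rewrite det_tr emb_mx_det.
have hW : `|\det W| < \prod_i c i.
  have p0 : 0 <= \prod_i c i by apply: prodr_ge0 => k _; apply: ltW.
  rewrite -(ltr_pXn2r (isT : (0 < 2)%N)) ?nnegrE //.
  by rewrite -normrX ger0_norm ?sqr_ge0 // det_tr -trace_discE // -eD.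
have [x x0 hx] := minkowski_linear_forms W0 c0 hW.
pose y : K := \sum_i tnth b i *~ x i 0.
have yE k : tau k y = (W *m map_mx intr x) k 0.
  rewrite mxE rmorph_sum; apply: eq_bigr => i _.
  by rewrite !mxE rmorphMz /= mulrzr.
exists y; split.
- by apply: OK_sum => i _; apply: OK_mulrz; case: bO.
- apply: contraNneq x0 => y0; apply/eqP/colP => i; rewrite mxE.
  have : W *m map_mx intr x = 0 :> 'cV[R]_d.
    by apply/colP => k; rewrite -yE y0 rmorph0 mxE.
  move/(congr1 (mulmx (invmx W))); rewrite mulKmx ?unitmxE ?unitfE // mulmx0.
  by move/colP/(_ i); rewrite !mxE => /eqP; rewrite intr_eq0 => /eqP.
by move=> k; rewrite yE.
Qed.

Lemma totally_positive_tau (x : K) :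
  totally_positive R x <-> forall k, 0 < tau k x.
Proof.
split=> [h k|h s]; first exact: h.
by have [k ->] := htau.2 s.
Qed.

(** If the norm of [g] exceeds the discriminant, the box with sides
    [sqrt (tau k g)] is large enough for Minkowski's theorem. *)
Lemma subtract_square (g : K) : totally_positive R g ->
  discriminant K < field_norm g ->
  exists x : K, [/\ ring_of_integers x, x != 0 & totally_positive R (g - x ^+
    2)].
Proof.
move=> gpos hg; pose c k := Num.sqrt (tau k g).
have c0 k : 0 < c k by rewrite sqrtr_gt0.
have [|x [xO x0 hx]] := @exists_small_integer c c0.
  rewrite -prodrXl; under eq_bigr => k _ do rewrite sqr_sqrtr ?ltW //.
  by rewrite -(field_normE htau) ltr_rat.
exists x; split => //; apply/totally_positive_tau => k.
rewrite rmorphB rmorphXn /= subr_gt0 -[tau k g]sqr_sqrtr ?ltW // -real_normK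
  ?num_real //.
by rewrite ltr_pXn2r ?nnegrE ?normr_ge0 ?sqrtr_ge0 //; apply: hx.
Qed.

Lemma sum_of_squares_cons m (x y : K) : ring_of_integers x ->
  is_sum_of_squares m y -> is_sum_of_squares m.+1 (x ^+ 2 + y).
Proof.
move=> xO [v vO ->]; exists (fun i => oapp v x (unlift ord0 i)).
  by move=> i; case: (unlift ord0 i).
rewrite big_ord_recl unlift_none; congr (_ + _).
by apply: eq_bigr => i _; rewrite liftK.
Qed.

(** Subtracting squares as long as the norm is large: the trace, a positive
    integer, decreases. *)
Lemma totally_positive_decomposition (g : K) :
  ring_of_integers g -> totally_positive R g ->
  exists m a y, [/\ small_norm_elements R a, is_sum_of_squares m y & g = a + y].
Proof.
suff H n : forall g : K, ring_of_integers g -> totally_positive R g ->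
    field_trace g < n%:R -> exists m a y,
    [/\ small_norm_elements R a, is_sum_of_squares m y & g = a + y].
  move=> gO gpos; apply: (H (Num.truncn (field_trace g)).+1) => //.
  exact: truncnS_gt.
elim: n => [|n IH] {}g gO gpos gn.
  have : (0 : R) <= ratr (field_trace g).
    by rewrite (field_traceE htau); apply: sumr_ge0 => k _; apply/ltW/gpos.
  by rewrite leNgt ltrq0 gn.
have [le|gt] := lerP (field_norm g) (discriminant K).
  exists 0%N, g, 0; rewrite addr0; split => //.
  by exists (fun=> 0); [move=> i; apply: OK0 | rewrite big_ord0].
have [x [xO x0 hx]] := subtract_square gpos gt.
have x2O : ring_of_integers (x ^+ 2) by apply: OKX.
have g'O : ring_of_integers (g - x ^+ 2) by apply: OKB.
have [|m [a [y [ha hy e]]]] := IH _ g'O hx.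
  have [z ez] := field_trace_int htau x2O.
  have z0 : 0 < z.
    rewrite -(ltr0z rat) -ez -(ltr_rat R) rmorph0 (field_traceE htau).
    have d0 : (0 < d)%N by apply: adim_gt0.
    rewrite (bigD1 (Ordinal d0)) //= ltr_pwDl //.
      by rewrite rmorphXn /= exprn_even_gt0 //= fmorph_eq0.
    by apply: sumr_ge0 => k _; rewrite rmorphXn /= sqr_ge0.
  have e : field_trace g = field_trace (g - x ^+ 2) + z%:~R.
    apply: (fmorph_inj (ratr : {rmorphism rat -> R})).
    rewrite /= rmorphD /= -ez !(field_traceE htau) -big_split /=.
    by apply: eq_bigr => k _; rewrite rmorphB subrK.
  have z1 : 1 <= z%:~R :> rat by rewrite -[1]/(1%:~R) ler_int -gtz0_ge1.
  by rewrite -(ltrD2r z%:~R) -e; apply: (lt_le_trans gn); rewrite -natr1 lerD2l.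
exists m.+1, a, (x ^+ 2 + y); split => //; first exact: sum_of_squares_cons.
by rewrite addrCA -e addrC subrK.
Qed.

(** If the discriminant were [1], boxes with sides [c > 1, 1, ..., 1] would
    contain nonzero integers [x]; their first conjugates have absolute value
    greater than [1], so [c] can be taken to be [`|tau 0 x|], which gives
    infinitely many such [x].  Two of them with close first conjugates have a
    difference of norm less than [1]. *)
Lemma discriminant_gt1 : (1 < d)%N -> 1 < discriminant K.
Proof.
move=> d1; have [b [_ _ _ [D D0 eD]]] := discriminantP htau.
rewrite eD ltr1n ltn_neqAle D0 andbT eq_sym; apply/negP => /eqP D1.
pose k0 : 'I_d := Ordinal (ltnW d1); pose k1 : 'I_d := Ordinal d1.
have k10 : k1 != k0 by [].
pose A (x : K) := [/\ ring_of_integers x, 0 < tau k0 x & forall k, k != k0 ->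
  `|tau k x| < 1].
have normE (x : K) : ratr `|field_norm x| = `|tau k0 x| * \prod_(k | k != k0)
  `|tau k x|.
  by rewrite ratr_norm (field_normE htau) normr_prod (bigD1 k0).
have close_eq (x : K) : ring_of_integers x -> `|tau k0 x| < (2 ^+ d)^-1 ->
    (forall k, k != k0 -> `|tau k x| < 2) -> x = 0.
  move=> xO h1 h2; apply/eqP; apply: contraT => x0.
  have := field_norm_ge1 htau xO x0.
  rewrite -(ler_rat R) rmorph1 normE leNgt => /negP[].
  have h3 : \prod_(k | k != k0) `|tau k x| <= 2 ^+ d.
    apply: (@le_trans _ _ (\prod_(k < d | k != k0) 2)).
      by apply: ler_prod => k kk0; rewrite normr_ge0 ltW ?h2.
    rewrite prodr_const ler_weXn2l ?ler1n //.
    by rewrite -[X in (_ <= X)%N]card_ord max_card.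
  have p0 : 0 < 2 ^+ d :> R by rewrite exprn_gt0.
  apply: (@le_lt_trans _ _ (`|tau k0 x| * 2 ^+ d)); first by rewrite ler_wpM2l.
  by rewrite -ltr_pdivlMr // mul1r.
have A_gt1 x : A x -> 1 < tau k0 x.
  move=> [xO x0 hx]; have xn0 : x != 0.
    by apply: contraTneq x0 => ->; rewrite rmorph0 ltxx.
  have := field_norm_ge1 htau xO xn0.
  rewrite -(ler_rat R) rmorph1 normE gtr0_norm //;
    set q := \prod_(k | _) _ => h.
  have q1 : q < 1.
    rewrite /q (bigD1 k1) //=; apply: le_lt_trans (hx k1 k10).
    rewrite ler_piMr ?normr_ge0 //; apply: prodr_ile1 => k /andP[kk0 _].
    by rewrite normr_ge0 ltW ?hx.
  rewrite ltNge; apply/negP => t1; have q0 : 0 <= q by apply: prodr_ge0.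
  by have := le_trans h (ler_piMl q0 t1); rewrite leNgt q1.
have step c : 1 < c -> exists2 x, A x & tau k0 x < c.
  move=> c1; pose cc k := if k == k0 then c else 1.
  have c0 : 0 < c by apply: lt_trans c1.
  have [k|| x [xO x0 hx]] := @exists_small_integer cc.
  - by rewrite /cc; case: eqP.
  - rewrite eD D1 (bigD1 k0) //= /cc eqxx big1 ?mulr1 => [|k /negbTE -> //].
    by rewrite rmorph_nat expr_gt1 // ltW.
  have hx0 : `|tau k0 x| < c by have := hx k0; rewrite /cc eqxx.
  have hx1 k : k != k0 -> `|tau k x| < 1 by move=> kk0; have := hx k;
    rewrite /cc (negbTE kk0).
  have t0 : tau k0 x != 0 by rewrite fmorph_eq0.
  have [tpos|tneg|e] := ltrgtP (tau k0 x) 0.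
  - exists (- x); last by rewrite rmorphN /=; move: hx0; rewrite ltr0_norm.
    split; [exact: OKN | by rewrite rmorphN oppr_gt0 |].
    by move=> k kk0; rewrite rmorphN normrN hx1.
  - by exists x; [split | move: hx0; rewrite gtr0_norm].
  by rewrite e eqxx in t0.
pose E : set R := [set r | exists2 x, A x & r = tau k0 x]%classic.
have infE : has_inf E.
  split; first by have [x Ax _] := step 2 (ltr1n _ 2); exists (tau k0 x), x.
  by exists 1 => _ [x Ax ->]; apply/ltW/A_gt1.
have e0 : 0 < (2 ^+ d)^-1 :> R by rewrite invr_gt0 exprn_gt0.
have [_ [x Ax ->] hx] := inf_adherent e0 infE.
have [y Ay hy] := step _ (A_gt1 x Ax).
have hI : inf E <= tau k0 y by apply: ge_inf; [case: infE | exists y].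
have xy : x - y = 0.
  case: Ax => xO x0 x1; case: Ay => yO y0 y1.
  apply: close_eq; first exact: OKB.
    have -> : `|tau k0 (x - y)| = tau k0 x - tau k0 y.
      by rewrite rmorphB /= gtr0_norm // subr_gt0.
    by rewrite ltrBlDl; apply: (lt_le_trans hx); rewrite lerD2r.
  move=> k kk0; rewrite rmorphB /=; apply: (le_lt_trans (ler_normB _ _)).
  by have := x1 k kk0; have := y1 k kk0; clear; lra.
by move: hy; rewrite (subr0_eq xy) ltxx.
Qed.

End SmallElements.

(** * Greatest common divisors at a prime number *)

(** A version of [lead_coef_mul_OK] in which the leading coefficient may
    vanish. *)
Lemma top_coef_mul_OK (K : fieldExtType rat) n (a : nat -> K) (z : K) :
  (0 < n)%N -> (forall i, (i <= n)%N -> ring_of_integers (a i)) ->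
  \sum_(i < n.+1) a i * z ^+ i = 0 -> ring_of_integers (z * a n).
Proof.
move=> n0 aO e; have [->|an0] := eqVneq (a n) 0; first by rewrite mulr0;
  apply: OK0.
have lc : lead_coef (\poly_(i < n.+1) a i) = a n by rewrite lead_coef_poly.
rewrite mulrC -lc; apply: lead_coef_mul_OK => [i|].
  by rewrite coef_poly; case: ltnP => h; [apply: aO | exact: OK0].
by rewrite /root horner_poly e.
Qed.

(** Any fractional ideal [(1, z)] is invertible at [p].  If [f] is a primitive
    polynomial with [f(z) = 0], the Horner quotients
    [h_j = f_n z ^ j + ... + f_(n - j)] and the products [z h_j] are integers,
    and [f_(n - j) = h_j - z h_(j - 1)] is prime to [p] for some [j]. *)
Lemma invertible_at_prime (K : fieldExtType rat) (p : nat) (z : K) : prime p ->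
  exists X Y (k : int), [/\ ring_of_integers X, ring_of_integers (X * z),
    ring_of_integers Y, ring_of_integers (Y * z) & X + Y * z = 1 + p%:R *
      k%:~R].
Proof.
move=> pr_p; have [f [cf fz]] := primitive_int_poly z.
have f0 : f != 0 by rewrite -zcontents_eq0 cf.
pose n := (size f).-1; have en : size f = n.+1
  by rewrite /n prednK // size_poly_gt0.
pose P i : K := (f`_i)%:~R.
have PO i : ring_of_integers (P i) by apply: OK_int.
pose h := fix h j : K := if j is j'.+1 then z * h j' + P (n - j)%N else P n.
have inv j : (j <= n)%N -> ring_of_integers (h j) /\
    h j * z ^+ (n - j) + \sum_(i < n - j) P i * z ^+ i = 0.
  elim: j => [|j IH] hj.
    split; [exact: PO | rewrite subn0 addrC; move: fz].
    rewrite /root horner_coef size_map_inj_poly ?rmorph0 //;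
      last exact: intrK_inj.
    rewrite en big_ord_recr /= coef_map => /eqP e; rewrite -[RHS]e.
    by congr (_ + _); apply: eq_bigr => i _; rewrite coef_map.
  have [hO rel] := IH (ltnW hj).
  have nj : (n - j)%N = (n - j.+1).+1 by rewrite subnSK.
  have zh : ring_of_integers (z * h j).
    pose a i := if i == (n - j)%N then h j else P i.
    have := @top_coef_mul_OK K (n - j) a z; rewrite /a eqxx; apply.
    - by rewrite subn_gt0.
    - by move=> i _; case: eqP.
    rewrite big_ord_recr /= eqxx addrC -[RHS]rel; congr (_ + _).
    by apply: eq_bigr => i _; rewrite ltn_eqF.
  split; first exact: OKD.
  rewrite -[RHS]rel nj big_ord_recr /= mulrDl exprS.
  by rewrite [h j * _]mulrA [h j * z]mulrC -addrA; congr (_ + _); rewrite addrC.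
have zhO j : (j < n)%N -> ring_of_integers (z * h j).
  move=> hj; have [hO _] := inv j.+1 hj.
  have -> : z * h j = h j.+1 - P (n - j.+1)%N by rewrite /= addrK.
  exact: OKB.
have hn : h n = 0.
  by have [_] := inv n (leqnn n); rewrite subnn big_ord0 addr0 mulr1.
have zhO' j : (j <= n)%N -> ring_of_integers (z * h j).
  rewrite leq_eqVlt => /orP[/eqP ->|]; last exact: zhO.
  by rewrite hn mulr0; apply: OK0.
have [i [i_le pi]] : exists i, (i <= n)%N /\ ~~ (p %| f`_i)%Z.
  apply: contrapT => nex; have : (p %| zcontents f)%Z.
    rewrite dvdz_contents; apply/polyOverP => i; apply: contrapT => hi;
      apply: nex.
    exists i; split; last by apply/negP.
    rewrite leqNgt; apply/negP => lt; apply: hi.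
    by rewrite nth_default ?en // dvdz0.
  by rewrite cf dvdz1 /= => /eqP p1; move: pr_p; rewrite p1.
have [m' [k ek]] : exists m' k : int, m' * f`_i = 1 + p%:Z * k.
  have cop : coprimez f`_i p.
    by rewrite coprimezE /= coprime_sym prime_coprime.
  case/coprimezP: cop => -[u v] /= e; exists u, (- v); lia.
have [X0 [Y0 [XO XzO YO YzO eXY]]] : exists X0 Y0 : K,
    [/\ ring_of_integers X0, ring_of_integers (X0 * z), ring_of_integers Y0,
        ring_of_integers (Y0 * z) & X0 + Y0 * z = P i].
  have [j ej] : exists j, i = (n - j)%N /\ (j <= n)%N.
    by exists (n - i)%N; rewrite subKn // leq_subr.
  case: j ej => [|j] [ei jn].
    exists (h 0%N), 0; split; rewrite ?mul0r ?addr0;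
      [exact: PO | | exact: OK0 | exact: OK0 |].
      by rewrite mulrC; apply: (zhO' 0%N).
    by rewrite ei subn0.
  exists (h j.+1), (- h j); split.
  - by case: (inv _ jn).
  - by rewrite mulrC; apply: zhO'.
  - by apply: OKN; case: (inv _ (ltnW jn)).
  - by rewrite mulNr; apply: OKN; rewrite mulrC; apply: zhO.
  by rewrite /= mulNr ei mulrC [h j * z]mulrC addrAC subrr add0r.
exists (m'%:~R * X0), (m'%:~R * Y0), k; split.
- by apply: OKM => //; apply: OK_int.
- by rewrite -mulrA; apply: OKM => //; apply: OK_int.
- by apply: OKM => //; apply: OK_int.
- by rewrite -mulrA; apply: OKM => //; apply: OK_int.
by rewrite -mulrA -mulrDr eXY -rmorphM ek rmorphD rmorphM.
Qed.

Section ModuloPrime.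
Variables (R : realType) (K : fieldExtType rat).
Local Notation d := (\dim {:K}).
Variable tau : 'I_d -> {rmorphism K -> R}.
Hypothesis htau : are_all_embeddings tau.
Variable p : nat.
Hypothesis p_gt0 : (0 < p)%N.

Definition congr_OK (x y : K) := exists2 r, ring_of_integers r & x = y + p%:R *
  r.

Lemma OK_mod_finite (f : nat -> K) : (forall n, ring_of_integers (f n)) ->
  exists i t, (0 < t)%N /\ congr_OK (f (i + t)%N) (f i).
Proof.
move=> fO; have [b [hb bb _ _]] := discriminantP htau.
have coords x : ring_of_integers x -> exists c : {ffun 'I_d -> int},
    x = \sum_i tnth b i *~ c i.
  by move=> xO; have [c [e _]] := hb.2 x xO; exists c.
pose c n := projT1 (cid (coords _ (fO n))).
have cE n : f n = \sum_i tnth b i *~ c n i by rewrite /c; case: cid.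
have cong (n m : nat) : (forall i, (c n i = c m i %[mod p])%Z) ->
  congr_OK (f n) (f m).
  move=> e; exists (\sum_i tnth b i *~ ((c n i - c m i) %/ p)%Z).
    by apply: OK_sum => i _; apply: OK_mulrz; case: hb.
  rewrite !cE mulr_sumr -big_split /=; apply: eq_bigr => i _.
  have /divzK dv : (p %| c n i - c m i)%Z by rewrite -eqz_mod_dvd; apply/eqP.
  by rewrite mulr_natl pmulrn -mulrzA -mulrzDr dv addrC subrK.
have lt_p (z : int) : (`|(z %% p)%Z| < p)%N.
  by rewrite -ltz_nat gez0_abs ?modz_ge0 ?ltz_pmod //; lia.
pose red (n : 'I_(p ^ d).+1) : {ffun 'I_d -> 'I_p} :=
  [ffun i => Ordinal (lt_p (c n i))].
have [|n [m [nm /ffunP e]]] := @pigeonhole _ _ red.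
  by rewrite card_ffun !card_ord.
have e' i : (c n i = c m i %[mod p])%Z.
  have := e i; rewrite !ffunE => /(congr1 (fun o => (val o)%:Z)) /=.
  by rewrite !gez0_abs ?modz_ge0 //; lia.
have [lt|gt|/val_inj eq] := ltngtP n m.
- exists n, (m - n)%N; rewrite subn_gt0 lt subnKC 1?ltnW //; split => //.
  by apply: cong => i; rewrite e'.
- exists m, (n - m)%N; rewrite subn_gt0 gt subnKC 1?ltnW //; split => //.
  exact: cong.
by rewrite eq eqxx in nm.
Qed.
End ModuloPrime.

Section Norms.
Variables (R : realType) (K : fieldExtType rat).
Local Notation d := (\dim {:K}).
Variable tau : 'I_d -> {rmorphism K -> R}.
Hypothesis htau : are_all_embeddings tau.

(** Norms of integers are integers, so taking the numerator loses nothing. *)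
Definition nrm (x : K) : nat := `|numq (field_norm x)|.

Lemma nrm_int (x : K) (z : int) : field_norm x = z%:~R -> nrm x = `|z|%N.
Proof. by rewrite /nrm => ->; rewrite numq_int. Qed.

Lemma nrmM (x y : K) : ring_of_integers x -> ring_of_integers y ->
  nrm (x * y) = (nrm x * nrm y)%N.
Proof.
move=> xO yO; have [a ea] := field_norm_int htau xO.
have [b eb] := field_norm_int htau yO.
rewrite (nrm_int ea) (nrm_int eb) -abszM; apply: nrm_int.
by rewrite (field_normM htau) ea eb rmorphM.
Qed.

Lemma nrm_gt0 (x : K) : ring_of_integers x -> x != 0 -> (0 < nrm x)%N.
Proof.
move=> xO x0; have [a ea] := field_norm_int htau xO.
by rewrite (nrm_int ea) absz_gt0 -(intr_eq0 rat) -ea (field_norm_eq0 htau).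
Qed.

Lemma nrm_nat (n : nat) : nrm n%:R = (n ^ d)%N.
Proof.
rewrite (@nrm_int _ (n ^ d)%N) //.
apply: (fmorph_inj (ratr : {rmorphism rat -> R})).
rewrite /= (field_normE htau) rmorph_int.
under eq_bigr => k _ do rewrite rmorph_nat.
by rewrite prodr_const card_ord -[RHS]/((n ^ d)%:R) natrX.
Qed.

Variable p : nat.
Hypothesis pr_p : prime p.

(** The conjugates of congruent integers are congruent modulo [p] in the ring of
    all real algebraic integers, hence so are their products. *)
Lemma nrm_congr (x y : K) : ring_of_integers x -> congr_OK p x y ->
  ring_of_integers y -> (p %| nrm x)%N = (p %| nrm y)%N.
Proof.
move=> xO [r rO e] yO; have [a ea] := field_norm_int htau xO.
have [b eb] := field_norm_int htau yO.
pose ai (t : R) := integralOver (intr : int -> R) t.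
have [_ [s sI es]] : ai (\prod_k tau k y) /\
    exists2 s, ai s & \prod_k tau k x = \prod_k tau k y + p%:R * s.
  elim/big_rec2: _ => [|k X Y _ [YI [s sI es]]].
    split; first exact: integral1.
    by exists 0; [exact: integral0 | rewrite mulr0 addr0].
  have yI : ai (tau k y) by apply/OK_embedding.
  have rI : ai (tau k r) by apply/OK_embedding.
  have pI : ai p%:R by apply: integral_nat.
  split; first exact: integral_mul.
  exists (tau k y * s + tau k r * Y + p%:R * (tau k r * s)).
    apply: integral_add; last by apply: integral_mul => //; apply: integral_mul.
    by apply: integral_add; apply: integral_mul.
  by rewrite es e rmorphD rmorphM rmorph_nat; ring.
have p0 : p%:R != 0 :> rat by rewrite pnatr_eq0 -lt0n prime_gt0.
have es' : s = ratr ((a - b)%:~R / p%:R).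
  have p0' : p%:R != 0 :> R by rewrite pnatr_eq0 -lt0n prime_gt0.
  apply: (mulfI p0'); rewrite fmorph_div /= rmorph_nat rmorph_int mulrCA divff
    // mulr1.
  move: es; rewrite -!(field_normE htau) ea eb !rmorph_int => es.
  by rewrite rmorphB /= es addrC addKr.
rewrite es' in sI; have [c ec] := rat_integral sI.
have eab : a = b + p%:Z * c.
  apply: (@intr_inj rat); rewrite rmorphD rmorphM /= -ec mulrCA divff // mulr1.
  by rewrite rmorphB addrC subrK.
rewrite (nrm_int ea) (nrm_int eb).
rewrite -[LHS]/(p%:Z %| a)%Z -[RHS]/(p%:Z %| b)%Z eab.
by rewrite rpredDr // dvdz_mulr.
Qed.

Lemma unit_mod_prime (x a b : K) : ring_of_integers x -> ring_of_integers a ->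
  ring_of_integers b -> x * a = 1 + p%:R * b -> ~~ (p %| nrm x)%N.
Proof.
move=> xO aO bO e; have h : (p %| nrm (x * a)%R)%N = (p %| nrm 1)%N.
  by apply: nrm_congr; [exact: OKM | exists b | exact: OK1].
apply/negP => px; move: h; rewrite nrmM // dvdn_mulr // (nrm_nat 1) exp1n dvdn1.
by case: eqP pr_p => // ->.
Qed.

(** Divisibility after inverting the integers of norm prime to [p]. *)
Definition ldvd (x y : K) := exists u c, [/\ ring_of_integers u,
  ring_of_integers c, ~~ (p %| nrm u)%N & u * y = x * c].

Lemma coprime_nrmM (x y : K) : ring_of_integers x -> ring_of_integers y ->
  ~~ (p %| nrm x)%N -> ~~ (p %| nrm y)%N -> ~~ (p %| nrm (x * y))%N.
Proof. by move=> xO yO px py; rewrite nrmM // Euclid_dvdM // negb_or px. Qed.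

Lemma ldvd_trans (x y z : K) : ldvd x y -> ldvd y z -> ldvd x z.
Proof.
move=> [u [c [uO cO pu e]]] [v [c' [vO c'O pv e']]].
exists (u * v), (c * c'); split; [exact: OKM | exact: OKM | exact: coprime_nrmM
  |].
by rewrite -mulrA e' mulrA e -mulrA.
Qed.

(** Modulo [p] some power [e = X ^ N] is idempotent.  In the relation
    [X + Y z = 1] of [invertible_at_prime], [X] is a unit on the component of
    [e] and [Y z] on that of [1 - e], so [e + (1 - e) z] generates [(1, z)]. *)
Lemma gcd_at_prime (a b : K) : ring_of_integers a -> ring_of_integers b ->
  a != 0 ->
  exists x y, [/\ ring_of_integers x, ring_of_integers y,
    ldvd (x * a + y * b) a & ldvd (x * a + y * b) b].
Proof.
move=> aO bO a0; pose z := b / a.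
have [X [Y [k [XO XzO YO YzO eXY]]]] := invertible_at_prime z pr_p.
have [i [t [t0 [r rO er]]]] :=
  OK_mod_finite htau (prime_gt0 pr_p) (fun n => OKX n XO).
pose N := (t * i.+1)%N.
have N0 : (0 < N)%N by rewrite muln_gt0 t0.
have iN : (i <= N)%N by rewrite /N; nia.
have per m : exists2 s, ring_of_integers s & X ^+ (N + m * t) = X ^+ N + p%:R *
  s.
  elim: m => [|m [s sO es]]; first by exists 0;
    [exact: OK0 | rewrite mulr0 addr0 addn0].
  exists (s + X ^+ (N - i + m * t) * r).
    by apply: OKD => //; apply: OKM => //; apply: OKX.
  have -> : (N + m.+1 * t = (N - i + m * t) + (i + t))%N.
    by rewrite mulSn; move: (N) (m * t)%N iN => N' mt; clear; lia.
  rewrite exprD er mulrDr -exprD.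
  have -> : (N - i + m * t + i = N + m * t)%N by rewrite addnAC subnK.
  by rewrite es; ring.
pose e := X ^+ N; have eO : ring_of_integers e by apply: OKX.
have [s sO es] : exists2 s, ring_of_integers s & e ^+ 2 = e + p%:R * s.
  have [s sO es] := per i.+1; exists s => //.
  by rewrite -es /e -exprM muln2 -addnn /N [(i.+1 * t)%N]mulnC.
have fO : ring_of_integers (1 - e) by apply: OKB => //; exact: OK1.
have kO : ring_of_integers (k%:~R : K) by apply: OK_int.
have pO : ring_of_integers (p%:R : K) by apply: (OK_int _ p%:Z).
pose c := e + (1 - e) * z; pose j := e * X + (1 - e) * Y.
have jO : ring_of_integers j by apply: OKD; apply: OKM.
have jzO : ring_of_integers (j * z).
  by rewrite mulrDl -!mulrA; apply: OKD; apply: OKM.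
have cjO : ring_of_integers (c * j).
  have -> : c * j = e * j + (1 - e) * (j * z) by rewrite /c; ring.
  by apply: OKD; apply: OKM.
pose S := \sum_(m < N) X ^+ m.
have SO : ring_of_integers S by apply: OK_sum => m _; apply: OKX.
have eS : (1 - X) * S = 1 - e by rewrite -[1 - e]opprB /e subrX1 -mulNr opprB.
pose T := e * X ^+ N.-1 + (1 - e) * S.
have TO : ring_of_integers T by apply: OKD; apply: OKM => //; apply: OKX.
have XN : X * X ^+ N.-1 = e by rewrite -exprS prednK.
have X'O : ring_of_integers (X ^+ N.-1) by apply: OKX.
have pcj : ~~ (p %| nrm (c * j)%R)%N.
  (* [r1] and [r2] collect the multiples of [p] in [c * j] and in its product
     with [T], an inverse of it modulo [p]. *)
  pose r1 := s * X - s * Y - s * (X * z) + (1 - e) * k%:~R + s * (1 - X)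
    + p%:R * (s * k%:~R).
  have X1O : ring_of_integers (1 - X) by apply: OKB => //; exact: OK1.
  have r1O : ring_of_integers r1.
    by rewrite /r1; repeat first [done | apply: OKB | apply: OKD | apply: OKM].
  pose r2 := r1 * T + 3 * s - s * (X * S + (1 - X) * X ^+ N.-1).
  have r2O : ring_of_integers r2.
    have O3 : ring_of_integers (3 : K) by apply: (OK_int _ 3%:Z).
    by rewrite /r2; repeat first [done | apply: OKB | apply: OKD | apply: OKM].
  apply: (unit_mod_prime cjO TO r2O).
  have e1 : c * j = e * X + (1 - e) * (1 - X) + p%:R * r1.
    have -> : c * j = e ^+ 2 * X + (e - e ^+ 2) * (Y + X * z) +
      (1 - 2 * e + e ^+ 2) * (Y * z) by rewrite /c /j; ring.
    have -> : Y * z = 1 + p%:R * k%:~R - X by rewrite -eXY; ring.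
    by rewrite es /r1; ring.
  have e2 : (e * X + (1 - e) * (1 - X)) * T =
      1 + p%:R * (3 * s - s * (X * S + (1 - X) * X ^+ N.-1)).
    have -> : (e * X + (1 - e) * (1 - X)) * T = e ^+ 2 * (X * X ^+ N.-1) +
      (e - e ^+ 2) * (X * S + (1 - X) * X ^+ N.-1) +
      (1 - 2 * e + e ^+ 2) * ((1 - X) * S) by rewrite /T; ring.
    rewrite XN eS es; move: (X * S + _) => V.
    have -> : (e + p%:R * s) * e + (e - (e + p%:R * s)) * V +
      (1 - 2 * e + (e + p%:R * s)) * (1 - e) =
      2 * e ^+ 2 + p%:R * s * (1 - V) + 1 - 2 * e by ring.
    by rewrite es; ring.
  by rewrite e1 mulrDl e2 /r2; ring.
exists e, (1 - e).
have eg : e * a + (1 - e) * b = a * c by rewrite /c /z; field.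
rewrite eg; split => //.
  by exists (c * j), j; split => //; ring.
by exists (c * j), (j * z); split => //; rewrite /z; field.
Qed.

End Norms.

(** * Factorization at a prime number *)

Section LocalFactorization.
Variables (R : realType) (K : fieldExtType rat).
Local Notation d := (\dim {:K}).
Variable tau : 'I_d -> {rmorphism K -> R}.
Hypothesis htau : are_all_embeddings tau.
Variable p : nat.
Hypothesis pr_p : prime p.
Local Notation nrmM := (nrmM htau).

Lemma coprime_nrm1 : ~~ (p %| nrm (1 : K))%N.
Proof.
rewrite -[1]/(1%:R) (nrm_nat htau) exp1n dvdn1.
by case: eqP pr_p => // ->.
Qed.

Lemma ldvd_mulr (x y c : K) : ring_of_integers c -> ldvd p x y ->
  ldvd p x (y * c).
Proof.
move=> cO [u [c' [uO c'O pu e]]]; exists u, (c' * c).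
by split => //; [exact: OKM | rewrite mulrA e mulrA].
Qed.

Lemma ldvdxx (x : K) : ldvd p x x.
Proof.
exists 1, 1; split; [exact: OK1 | exact: OK1 | exact: coprime_nrm1 |
  by rewrite mul1r mulr1].
Qed.

(** Irreducibility for [ldvd]; it does not exclude [0], whence the separate
    hypotheses [q != 0] below. *)
Definition lirr (x : K) := [/\ ring_of_integers x, (p %| nrm x)%N &
  forall g, ring_of_integers g -> ldvd p g x -> (p %| nrm g)%N -> ldvd p x g].

Lemma logn_nrmM (x y : K) : ring_of_integers x -> ring_of_integers y ->
  x != 0 -> y != 0 ->
  logn p (nrm (x * y)) = (logn p (nrm x) + logn p (nrm y))%N.
Proof.
by move=> xO yO x0 y0; rewrite nrmM // lognM // (nrm_gt0 htau).
Qed.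

Lemma logn_coprime_nrm (x : K) : ~~ (p %| nrm x)%N -> logn p (nrm x) = 0%N.
Proof. by rewrite -prime_coprime // => /logn_coprime. Qed.

Lemma coprime_nrm_neq0 (x : K) : ~~ (p %| nrm x)%N -> x != 0.
Proof.
apply: contraNneq => ->; rewrite (_ : nrm 0 = 0%N) //.
by apply/eqP; rewrite /nrm absz_eq0 numq_eq0 (field_norm_eq0 htau).
Qed.

Lemma logn_nrm_gt0 (x : K) : ring_of_integers x -> x != 0 ->
  (0 < logn p (nrm x))%N = (p %| nrm x)%N.
Proof. by move=> xO x0; rewrite logn_gt0 mem_primes pr_p (nrm_gt0 htau). Qed.

(** The valuation of the norm is additive along a factorization, which makes it
    a measure for inductions on divisibility. *)
Lemma ldvd_factor (x y : K) : ring_of_integers x -> ring_of_integers y ->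
  y != 0 -> ldvd p x y -> exists u c, [/\ ring_of_integers u,
    ring_of_integers c,
    ~~ (p %| nrm u)%N, u * y = x * c &
    [/\ x != 0, c != 0 & logn p (nrm y) = (logn p (nrm x) + logn p (nrm c))%N]].
Proof.
move=> xO yO y0 [u [c [uO cO pu e]]]; exists u, c; split => //.
have u0 := coprime_nrm_neq0 pu.
have : x * c != 0 by rewrite -e mulf_neq0.
rewrite mulf_eq0 negb_or => /andP[x0 c0]; split => //.
have := congr1 (fun t => logn p (nrm t)) e.
by rewrite /= (logn_nrmM uO yO u0 y0) (logn_nrmM xO cO x0 c0) (logn_coprime_nrm
  pu).
Qed.

Lemma ldvd_antisym_factor (x y : K) : ring_of_integers x ->
  ring_of_integers y ->
  y != 0 -> ldvd p x y -> (logn p (nrm y) <= logn p (nrm x))%N ->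
  exists u c, [/\ ring_of_integers u, ring_of_integers c, ~~ (p %| nrm u)%N,
    ~~ (p %| nrm c)%N & u * y = x * c].
Proof.
move=> xO yO y0 xy le; have [u [c [uO cO pu e [x0 c0 el]]]] :=
  ldvd_factor xO yO y0 xy.
exists u, c; split => //; rewrite -logn_nrm_gt0 // -eqn0Ngt.
by move: le; rewrite el; clear; lia.
Qed.

Lemma exists_lirr_divisor (x : K) : ring_of_integers x -> x != 0 ->
  (p %| nrm x)%N -> exists2 q, lirr q & ldvd p q x.
Proof.
move: {2}(logn p (nrm x)) (leqnn (logn p (nrm x))) => n.
elim: n x => [|n IH] x le xO x0 px.
  by move: le; rewrite leqn0 -leqn0 leqNgt logn_nrm_gt0 // px.
have [irr|] := pselect (lirr x); first by exists x => //; apply: ldvdxx.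
move=> nirr; have [g [gO gx pg nxg]] : exists g, [/\ ring_of_integers g,
  ldvd p g x,
    (p %| nrm g)%N & ~ ldvd p x g].
  apply: contrapT => h; apply: nirr; split => // g gO gx pg.
  by apply: contrapT => nxg; apply: h; exists g.
have [u [c [uO cO pu e [g0 c0 el]]]] := ldvd_factor gO xO x0 gx.
have lt : (logn p (nrm g) < logn p (nrm x))%N.
  rewrite ltnNge; apply/negP => le'; apply: nxg.
  have [v [w [vO wO pv pw e']]] := ldvd_antisym_factor gO xO x0 gx le'.
  by exists w, v; split => //; rewrite mulrC -e' mulrC.
have le' : (logn p (nrm g) <= n)%N by rewrite -ltnS; apply: leq_trans lt le.
have [q irr qg] := IH g le' gO g0 pg.
by exists q => //; apply: (ldvd_trans htau pr_p qg gx).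
Qed.

(** The norm of a greatest common divisor of [q] and [a] is prime to [p]:
    otherwise [q], being irreducible, would divide it, and hence divide [a]. *)
Lemma lirr_coprime (q a : K) : lirr q -> q != 0 -> ring_of_integers a ->
  ~ ldvd p q a ->
  exists x y, [/\ ring_of_integers x, ring_of_integers y &
    ~~ (p %| nrm (x * q + y * a)%R)%N].
Proof.
move=> [qO pq irr] q0 aO nqa.
have [x [y [xO yO gq ga]]] := gcd_at_prime htau pr_p qO aO q0.
exists x, y; split => //; apply/negP => pg.
have gO : ring_of_integers (x * q + y * a) by apply: OKD; apply: OKM.
by apply: nqa; apply: (ldvd_trans htau pr_p _ ga); apply: irr.
Qed.

Lemma lirr_prime (q a b : K) : lirr q -> q != 0 -> ring_of_integers a ->
  ring_of_integers b -> ldvd p q (a * b) -> ldvd p q a \/ ldvd p q b.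
Proof.
move=> irr q0 aO bO [u [c [uO cO pu e]]].
have [|nqa] := pselect (ldvd p q a); first by left.
have [x [y [xO yO pw]]] := lirr_coprime irr q0 aO nqa; right.
have qO : ring_of_integers q by case: irr.
exists ((x * q + y * a) * u), (x * u * b + y * c); split.
- by apply: OKM => //; apply: OKD; apply: OKM.
- by apply: OKD; [apply: OKM => //; apply: OKM | apply: OKM].
- by apply: (coprime_nrmM htau) => //; apply: OKD; apply: OKM.
have -> : (x * q + y * a) * u * b = x * q * u * b + y * (u * (a * b)) by ring.
by rewrite e; ring.
Qed.

Lemma OKp : ring_of_integers (p%:R : K).
Proof. exact: (OK_int _ p%:Z). Qed.

(** Otherwise some combination of [q] and [p] has norm prime to [p], and modulo
    [p] this norm is that of a multiple of [q]. *)
Lemma lirr_dvd_p (q : K) : lirr q -> q != 0 -> ldvd p q p%:R.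
Proof.
move=> irr q0; apply: contrapT => nqp.
have [x [y [xO yO /negP[]]]] := lirr_coprime irr q0 OKp nqp.
case: irr => qO pq _; have xqO : ring_of_integers (x * q) by apply: OKM.
rewrite (nrm_congr htau pr_p (y := x * q)) //.
- by rewrite nrmM // dvdn_mull.
- by apply: OKD => //; apply: OKM => //; apply: OKp.
by exists y => //; rewrite [y * _]mulrC.
Qed.

Lemma lirr_factorization (x : K) : ring_of_integers x -> x != 0 ->
  exists (L : seq K) u w, [/\ forall q, q \in L -> lirr q /\ q != 0,
    (size L <= logn p (nrm x))%N, ring_of_integers u /\ ~~ (p %| nrm u)%N,
    ring_of_integers w /\ ~~ (p %| nrm w)%N & u * x = w * \prod_(q <- L) q].
Proof.
move: {2}(logn p (nrm x)) (leqnn (logn p (nrm x))) => n.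
elim: n x => [|n IH] x le xO x0; have [px|npx] := boolP (p %| nrm x)%N.
- by move: le; rewrite leqNgt logn_nrm_gt0 // px.
- exists [::], 1, x; split => //; rewrite ?big_nil ?mul1r ?mulr1 //.
  by split; [exact: OK1 | exact: coprime_nrm1].
- have [q irr qx] := exists_lirr_divisor xO x0 px.
  have [qO pq _] := irr.
  have [u [c [uO cO pu e [q0 c0 el]]]] := ldvd_factor qO xO x0 qx.
  have q1 : (0 < logn p (nrm q))%N by rewrite logn_nrm_gt0.
  have [|L [v [w [hL sL [vO pv] [wO pw] e']]]] := IH c _ cO c0.
    by move: le q1; rewrite el; clear; lia.
  exists (q :: L), (v * u), w; split => //=.
  + by move=> q'; rewrite inE => /orP[/eqP ->|/hL].
  + by move: sL q1; rewrite el; clear; lia.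
  + by split; [exact: OKM | exact: (coprime_nrmM htau)].
  by rewrite -mulrA e mulrCA e' big_cons mulrCA.
exists [::], 1, x; split => //; rewrite ?big_nil ?mul1r ?mulr1 //.
by split; [exact: OK1 | exact: coprime_nrm1].
Qed.

(** The norm of [p] is [p ^ d], so [p] has at most [d] irreducible factors, and
    every irreducible element is associated to one of them. *)
Lemma irreducibles_at_prime : exists L : seq K, [/\ (size L <= d)%N,
    forall q, q \in L -> lirr q /\ q != 0 &
    forall q, lirr q -> q != 0 -> exists2 q', q' \in L & ldvd p q' q].
Proof.
have p0 : p%:R != 0 :> K.
  by rewrite -[p%:R]/(p%:Z%:~R) intrK_eq0 -lt0n prime_gt0.
have [L [u [w [hL sL [uO pu] [wO pw] e]]]] := lirr_factorization OKp p0.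
exists L; split => //.
  by move: sL; rewrite (nrm_nat htau) lognX lognE pr_p /= prime_gt0 // dvdnn
    divnn prime_gt0 // logn1 muln1.
move=> q irr q0.
have qLw : ldvd p q (w * \prod_(q <- L) q).
  by rewrite -e mulrC; apply: ldvd_mulr => //; apply: lirr_dvd_p.
have LO (L' : seq K) : (forall q, q \in L' -> lirr q /\ q != 0) ->
    ring_of_integers (\prod_(q <- L') q).
  move=> h; rewrite big_seq; apply: OK_prod => q' /h[[]] //.
have nqw : ~ ldvd p q w.
  have qO : ring_of_integers q by case: irr.
  have w0 := coprime_nrm_neq0 pw.
  move=> /(ldvd_factor qO wO w0)[? [? [_ _ _ _ [_ _]]]].
  rewrite (logn_coprime_nrm pw) => /esym/eqP; rewrite addn_eq0 => /andP[].
  by rewrite eqn0Ngt logn_nrm_gt0 //; case: irr => _ ->.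
have [//|{qLw}] := lirr_prime irr q0 wO (LO L hL) qLw.
elim: L hL {sL e} => [|q' L IH] hL.
  rewrite big_nil => h; case: nqw.
  by rewrite -[w]mul1r; apply: ldvd_mulr.
rewrite big_cons => h.
have hL' q1 : q1 \in L -> lirr q1 /\ q1 != 0 by move=> ?; apply: hL;
  rewrite inE orbC; apply/orP; left.
have [irr' q'0] : lirr q' /\ q' != 0 by apply: hL; rewrite mem_head.
have [q'O _ hq'] := irr'; have [qO pq _] := irr.
have [qq'|/(IH hL')[q1 q1L h1]] := lirr_prime irr q0 q'O (LO L hL') h.
  by exists q'; [rewrite mem_head | exact: hq'].
by exists q1 => //; rewrite inE q1L orbT.
Qed.

(** Inverting the integers of norm prime to [p], the ring of integers becomes
    a principal ring with at most [d] primes. *)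
Theorem local_factorization : exists q : nat -> K,
  (forall i, [/\ ring_of_integers (q i), q i != 0 & (p %| nrm (q i))%N]) /\
  forall x, ring_of_integers x -> x != 0 -> exists (v : nat -> nat) u w,
    [/\ ring_of_integers u /\ ~~ (p %| nrm u)%N,
        ring_of_integers w /\ ~~ (p %| nrm w)%N &
        u * x = w * \prod_(i < d) q i ^+ v i].
Proof.
have [L [sL hL all_irr]] := irreducibles_at_prime.
pose q i := nth p%:R L i.
have d0 : (0 < d)%N by apply: adim_gt0.
have hq i : [/\ ring_of_integers (q i), q i != 0 & (p %| nrm (q i))%N].
  rewrite /q; case: (ltnP i (size L)) => hi.
    by have [[]] := hL _ (mem_nth p%:R hi).
  rewrite nth_default //; split; [exact: OKp | |
    by rewrite (nrm_nat htau) dvdn_exp].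
  by rewrite -[p%:R]/(p%:Z%:~R) intrK_eq0 -lt0n prime_gt0.
exists q; split => // x.
move: {2}(logn p (nrm x)) (leqnn (logn p (nrm x))) => n.
elim: n x => [|n IH] x le xO x0; have [px|npx] := boolP (p %| nrm x)%N.
- by move: le; rewrite leqNgt logn_nrm_gt0 // px.
- exists (fun=> 0%N), 1, x; split => //; first by split;
  [exact: OK1 | exact: coprime_nrm1].
  by rewrite big1 ?mul1r ?mulr1.
- have [q1 irr q1x] := exists_lirr_divisor xO x0 px.
  have q10 : q1 != 0.
    have [q1O _ _] := irr.
    by have [u [c [_ _ _ _ [q10 _ _]]]] := ldvd_factor q1O xO x0 q1x.
  have [q2 q2L q21] := all_irr q1 irr q10.
  have q2x := ldvd_trans htau pr_p q21 q1x.
  have [[q2O pq2 _] q20] := hL _ q2L.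
  have [u [c [uO cO pu e [_ c0 el]]]] := ldvd_factor q2O xO x0 q2x.
  have q2_1 : (0 < logn p (nrm q2))%N by rewrite logn_nrm_gt0.
  have [|v [u' [w [[u'O pu'] hw e']]]] := IH c _ cO c0.
    by move: le q2_1; rewrite el; clear; lia.
  have lt : (index q2 L < d)%N by apply: leq_trans sL; rewrite index_mem.
  pose i0 := Ordinal lt.
  have qi0 : q i0 = q2 by rewrite /q /= nth_index.
  exists (fun i => (i == i0 :> nat) + v i)%N, (u' * u), w; split => //.
    by split; [exact: OKM | exact: (coprime_nrmM htau)].
  rewrite -mulrA e mulrCA e' mulrCA; congr (_ * _).
  rewrite (bigD1 i0) //= [in RHS](bigD1 i0) //= eqxx add1n exprS qi0 mulrA.
  by congr (_ * _); apply: eq_bigr => i ii0; rewrite (negbTE (ii0 : i != i0 :>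
    nat)).
exists (fun=> 0%N), 1, x; split => //; first by split;
  [exact: OK1 | exact: coprime_nrm1].
by rewrite big1 ?mul1r ?mulr1.
Qed.

End LocalFactorization.

(** * Principal ideals and factorizations of the norm *)

Section Codes.
Variables (R : realType) (K : fieldExtType rat).
Local Notation d := (\dim {:K}).
Variable tau : 'I_d -> {rmorphism K -> R}.
Hypothesis htau : are_all_embeddings tau.

Lemma logn_prod (p : nat) (I : eqType) (r : seq I) (F : I -> nat) :
  (forall i, i \in r -> (0 < F i)%N) ->
  logn p (\prod_(i <- r) F i)%N = (\sum_(i <- r) logn p (F i))%N.
Proof.
elim: r => [|i r IH] F0; first by rewrite !big_nil logn1.
have Fr j : j \in r -> (0 < F j)%N by move=> jr; apply: F0; rewrite inE jr orbT.
rewrite !big_cons lognM ?IH ?F0 ?mem_head //.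
by rewrite big_seq; apply: prodn_cond_gt0.
Qed.

Lemma dvdn_of_logn (m n : nat) : (0 < m)%N -> (0 < n)%N ->
  (forall p, prime p -> (logn p m <= logn p n)%N) -> (m %| n)%N.
Proof.
move=> m0 n0 h; apply/dvdn_partP => // p; rewrite mem_primes =>
  /and3P[pr_p _ _].
by rewrite p_part pfactor_dvdn // h.
Qed.

(** The valuation of the norm is a combination of the [d] valuations with
    positive coefficients, so the last of these follows from the others and the
    norm. *)
Lemma local_valuations (p : nat) : prime p -> exists v : K -> nat -> nat,
  (forall x, ring_of_integers x -> x != 0 ->
     (\sum_(i < d) v x i <= logn p (nrm x))%N) /\
  (forall x y, ring_of_integers x -> x != 0 -> ring_of_integers y -> y != 0 ->
     nrm x = nrm y -> (forall i, (i < d.-1)%N -> v x i = v y i) ->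
     exists u w, [/\ ring_of_integers u /\ ~~ (p %| nrm u)%N,
       ring_of_integers w /\ ~~ (p %| nrm w)%N & u * x = w * y]).
Proof.
move=> pr_p; have [q [hq fact]] := local_factorization htau pr_p.
pose good x (v : nat -> nat) := exists u w,
   [/\ ring_of_integers u /\ ~~ (p %| nrm u)%N,
       ring_of_integers w /\ ~~ (p %| nrm w)%N & u * x = w * \prod_(i < d) q i
         ^+ v i].
have ex x : exists v, ring_of_integers x /\ x != 0 -> good x v.
  have [[xO x0]|h] := pselect (ring_of_integers x /\ x != 0);
    last by exists (fun=> 0%N).
  by have [v hv] := fact x xO x0; exists v.
pose v x := projT1 (cid (ex x)).
have vP x : ring_of_integers x -> x != 0 -> good x (v x).
  by move=> xO x0; rewrite /v; case: cid => /= w; apply.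
pose l i := logn p (nrm (q i)).
have l0 i : (0 < l i)%N.
  by rewrite /l (logn_nrm_gt0 htau pr_p); case: (hq i).
have qO (w : nat -> nat) : ring_of_integers (\prod_(i < d) q i ^+ w i).
  by apply: OK_prod => i _; apply: OKX; case: (hq i).
have q0 (w : nat -> nat) : \prod_(i < d) q i ^+ w i != 0.
  by apply/prodf_neq0 => i _; apply: expf_neq0; case: (hq i).
have logq (w : nat -> nat) : logn p (nrm (\prod_(i < d) q i ^+ w i)) = (\sum_(i
  < d) w i * l i)%N.
  have lX i n : logn p (nrm (q i ^+ n)) = (n * l i)%N.
    have [qiO qi0 _] := hq i; elim: n => [|n IH].
      by rewrite expr0 -[1]/(1%:R) (nrm_nat htau) exp1n logn1.
    rewrite exprS (logn_nrmM htau) ?expf_neq0 //; last exact: OKX.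
    by rewrite IH mulSn.
  elim: (index_enum _) => [|i r IH]; first by rewrite !big_nil -[1]/(1%:R)
    (nrm_nat htau) exp1n logn1.
  have O1 : ring_of_integers (q i ^+ w i) by apply: OKX; case: (hq i).
  have O2 : ring_of_integers (\prod_(i <- r) q i ^+ w i).
    by apply: OK_prod => j _; apply: OKX; case: (hq j).
  have N1 : q i ^+ w i != 0 by apply: expf_neq0; case: (hq i).
  have N2 : \prod_(i <- r) q i ^+ w i != 0.
    by rewrite prodf_seq_neq0; apply/allP => j _; apply: expf_neq0;
      case: (hq j).
  by rewrite !big_cons (logn_nrmM htau p O1 O2 N1 N2) lX IH.
have logx x : ring_of_integers x -> x != 0 -> logn p (nrm x) = (\sum_(i < d) v x
  i * l i)%N.
  move=> xO x0; have [u [w [[uO pu] [wO pw] e]]] := vP x xO x0.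
  have u0 := coprime_nrm_neq0 htau pu; have w0 := coprime_nrm_neq0 htau pw.
  have : logn p (nrm (u * x)) = logn p (nrm (w * \prod_(i < d) q i ^+ v x i))
    by rewrite e.
  rewrite (logn_nrmM htau p uO xO u0 x0) (logn_nrmM htau p wO (qO _) w0 (q0 _)).
  by rewrite (logn_coprime_nrm pr_p pu) (logn_coprime_nrm pr_p pw) logq.
exists v; split=> [x xO x0|x y xO x0 yO y0 exy ev].
  by rewrite logx // leq_sum // => i _; rewrite leq_pmulr.
have d0 : (0 < d)%N by apply: adim_gt0.
have lastE : v x d.-1 = v y d.-1.
  have E (w : nat -> nat) : (\sum_(i < d) w i * l i = \sum_(i < d.-1) w i * l i
    + w d.-1 * l d.-1)%N.
    by rewrite -(prednK d0) big_ord_recr.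
  have := logx x xO x0; rewrite exy (logx y yO y0) (E (v x)) (E (v y)).
  rewrite [X in _ = (X + _)%N](eq_bigr (fun i : 'I_d.-1 => v y i * l i)%N);
    last first.
    by move=> i _; rewrite ev.
  by move/addnI/eqP; rewrite eqn_pmul2r // => /eqP.
have [u [w [[uO pu] [wO pw] e]]] := vP x xO x0.
have [u' [w' [[u'O pu'] [w'O pw'] e']]] := vP y yO y0.
exists (w' * u), (w * u'); split.
- by split; [exact: OKM | exact: (coprime_nrmM htau)].
- by split; [exact: OKM | exact: (coprime_nrmM htau)].
rewrite -mulrA e -[RHS]mulrA e' mulrCA; congr (_ * (_ * _)).
apply: eq_bigr => i _; congr (_ ^+ _).
have : (i <= d.-1)%N by rewrite -ltnS prednK.
by rewrite leq_eqVlt => /orP[/eqP ->|/ev].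
Qed.

(** The integers [n] such that [n * z] is integral form an ideal, which is
    contained in no prime ideal. *)
Lemma OK_of_local (z : K) :
  (forall p, prime p -> exists s : nat, ~~ (p %| s)%N /\ ring_of_integers (s%:R
    * z)) ->
  ring_of_integers z.
Proof.
move=> h; pose P n := (0 < n)%N && `[< ring_of_integers (n%:R * z) >].
have exP : exists n, P n.
  have [n [n0 nz]] := OK_denominator z; exists `|n|%N.
  rewrite /P absz_gt0 n0; apply/asboolP.
  case: (intP n) nz => [|k|k]; rewrite ?abszN //.
  by rewrite rmorphN mulNr => /OKN; rewrite opprK.
case: (ex_minnP exP) => n /andP[n0 /asboolP nz] nmin.
have [n1|n1] := leqP n 1.
  have n1' : n = 1%N by apply/eqP; rewrite eqn_leq n1.
  by move: nz; rewrite n1' mul1r.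
have [s [ps sz]] := h (pdiv n) (pdiv_prime n1).
case: (egcdnP s n0) => u v e _.
have gz : ring_of_integers ((gcdn n s)%:R * z).
  have -> : (gcdn n s)%:R * z = u%:R * (n%:R * z) - v%:R * (s%:R * z) :> K.
    have := congr1 (fun m : nat => m%:R : K) e; rewrite natrD !natrM => e'.
    by rewrite !mulrA e' mulrDl addrAC subrr add0r.
  have natO m : ring_of_integers (m%:R : K) by apply: (OK_int _ m%:Z).
  by apply: OKB; apply: OKM.
have /nmin le : P (gcdn n s) by rewrite /P gcdn_gt0 n0; apply/asboolP.
have ns : (n %| s)%N.
  have /eqP <- : gcdn n s == n; last exact: dvdn_gcdr.
  by rewrite eqn_leq le andbT dvdn_leq // dvdn_gcdl.
by case/negP: ps; apply: dvdn_trans ns; apply: pdiv_dvd.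
Qed.

(** The quotient of the norm of [u] by [u] is an integer: its first conjugate
    is the product of the other conjugates of [u]. *)
Lemma norm_cofactor_OK (u : K) : ring_of_integers u -> u != 0 ->
  ring_of_integers ((nrm u)%:R / u).
Proof.
move=> uO u0; have d0 : (0 < d)%N by apply: adim_gt0.
have [a ea] := field_norm_int htau uO.
have h : ring_of_integers (a%:~R / u).
  pose k0 : 'I_d := Ordinal d0; apply/(OK_embedding (tau k0)).
  have -> : tau k0 (a%:~R / u) = \prod_(k | k != k0) tau k u.
    have eN : a%:~R = \prod_k tau k u :> R.
      by rewrite -(field_normE htau) ea rmorph_int.
    rewrite fmorph_div rmorph_int eN (bigD1 k0) //= mulrC mulKf //.
    by rewrite fmorph_eq0.
  elim/big_ind: _ => [||k _]; [exact: integral1 | exact: integral_mul |].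
  exact/OK_embedding.
rewrite (nrm_int ea); case: (intP a) h => [|n|n]; rewrite ?abszN //.
by rewrite rmorphN mulNr => /OKN; rewrite opprK.
Qed.

Lemma quotient_OK_of_local (x y : K) : y != 0 ->
  (forall p, prime p -> exists u w,
      [/\ ring_of_integers u /\ ~~ (p %| nrm u)%N,
          ring_of_integers w /\ ~~ (p %| nrm w)%N & u * x = w * y]) ->
  ring_of_integers (x / y).
Proof.
move=> y0 h; apply: OK_of_local => p pr_p.
have [u [w [[uO pu] [wO _] e]]] := h p pr_p.
have u0 := coprime_nrm_neq0 htau pu.
exists (nrm u); split => //.
have -> : (nrm u)%:R * (x / y) = (nrm u)%:R / u * w.
  have -> : w = u * x / y by rewrite e mulfK.
  by field; rewrite u0 y0.
by apply: OKM => //; apply: norm_cofactor_OK.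
Qed.

(** The ideal generated by an integer is encoded by a factorization of its norm
    into [d] factors: at each prime, the exponents of the first [d - 1] factors
    are the first [d - 1] valuations. *)
Theorem norm_factorization_code : exists code : K -> seq nat,
  (forall x, ring_of_integers x -> x != 0 ->
     [/\ size (code x) = d, all (leq 1) (code x) &
         (\prod_(n <- code x) n)%N = nrm x]) /\
  (forall x y, ring_of_integers x -> x != 0 -> ring_of_integers y -> y != 0 ->
     code x = code y -> ring_of_integers (x / y)).
Proof.
have ex (p : nat) : exists v : K -> nat -> nat, prime p ->
  (forall x, ring_of_integers x -> x != 0 ->
     (\sum_(i < d) v x i <= logn p (nrm x))%N) /\
  (forall x y, ring_of_integers x -> x != 0 -> ring_of_integers y -> y != 0 ->
     nrm x = nrm y -> (forall i, (i < d.-1)%N -> v x i = v y i) ->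
     exists u w, [/\ ring_of_integers u /\ ~~ (p %| nrm u)%N,
       ring_of_integers w /\ ~~ (p %| nrm w)%N & u * x = w * y]).
  have [pr_p|npr] := boolP (prime p); last by exists (fun _ _ => 0%N).
  by have [v hv] := local_valuations pr_p; exists v.
pose v p := projT1 (cid (ex p)).
have vP p : prime p -> _ := projT2 (cid (ex p)); rewrite -/(v _) in vP.
pose n x i := (\prod_(p <- primes (nrm x)) p ^ v p x i)%N.
have F0 x i p : p \in primes (nrm x) -> (0 < p ^ v p x i)%N.
  by rewrite mem_primes => /and3P[pr_p _ _]; rewrite expn_gt0 prime_gt0.
have n0 x i : (0 < n x i)%N by rewrite /n big_seq; apply: prodn_cond_gt0;
  apply: F0.
have logn_n x i p : prime p ->
    logn p (n x i) = if p \in primes (nrm x) then v p x i else 0%N.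
  move=> pr_p; rewrite /n logn_prod; last exact: F0.
  have E q : q \in primes (nrm x) -> logn p (q ^ v q x i) = (v q x i * (p ==
    q))%N.
    by rewrite mem_primes => /and3P[pr_q _ _]; rewrite lognX logn_prime.
  rewrite (eq_big_seq _ E); case: ifP => [px|/negbT px].
    rewrite (bigD1_seq p) ?primes_uniq //= eqxx muln1 big1 ?addn0 // => q qp.
    by rewrite eq_sym (negbTE qp) muln0.
  rewrite big_seq big1 // => q qx; case: eqP => [pq|]; last by rewrite muln0.
  by rewrite pq qx in px.
pose k := d.-1; pose P x := (\prod_(i <- iota 0 k) n x i)%N.
have d0 : (0 < d)%N by apply: adim_gt0.
have P0 x : (0 < P x)%N by rewrite prodn_gt0.
have dvP x : ring_of_integers x -> x != 0 -> (P x %| nrm x)%N.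
  move=> xO x0; apply: dvdn_of_logn => [//||p pr_p];
    first exact: (nrm_gt0 htau).
  rewrite logn_prod //; under eq_bigr => i _ do rewrite logn_n //.
  case: (p \in primes (nrm x)); last by rewrite big1.
  have [h _] := vP p pr_p; apply: leq_trans (h x xO x0).
  have E (w : nat -> nat) : (\sum_(i <- iota 0 k) w i <= \sum_(i < d) w i)%N.
    by rewrite -(prednK d0) big_ord_recr -[X in iota 0 X]subn0 big_mkord
      leq_addr.
  exact: E.
exists (fun x => (nrm x %/ P x)%N :: [seq n x i | i <- iota 0 k]).
have prodE x : ring_of_integers x -> x != 0 ->
    (\prod_(m <- (nrm x %/ P x)%N :: [seq n x i | i <- iota 0 k]) m)%N = nrm x.
  by move=> xO x0; rewrite big_cons big_map divnK // dvP.
split=> [x xO x0|x y xO x0 yO y0 exy].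
  split; [by rewrite /= size_map size_iota prednK | | exact: prodE].
  rewrite /= divn_gt0 // dvdn_leq ?dvP ?(nrm_gt0 htau) //=.
  by apply/allP => _ /mapP[i _ ->].
have eN : nrm x = nrm y by rewrite -(prodE x) // -(prodE y) // exy.
case: exy => _ en; apply: quotient_OK_of_local => // p pr_p.
have [hx hxy] := vP p pr_p; apply: hxy => // i ik.
have eni : n x i = n y i.
  have := congr1 (fun s => nth 0%N s i) en.
  by rewrite !(nth_map 0%N) ?size_iota // !nth_iota.
have := logn_n x i p pr_p; have := logn_n y i p pr_p; rewrite eni eN => ->.
case: ifP => // /negbT py _.
have z (x' : K) : ring_of_integers x' -> x' != 0 -> nrm x' = nrm y ->
  v p x' i = 0%N.
  move=> x'O x'0 e; apply/eqP; rewrite -leqn0.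
  have id : (i < d)%N by apply: leq_trans ik _; rewrite leq_pred.
  have := hx x' x'O x'0; rewrite e (bigD1 (Ordinal id)) //=.
  have -> : logn p (nrm y) = 0%N by rewrite lognE; move: py; rewrite mem_primes;
    case: ifP => // /and3P[-> -> ->].
  by apply: leq_trans; rewrite leq_addr.
exact: (etrans (z x xO x0 eN) (esym (z y yO y0 erefl))).
Qed.

End Codes.

(** * Totally positive units modulo squares *)

Lemma exponential_gap (B C : nat) : (0 < B)%N ->
  exists k, (C * B ^ k < B.+1 ^ k)%N.
Proof.
move=> B0; have H k : ((B + k) * B ^ k <= B.+1 ^ k * B)%N.
  elim: k => [|k IH]; first by rewrite !expn0 addn0 muln1 mul1n.
  rewrite !expnS; have := leq_mul (leqnn B.+1) IH.
  move: (B ^ k)%N (B.+1 ^ k)%N B0 => x y; clear; nia.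
exists (B * C)%N; rewrite -(ltn_pmul2r B0); apply: leq_trans (H _).
have := expn_gt0 B (B * C); rewrite B0 /=.
by move: (B ^ (B * C))%N B0 => x; clear; nia.
Qed.

Section UnitsModSquares.
Variables (R : realType) (K : fieldExtType rat).
Local Notation d := (\dim {:K}).
Variable tau : 'I_d -> {rmorphism K -> R}.
Hypothesis htau : are_all_embeddings tau.

Definition tp_unit (u : K) :=
  [/\ ring_of_integers u, ring_of_integers u^-1 & forall k, 0 < tau k u].

Lemma tp_unit_neq0 u : tp_unit u -> u != 0.
Proof.
move=> [_ _ pos]; have d0 : (0 < d)%N by apply: adim_gt0.
by apply: contraTneq (pos (Ordinal d0)) => ->; rewrite rmorph0 ltxx.
Qed.

Lemma tp_unit1 : tp_unit 1.
Proof. by split; rewrite ?invr1; [exact: OK1 | exact: OK1 | move=> k;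
  rewrite rmorph1]. Qed.

Lemma tp_unitM u v : tp_unit u -> tp_unit v -> tp_unit (u * v).
Proof.
move=> [uO u'O up] [vO v'O vp]; split; [exact: OKM | rewrite invfM;
  exact: OKM |].
by move=> k; rewrite rmorphM mulr_gt0.
Qed.

Lemma tp_unitV u : tp_unit u -> tp_unit u^-1.
Proof.
by move=> [uO u'O up]; split; rewrite ?invrK // => k; rewrite fmorphV invr_gt0.
Qed.

(** The product [x_0 * x_1 ^ 2 * x_2 ^ 4 * ...] of the letters: modulo squares
    it is its first letter, so all the letters can be recovered one by one. *)
Definition word (s : seq K) : K := foldr (fun x y => x * y ^+ 2) 1 s.

Lemma tp_unit_word (s : seq K) : (forall x, x \in s -> tp_unit x) ->
  tp_unit (word s).
Proof.
elim: s => [|x s IH] hs /=; first exact: tp_unit1.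
have hw : tp_unit (word s) by apply: IH => y ys; apply: hs; rewrite inE ys orbT.
by rewrite expr2; apply: tp_unitM; [apply: hs;
  rewrite mem_head | apply: tp_unitM].
Qed.

Variable L : seq K.
Hypothesis L_unit : forall x, x \in L -> tp_unit x.
Hypothesis L_ineq : forall x y w, x \in L -> y \in L -> tp_unit w ->
  y = x * w ^+ 2 -> x = y.

Lemma word_inj (s t : seq K) : {subset s <= L} -> {subset t <= L} ->
  size s = size t -> word s = word t -> s = t.
Proof.
elim: s t => [|x s IH] [|y t] //= sL tL [st] e.
have sL' : {subset s <= L} by move=> z zs; apply: sL; rewrite inE zs orbT.
have tL' : {subset t <= L} by move=> z zs; apply: tL; rewrite inE zs orbT.
have us : tp_unit (word s) by apply: tp_unit_word => z /sL'/L_unit.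
have ut : tp_unit (word t) by apply: tp_unit_word => z /tL'/L_unit.
have s0 := tp_unit_neq0 us; have t0 := tp_unit_neq0 ut.
have xy : x = y.
  apply: (L_ineq (w := word s / word t)); [by apply: sL;
    rewrite mem_head | by apply: tL; rewrite mem_head | |].
    exact/tp_unitM/tp_unitV.
  by rewrite expr_div_n mulrA e mulfK // expf_neq0.
have x0 : x != 0 by apply/tp_unit_neq0/L_unit/sL; rewrite mem_head.
congr (_ :: _) => //; apply: IH => //.
move: e; rewrite -xy => /(mulfI x0)/eqP; rewrite eqf_sqr =>
  /orP[/eqP //|/eqP e].
have d0 : (0 < d)%N by apply: adim_gt0.
have [_ _ /(_ (Ordinal d0)) h1] := us; have [_ _ /(_ (Ordinal d0)) h2] := ut.
by move: h1; rewrite e rmorphN oppr_gt0 => /(lt_trans h2); rewrite ltxx.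
Qed.

(** Logarithms to the base [2], so that two units in the same cell of side [1]
    have conjugates with ratios between [1 / 2] and [2]. *)
Definition lambda k (x : K) : R := ln (tau k x) / ln 2.

Lemma ln2_gt0 : 0 < ln 2 :> R. Proof. by rewrite ln_gt0 // ltr1n. Qed.

Lemma lambda_word k (c : R) (s : seq K) : {subset s <= L} -> 0 <= c ->
  (forall x, x \in L -> `|lambda k x| <= c) ->
  `|lambda k (word s)| <= c * (2 ^ size s)%:R.
Proof.
move=> sL c0 hc; apply: (@le_trans _ _ (c * ((2 ^ size s)%:R - 1))); last first.
  by rewrite ler_wpM2l // lerBlDr lerDl.
elim: s sL => [|x s IH] sL /=.
  by rewrite /lambda rmorph1 ln1 mul0r normr0 expn0 subrr mulr0.
have sL' : {subset s <= L} by move=> z zs; apply: sL; rewrite inE zs orbT.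
have [_ _ /(_ k) wp] : tp_unit (word s) by apply: tp_unit_word => z /sL'/L_unit.
have [_ _ /(_ k) xp] : tp_unit x by apply: L_unit; apply: sL; rewrite mem_head.
have -> : lambda k (x * word s ^+ 2) = lambda k x + 2 * lambda k (word s).
  rewrite /lambda rmorphM rmorphXn /= lnM ?posrE
    ?exprn_gt0 // lnXn // -mulr_natl; ring.
apply: (le_trans (ler_normD _ _)); have -> : `|2 * lambda k (word s)| = 2 *
  `|lambda k (word s)|.
  by rewrite [LHS]normrM ger0_norm.
have h1 := hc x (sL x (mem_head _ _)); have h2 := IH sL'.
rewrite expnS natrM; move: h1 h2; clear; lra.
Qed.

(** The quotient minus [1] is an integer whose conjugates are all less than
    [1] in absolute value. *)
Lemma close_units_eq (u v : K) : tp_unit u -> tp_unit v ->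
  (forall k, Num.floor (lambda k u) = Num.floor (lambda k v)) -> u = v.
Proof.
move=> hu hv h; have v0 := tp_unit_neq0 hv.
have hz : tp_unit (u / v) by apply/tp_unitM/tp_unitV.
have [zO _ zpos] := hz.
suff : u / v - 1 = 0 by move/subr0_eq => e; rewrite -(divfK v0 u) e mul1r.
apply/eqP; apply: contraT => z0.
have zO' : ring_of_integers (u / v - 1) by apply: OKB => //; exact: OK1.
have := field_norm_ge1 htau zO' z0.
rewrite -(ler_rat R) rmorph1 ratr_norm (field_normE htau) normr_prod leNgt =>
  /negP[].
have lt1 k : `|tau k (u / v - 1)| < 1.
  rewrite rmorphB rmorph1.
  have [_ _ /(_ k) up] := hu; have [_ _ /(_ k) vp] := hv.
  have e : lambda k u - lambda k v = ln (tau k (u / v)) / ln 2.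
    by rewrite /lambda fmorph_div ln_div ?posrE // mulrBl.
  have h1 := floor_le (lambda k u); have h2 := floorD1_gt (lambda k u).
  have h3 := floor_le (lambda k v); have h4 := floorD1_gt (lambda k v).
  have zp := zpos k; rewrite h rmorphD /= in h1 h2; rewrite rmorphD /= in h4.
  have b1 : ln (tau k (u / v)) < ln 2.
    by rewrite -[ltRHS]mul1r -ltr_pdivrMr ?ln2_gt0 // -e; move: h2 h3; clear;
      lra.
  have b2 : - ln 2 < ln (tau k (u / v)).
    by rewrite -mulN1r -ltr_pdivlMr ?ln2_gt0 // -e; move: h1 h4; clear; lra.
  rewrite -lnV ?posrE // in b2.
  rewrite ltr_ln ?posrE // in b1; rewrite ltr_ln ?posrE ?invr_gt0 // in b2.
  by rewrite ltr_norml; apply/andP; split; move: b1 b2 zp; clear; lra.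
have d0 : (0 < d)%N by apply: adim_gt0.
rewrite (bigD1 (Ordinal d0)) //=; apply: le_lt_trans (lt1 (Ordinal d0)).
rewrite ler_piMr // prodr_ile1 // => k _; rewrite normr_ge0 /=.
exact/ltW.
Qed.

(** The words of length [k] in [M] letters are [M ^ k] distinct units whose
    logarithms lie in a cube of side [O(2 ^ k)] in dimension [d], which holds
    only [O(2 ^ (d k))] units. *)
Theorem units_mod_squares : uniq L -> (size L <= 2 ^ d)%N.
Proof.
move=> uL; rewrite leqNgt; apply/negP => big.
have [c [c0 hc]] : exists c : nat, (0 < c)%N /\
    forall k x, x \in L -> `|lambda k x| <= c%:R.
  pose b := \sum_k \sum_(x <- L) `|lambda k x|.
  exists (Num.truncn b).+1; split => // k x xL.
  apply: (le_trans _ (ltW (truncnS_gt b))).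
  rewrite /b (bigD1 k) //= (big_rem x) //= -addrA lerDl addr_ge0 ?sumr_ge0 //.
  by move=> i _; apply: sumr_ge0.
have bound k : ((size L) ^ k <= (3 * c) ^ d * (2 ^ d) ^ k)%N.
  (* The logarithms lie between [- c * 2 ^ k] and [c * 2 ^ k], which leaves at
     most [2 * c * 2 ^ k + 1] cells. *)
  pose m := (3 * c * 2 ^ k)%N.
  have m0 : (0 < m)%N by rewrite !muln_gt0 c0 expn_gt0.
  pose W (s : k.-tuple 'I_(size L)) : seq K :=
    [seq tnth (in_tuple L) i | i <- s].
  have WL s : {subset W s <= L} by move=> _ /mapP[i _ ->]; apply: mem_tnth.
  pose fl s i : int := Num.floor (lambda i (word (W s))) + (c * 2 ^ k)%:Z.
  have szW s : size (W s) = k by rewrite size_map size_tuple.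
  have fl_bd s i : 0 <= fl s i < m%:Z.
    have := @lambda_word i c%:R (W s) (WL s) (ler0n _ c) (hc i).
    rewrite szW -natrM ler_norml => /andP[h1 h2].
    have g1 : - (c * 2 ^ k)%:Z <= Num.floor (lambda i (word (W s))).
      by rewrite floor_ge_int rmorphN.
    have g2 : Num.floor (lambda i (word (W s))) <= (c * 2 ^ k)%:Z.
      by rewrite -(ler_int R); apply: le_trans (floor_le _) h2.
    have x0 : (0 < c * 2 ^ k)%N by rewrite muln_gt0 c0 expn_gt0.
    rewrite /fl /m -mulnA; move: (c * 2 ^ k)%N x0 g1 g2 => x; clear.
    by move: (Num.floor _) => y; lia.
  have lt_m s i : (`|fl s i| < m)%N.
    by have /andP[h1 h2] := fl_bd s i; rewrite -ltz_nat gez0_abs.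
  pose F s : {ffun 'I_d -> 'I_m} := [ffun i => Ordinal (lt_m s i)].
  have injF : injective F.
    move=> s t /ffunP e; apply/val_inj.
    have WE : W s = W t.
      apply: word_inj; [exact: WL | exact: WL | by rewrite !szW |].
      apply: close_units_eq; try by apply: tp_unit_word => x /WL/L_unit.
      move=> i; have := e i; rewrite !ffunE => /(congr1 (fun o =>
        (val o)%:Z)) /=.
      have /andP[h1 _] := fl_bd s i; have /andP[h2 _] := fl_bd t i.
      by rewrite !gez0_abs // => /addIr.
    apply: (inj_map _ WE) => i j; rewrite !(tnth_nth 0) /= => /eqP.
    by rewrite nth_uniq // => /eqP/val_inj.
  have := leq_card F injF; rewrite card_tuple card_ffun !card_ord /m expnMn.
  by rewrite -!expnM [(k * d)%N]mulnC.
have B0 : (0 < 2 ^ d)%N by rewrite expn_gt0.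
have [k hk] := exponential_gap ((3 * c) ^ d) B0.
have le : ((2 ^ d).+1 ^ k <= size L ^ k)%N.
  by case: k {hk} => // k; rewrite leq_exp2r.
by have := leq_trans hk (leq_trans le (bound k)); rewrite ltnn.
Qed.

End UnitsModSquares.

(** * Counting factorizations *)

(** The ordered factorizations into [k] factors of the positive integers up to
    [X]. *)
Fixpoint factorizations (k X : nat) : seq (seq nat) :=
  if k is k'.+1 then
    [seq n :: t | n <- iota 1 X, t <- factorizations k' (X %/ n)]
  else [:: [::]].

Lemma mem_factorizations (s : seq nat) (X : nat) :
  all (leq 1) s -> (\prod_(n <- s) n <= X)%N -> s \in factorizations (size s) X.
Proof.
elim: s X => [|n s IH] X //= /andP[n0 s0]; rewrite big_cons => le.
have p0 : (0 < \prod_(m <- s) m)%N.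
  by rewrite big_seq; apply: prodn_cond_gt0 => m ms; apply: (allP s0).
apply/allpairsPdep; exists n, s; split => //.
  by rewrite mem_iota n0 add1n ltnS; apply: leq_trans le; rewrite leq_pmulr.
by apply: IH => //; rewrite leq_divRL // mulnC.
Qed.

Lemma harmonic_le (R : realType) (X : nat) : (0 < X)%N ->
  \sum_(n <- iota 1 X) (n%:R)^-1 <= 1 + ln (X%:R) :> R.
Proof.
case: X => // X _; elim: X => [|X IH].
  by rewrite big_seq1 invr1 ln1 addr0.
rewrite -[X.+2]addn1 iotaD big_cat big_seq1 add1n.
have x0 : 0 < X.+1%:R :> R by rewrite ltr0n.
have y0 : 0 < X.+2%:R :> R by rewrite ltr0n.
have h : ln (1 + - (X.+2%:R)^-1) <= - (X.+2%:R)^-1 :> R.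
  by apply: le_ln1Dx; rewrite ltrN2 invf_lt1 ?ltr1n // posrE.
have e : 1 + - (X.+2%:R)^-1 = X.+1%:R / X.+2%:R :> R.
  apply: (mulIf (lt0r_neq0 y0)).
  by rewrite mulrDl mulNr mulVf ?gt_eqF // mul1r divfK
    ?gt_eqF // -[X.+2%:R]natr1 addrK.
rewrite e ln_div ?posrE // in h; rewrite addn1.
apply: (le_trans (lerD IH (lexx _))).
by rewrite -addrA lerD2l -lerBrDr -lerBlDl.
Qed.

Lemma size_factorizationsS (k X : nat) :
  size (factorizations k.+1 X) =
    (\sum_(n <- iota 1 X) size (factorizations k (X %/ n)))%N.
Proof.
rewrite [factorizations _ _]/= size_flatten /shape -map_comp sumnE big_map.
by apply: eq_bigr => n _; rewrite /= size_map.
Qed.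

Lemma size_factorizations (R : realType) (k X : nat) : (0 < X)%N ->
  (size (factorizations k.+1 X))%:R <= X%:R * (1 + ln X%:R) ^+ k :> R.
Proof.
have ln0 Y : (0 < Y)%N -> 0 <= ln (Y%:R : R) by move=> Y0;
  rewrite ln_ge0 // ler1n.
elim: k X => [|k IH] X X0.
  by rewrite expr0 mulr1 ler_nat size_factorizationsS sum1_size size_iota.
rewrite size_factorizationsS natr_sum.
apply: (@le_trans _ _ (\sum_(n <- iota 1 X) X%:R * (1 + ln X%:R) ^+ k *
  (n%:R)^-1)).
  rewrite big_seq [leRHS]big_seq; apply: ler_sum => n.
  rewrite mem_iota add1n ltnS => /andP[n0 nX].
  have q0 : (0 < X %/ n)%N by rewrite divn_gt0.
  apply: (le_trans (IH _ q0)).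
  have n0' : 0 < n%:R :> R by rewrite ltr0n.
  have h1 : (X %/ n)%:R <= X%:R / n%:R :> R.
    by rewrite ler_pdivlMr // -natrM ler_nat leq_divM.
  have h2 : ln (X %/ n)%:R <= ln X%:R :> R.
    by rewrite ler_ln ?posrE ?ltr0n // ler_nat leq_div.
  rewrite mulrAC; apply: ler_pM => //.
    by apply: exprn_ge0; rewrite addr_ge0 // ln0.
  by rewrite lerXn2r ?nnegrE ?lerD2l // addr_ge0 // ln0.
rewrite -mulr_sumr exprSr mulrA ler_wpM2l ?harmonic_le // mulr_ge0 //.
by rewrite exprn_ge0 // addr_ge0 // ln0.
Qed.

Lemma fiber_count (A B : eqType) (f : A -> B) (s : seq A) (T : seq B) m :
  (forall x, x \in s -> f x \in T) ->
  (forall c, (size [seq x <- s | f x == c] <= m)%N) ->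
  (size s <= m * size T)%N.
Proof.
elim: T s => [|c T IH] s hT hm.
  by case: s hT {hm} => // x s /(_ x (mem_head _ _)).
rewrite mulnS -(count_predC (fun x => f x == c)) leq_add //.
  by rewrite -size_filter.
rewrite -size_filter; apply: IH => [x|c'].
  by rewrite mem_filter => /andP[/= /negbTE n xs]; have := hT x xs;
    rewrite inE n.
apply: leq_trans (hm c'); rewrite -filter_predI !size_filter.
by apply: sub_count => x /= /andP[].
Qed.

Lemma bounded_set_seq (T : eqType) (S : T -> Prop) (n : nat) :
  (forall s : seq T, uniq s -> (forall x, x \in s -> S x) -> (size s <= n)%N) ->
  exists s : seq T, [/\ uniq s, (size s <= n)%N & forall x, S x <-> x \in s].
Proof.
move=> h; pose P m := `[< exists s : seq T, [/\ uniq s, forall x, x \in s ->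
  S x & size s = m] >].
have exP : exists m, P m by exists 0%N; apply/asboolP; exists [::].
have bP m : P m -> (m <= n)%N by move=> /asboolP[s [us sS <-]]; apply: h.
case: (ex_maxnP exP bP) => m /asboolP[s [us sS sm]] max.
exists s; split; [exact: us | exact: h | move=> x; split => [Sx|];
  last exact: sS].
apply: contraT => xs; have /max : P m.+1; last by rewrite ltnn.
apply/asboolP; exists (x :: s); split => /=; [by rewrite xs | | by rewrite sm].
by move=> y; rewrite inE => /orP[/eqP ->|/sS].
Qed.

(** * The diagonal form *)

Lemma qform_diag (K : fieldExtType rat) n (r v : 'rV[K]_n) :
  qform (diag_mx r) v = \sum_i r 0 i * v 0 i ^+ 2.
Proof.
rewrite /qform mul_mx_diag mxE; apply: eq_bigr => i _.
by rewrite !mxE expr2 mulrCA mulrA mulrC.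
Qed.

Lemma totally_positive_diag (R : realType) (K : fieldExtType rat) n (r :
  'rV[K]_n) :
  (forall i, totally_positive R (r 0 i)) ->
  totally_positive_definite R (diag_mx r).
Proof.
move=> hr v v0 sigma; have [i vi] : exists i, v 0 i != 0.
  apply/existsP; rewrite -negb_forall; apply: contra v0 => /forallP h.
  by apply/eqP/rowP => i; rewrite mxE; apply/eqP.
rewrite qform_diag rmorph_sum (bigD1 i) //= ltr_pwDl //.
  rewrite rmorphM rmorphXn /= mulr_gt0 ?hr //.
  by rewrite exprn_even_gt0 //= fmorph_eq0.
apply: sumr_ge0 => j _; rewrite rmorphM rmorphXn /= mulr_ge0 ?sqr_ge0 //.
exact/ltW/hr.
Qed.

Section Assembly.
Variables (R : realType) (K : fieldExtType rat).
Local Notation d := (\dim {:K}).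
Variable tau : 'I_d -> {rmorphism K -> R}.
Hypothesis htau : are_all_embeddings tau.

(** A sum of squares of integers is the value at an integral basis of a sum of
    squares of integral linear forms. *)
Lemma pythagoras_bound_of_forms (N : nat) :
  (forall s : seq 'rV[int]_d, exists2 s', (size s' <= N)%N & sumsq s' = sumsq s)
    ->
  pythagoras_bound K N.
Proof.
move=> hN m x [v vO ->]; have [b [[bO hb] _ _ _]] := discriminantP htau.
pose beta (w : 'rV[int]_d) : K := \sum_j tnth b j *~ w 0 j.
have betaO w : ring_of_integers (beta w).
  by apply: OK_sum => j _; apply: OK_mulrz.
have ex i : exists w, v i = beta w.
  have [c [ec _]] := hb _ (vO i); exists (\row_j c j).
  by rewrite ec; apply: eq_bigr => j _; rewrite mxE.
pose w i := projT1 (cid (ex i)).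
have wE i : v i = beta (w i) by rewrite /w; case: cid.
pose eval (A : 'M[int]_d) : K := \sum_j \sum_k (tnth b j * tnth b k) *~ A j k.
have evalE s : eval (sumsq s) = \sum_(u <- s) beta u ^+ 2.
  elim: s => [|u s IH].
    rewrite /sumsq !big_nil /eval big1 // => j _; rewrite big1 // => k _.
    by rewrite mxE mulr0z.
  have -> : sumsq (u :: s) = u^T *m u + sumsq s by rewrite /sumsq big_cons.
  rewrite big_cons -IH /eval.
  have -> : beta u ^+ 2 = \sum_j \sum_k (tnth b j * tnth b k) *~ (u^T *m u) j k.
    rewrite expr2 mulr_suml; apply: eq_bigr => j _; rewrite mulr_sumr.
    apply: eq_bigr => k _; rewrite mxE big_ord1 !mxE.
    by rewrite mulrzAl mulrzAr -mulrzA [u 0 k * _]mulrC.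
  rewrite -big_split; apply: eq_bigr => j _ /=.
  by rewrite -big_split; apply: eq_bigr => k _ /=; rewrite -mulrzDr;
    congr (_ *~ _); rewrite [LHS]mxE.
have [s' sN es'] := hN [seq w i | i <- enum 'I_m].
exists (fun i : 'I_N => beta (nth 0 s' i)) => //.
have -> : \sum_(i < m) v i ^+ 2 = eval (sumsq [seq w i | i <- enum 'I_m]).
  by rewrite evalE big_map big_enum /=; apply: eq_bigr => i _; rewrite wE.
rewrite -es' evalE (big_nth 0) big_mkord.
have beta0 : beta 0 = 0.
  by rewrite /beta big1 // => j _; rewrite mxE mulr0z.
rewrite (big_ord_widen N (fun i => beta (nth 0 s' i) ^+ 2)) //.
rewrite [RHS](bigID (fun i : 'I_N => (i < size s')%N)) /= [X in _ = _ + X]big1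
  ?addr0 //.
by move=> i; rewrite -leqNgt => hi; rewrite nth_default // beta0 expr0n.
Qed.

Lemma pythagoras_number_exists (N : nat) : (0 < N)%N -> pythagoras_bound K N ->
  exists2 P, is_pythagoras_number K P & (P <= N)%N.
Proof.
move=> N0 bN; pose Q n := (0 < n)%N && `[< pythagoras_bound K n >].
have exQ : exists n, Q n by exists N; rewrite /Q N0; apply/asboolP.
case: (ex_minnP exQ) => P /andP[P0 /asboolP bP] Pmin; exists P.
  by split => // n n0 bn; apply: Pmin; rewrite /Q n0; apply/asboolP.
by apply: Pmin; rewrite /Q N0; apply/asboolP.
Qed.

Lemma square_unit_equiv_refl (a : K) : square_unit_equiv a a.
Proof.
exists 1; last by rewrite expr1n mulr1.
by split; rewrite ?oner_eq0 // ?invr1; exact: OK1.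
Qed.

Lemma representatives_inequiv (S : set K) a b : is_representative_set R S ->
  S a -> S b -> square_unit_equiv a b -> a = b.
Proof.
move=> [Ssmall Srep] Sa Sb ab; have [s [_ us]] := Srep a (Ssmall a Sa).
rewrite -(us a); last by split => //; exact: square_unit_equiv_refl.
by rewrite -(us b).
Qed.

(** Elements with the same code differ by totally positive units, and there are
    at most [2 ^ d] of these modulo squares. *)
Lemma card_representatives (S : set K) (D : nat) : is_representative_set R S ->
  discriminant K = D%:R -> forall s : seq K, uniq s -> (forall x, x \in s ->
    S x) ->
  (size s <= 2 ^ d * size (factorizations d D))%N.
Proof.
move=> hS eD s us sS; have [Ssmall _] := hS.
have [code [codeP code_inj]] := norm_factorization_code htau.
have SO x : S x -> ring_of_integers x by move=> /Ssmall[].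
have Spos x k : S x -> 0 < tau k x by move=> /Ssmall[].
have d0 : (0 < d)%N by apply: adim_gt0.
have Sn0 x : S x -> x != 0.
  by move=> Sx; apply: contraTneq (Spos x (Ordinal d0) Sx) => ->;
    rewrite rmorph0 ltxx.
apply: (@fiber_count _ _ code) => [x xs|c].
  have Sx := sS x xs; have [sz pos prod] := codeP x (SO x Sx) (Sn0 x Sx).
  rewrite -sz; apply: mem_factorizations => //; rewrite prod.
  have [_ _] := Ssmall x Sx; have [z ez] := field_norm_int htau (SO x Sx).
  have z0 : 0 < z.
    rewrite -(ltr0z rat) -ez -(ltr_rat R) rmorph0 (field_normE htau).
    by apply: prodr_gt0 => k _; apply: Spos.
  by rewrite (nrm_int ez) -(ler_nat rat) natr_absz gtr0_norm // -ez eD.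
set L' := seq.filter _ _; have uL' : uniq L' by rewrite filter_uniq.
have L'P x : x \in L' -> S x /\ code x = c.
  by rewrite mem_filter => /andP[/eqP -> /sS].
case eL : L' => [//|a0 L''].
have [Sa0 ca0] : S a0 /\ code a0 = c by apply: L'P; rewrite eL mem_head.
rewrite -eL -(size_map (fun a => a / a0)).
have a00 := Sn0 a0 Sa0.
apply: (units_mod_squares htau).
- move=> _ /mapP[a /L'P[Sa ca] ->]; split.
  + by apply: code_inj; rewrite ?ca ?ca0 //; [exact: SO | exact: Sn0 | exact:
    SO].
  + rewrite invf_div; apply: code_inj; rewrite ?ca ?ca0 //.
    * exact: SO.
    * exact: SO.
    * exact: Sn0.
  + by move=> k; rewrite fmorph_div divr_gt0 // Spos.
- move=> _ _ w /mapP[a /L'P[Sa _] ->] /mapP[b /L'P[Sb _] ->] hw e.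
  rewrite (representatives_inequiv hS Sa Sb) //; exists w.
    have [wO w'O _] := hw; split => //; exact: (tp_unit_neq0 hw).
  by rewrite -[b](divfK a00) e; field.
by rewrite map_inj_uniq // => x y /mulIf; apply; rewrite invr_eq0.
Qed.

(** A totally positive integer is a small one plus a sum of squares; the former
    is [s0 * (u^-1) ^ 2] for a representative [s0] and a unit [u], which sets
    one variable of the first block, and the latter is a value of the second
    block. *)
Lemma diagonal_form_universal (S : set K) (s : seq K) (P : nat) :
  is_representative_set R S -> (forall x, S x <-> x \in s) ->
  is_pythagoras_number K P -> is_universal R (diagonal_form s P).
Proof.
move=> [Ssmall Srep] sS [P0 bP _].
pose r : 'rV[K]_(size s + P) := row_mx (\row_(i < size s) s`_i) (const_mx 1).
have rl i : r 0 (lshift P i) = nth 0 s i by rewrite row_mxEl mxE.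
have rr i : r 0 (rshift (size s) i) = 1 by rewrite row_mxEr mxE.
have hs i : small_norm_elements R (nth 0 s (i : 'I_(size s))).
  by apply/Ssmall/sS; rewrite mem_nth.
have rO i : ring_of_integers (r 0 i).
  case: (splitP i) => j ij.
    have -> : i = lshift P j by apply/val_inj.
    by rewrite rl; have [] := hs j.
  have -> : i = rshift (size s) j by apply/val_inj.
  by rewrite rr; exact: OK1.
have rpos i : totally_positive R (r 0 i).
  case: (splitP i) => j ij.
    have -> : i = lshift P j by apply/val_inj.
    by rewrite rl; have [] := hs j.
  have -> : i = rshift (size s) j by apply/val_inj.
  by rewrite rr => sigma; rewrite rmorph1.
split.
- by move=> i j; rewrite mxE; case: eqP => _; [exact: rO | exact: OK0].
- exact: totally_positive_diag.
move=> g gO gpos.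
have [m [a [y [ha hy ->]]]] := totally_positive_decomposition htau gO gpos.
have [s0 [[Ss0 [u [u0 uO u'O] es0]] _]] := Srep a ha.
have [w wO ->] := bP m y hy.
have ltj : (index s0 s < size s)%N by rewrite index_mem; apply/sS.
pose j := Ordinal ltj.
exists (row_mx (\row_i (if i == j then u^-1 else 0)) (\row_i w i)).
  move=> i; case: (splitP i) => k ik.
    have -> : i = lshift P k by apply/val_inj.
    by rewrite row_mxEl mxE; case: eqP => _ //; exact: OK0.
  have -> : i = rshift (size s) k by apply/val_inj.
  by rewrite row_mxEr mxE.
rewrite /diagonal_form qform_diag big_split_ord /= -/r; congr (_ + _).
  rewrite (bigD1 j) //= big1 ?addr0 => [|i ij].
    rewrite rl row_mxEl mxE eqxx /j /= nth_index; last exact/sS.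
    by rewrite es0 -mulrA -exprMn divff // expr1n mulr1.
  by rewrite rl row_mxEl mxE (negbTE ij) expr0n mulr0.
by apply: eq_bigr => i _; rewrite rr row_mxEr mxE mul1r.
Qed.

End Assembly.

(** When [k > 0], the hypothesis [1 < D] bounds [ln D] from below by [ln 2], so
    that [1 + ln D] and [1] are both at most a multiple of [ln D]. *)
Lemma rank_constant (R : realType) (A N : R) (k : nat) : 0 <= A -> 0 <= N ->
  exists2 C : R, 0 < C & forall D : nat, (0 < D)%N -> ((0 < k)%N ->
    (1 < D)%N) ->
    A * (D%:R * (1 + ln D%:R) ^+ k) + N < C * D%:R * ln D%:R ^+ k.
Proof.
move=> A0 N0; pose l2 : R := ln 2.
have l20 : 0 < l2 by rewrite ln_gt0 // ltr1n.
have e1 : 0 <= (1 + l2^-1) ^+ k by rewrite exprn_ge0 // addr_ge0 // invr_ge0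
  ltW.
have e2 : 0 <= (l2^-1) ^+ k by rewrite exprn_ge0 // invr_ge0 ltW.
exists (A * (1 + l2^-1) ^+ k + N * (l2^-1) ^+ k + 1).
  by rewrite ltr_wpDl // addr_ge0 // mulr_ge0.
move=> D D0 hD; set l := ln _.
have D1 : 1 <= D%:R :> R by rewrite ler1n.
have [h1 h2 h3] : [/\ (1 + l) ^+ k <= (1 + l2^-1) ^+ k * l ^+ k,
    1 <= (l2^-1) ^+ k * l ^+ k & 0 < l ^+ k].
  have [k0|k0] := posnP k; first by rewrite k0 !expr0 !mulr1.
  have hl : l2 <= l by rewrite ler_ln ?posrE ?ltr0n // ler_nat hD.
  have l0 : 0 < l by apply: lt_le_trans hl.
  have il : 1 <= l2^-1 * l by rewrite mulrC ler_pdivlMr // mul1r.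
  split; last exact: exprn_gt0.
    rewrite -exprMn lerXn2r ?nnegrE ?addr_ge0 ?(ltW l0) //.
      by rewrite mulr_ge0 ?addr_ge0 ?invr_ge0 ?(ltW l0) ?(ltW l20).
    by rewrite mulrDl mul1r addrC lerD2l.
  by rewrite -exprMn exprn_ege1.
have DA : 0 <= A * D%:R by rewrite mulr_ge0.
have g1 : A * (D%:R * (1 + l) ^+ k) <= A * D%:R * ((1 + l2^-1) ^+ k * l ^+ k).
  by rewrite mulrA ler_wpM2l.
have g2 : N <= N * (D%:R * ((l2^-1) ^+ k * l ^+ k)).
  by rewrite ler_peMr // mulr_ege1.
have g3 : 0 < D%:R * l ^+ k by rewrite mulr_gt0 // ltr0n.
move: g1 g2 g3; move: ((1 + l2^-1) ^+ k) ((l2^-1) ^+ k) (l ^+ k) ((1 + l) ^+ k)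
  => a b c e.
by clear; lra.
Qed.

Local Open Scope classical_set_scope.
Local Open Scope ring_scope.

Theorem theorem6 (R : realType) (d : nat) (hd : (0 < d)%N) :
  exists2 C : R, 0 < C &
    forall K : fieldExtType rat,
      \dim {:K} = d -> totally_real R K ->
      forall S : set K, is_representative_set R S ->
      exists (s : seq K) (P : nat),
        [/\ uniq s /\ S = [set` s],
            is_pythagoras_number K P,
            is_universal R (diagonal_form s P)
          & (size s + P)%:R <
              C * ratr (discriminant K) * ln (ratr (discriminant K)) ^+ (d -
                1)].
Proof.
have [N hN] := bounded_sumsq d.
have A0 : 0 <= (2 ^ d)%:R :> R by rewrite ler0n.
have N0 : 0 <= N.+1%:R :> R by rewrite ler0n.
have [C C0 hC] := rank_constant (d - 1) A0 N0.
exists C => // K dK htr S hS; move: hd hN hC; rewrite -dK => dpos {}hN {}hC.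
have [tau htau] := totally_real_embeddings htr.
have [b [_ _ _ [D D0 eD]]] := discriminantP htau.
have D1 : (0 < \dim {:K} - 1)%N -> (1 < D)%N.
  by rewrite subn_gt0 => /(discriminant_gt1 htau); rewrite eD ltr1n.
have [s [us sz sS]] := bounded_set_seq (card_representatives htau hS eD).
have bN : pythagoras_bound K N.+1.
  apply: (pythagoras_bound_of_forms htau) => t.
  by have [t' h e] := hN t; exists t' => //; apply: leqW.
have [P hP PN] := pythagoras_number_exists (ltn0Sn N) bN.
exists s, P; split => //.
- by split => //; apply/seteqP; split => x /=; move/sS.
- exact: (diagonal_form_universal htau hS).
rewrite eD rmorph_nat; apply: le_lt_trans (hC D D0 D1).
rewrite natrD lerD ?ler_nat //; apply: (@le_trans _ _ (2 ^ \dim {:K} * size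
  (factorizations (\dim {:K}) D))%N%:R).
  by rewrite ler_nat.
rewrite natrM ler_wpM2l ?ler0n //.
have := @size_factorizations R (\dim {:K} - 1) D D0.
by rewrite subn1 prednK.
Qed.
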